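(* Let $\Omega\subset\mathbb{R}^n$ be an open set, let $d$ be a metric induced by a norm $\|\cdot\|$ on $\mathbb{R}^n$, and let $d\mu=w\,dx$ with $w\in L^1_{loc}(\Omega)$, $w>0$ a.e. in $\Omega$. Suppose that $w\in W^{2l,\infty}_{loc}(\Omega)$ for some given integer $l\geq 1$. Then every function $u\in\mathcal{H}(\Omega,d,w\,dx)$ (i.e. every strongly harmonic function in $\Omega$) is a weak solution to the following system of partial differential equations: $$\sum_{|\alpha|=j}A_\alpha\left(D^\alpha(uw)-u\,D^\alpha w\right)=0\qquad\text{for } j=2,4,\ldots,2l,$$ where, for a multi-index $\alpha\in\mathbb{N}^n$, $$A_\alpha:=\binom{|\alpha|}{\alpha}\int_{B(0,1)}x^\alpha\,dx=\frac{|\alpha|!}{\alpha_1!\cdots\alpha_n!}\int_{B(0,1)}x_1^{\alpha_1}\cdots x_n^{\alpha_n}\,dx .$$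
   Context: A metric $d$ is norm induced if $d(x,y)=\|x-y\|$ for a norm $\|\cdot\|$ on $\mathbb{R}^n$ (not necessarily Euclidean). $B(x,r)=\{y\in\mathbb{R}^n: d(x,y)<r\}$; in particular $B(0,1)$ is the open unit ball of the norm. For a measure $d\mu=w\,dx$ on $\Omega$, a locally integrable function $u:\Omega\to\mathbb{R}$ is called strongly harmonic in $\Omega$ if for every ball $B(x,r)$ with $B(x,r)\Subset\Omega$ (closure compact and contained in $\Omega$) there holds $$u(x)=\frac{1}{\mu(B(x,r))}\int_{B(x,r)}u(y)\,d\mu(y),\qquad \mu(B(x,r))=\int_{B(x,r)}w\,dx.$$ The set of all such functions is denoted $\mathcal{H}(\Omega,d,\mu)=\mathcal{H}(\Omega,d,w\,dx)$. Standard multi-index notation is used: $|\alpha|=\alpha_1+\dots+\alpha_n$, $x^\alpha=x_1^{\alpha_1}\cdots x_n^{\alpha_n}$, $D^\alpha=\partial_{x_1}^{\alpha_1}\cdots\partial_{x_n}^{\alpha_n}$, $\binom{|\alpha|}{\alpha}=\frac{|\alpha|!}{\alpha_1!\cdots\alpha_n!}$. That $u$ is a weak solution of the $j$-th equation means that for all $\varphi\in C_0^\infty(\Omega)$ $$\int_\Omega\varphi\sum_{|\alpha|=j}A_\alpha\left(D^\alpha(uw)-u\,D^\alpha w\right)dx=0,$$ where the derivatives are understood in the weak sense. *)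

(* Defs.v *)
From HB Require Import structures.
From mathcomp Require Import all_boot all_order all_algebra.
From mathcomp Require Import all_classical all_reals all_analysis.

Set Implicit Arguments.
Unset Strict Implicit.
Unset Printing Implicit Defensive.

Import Order.TTheory GRing.Theory Num.Theory.
Import numFieldNormedType.Exports.

Local Open Scope classical_set_scope.
Local Open Scope ring_scope.

(* MathComp-Analysis has Lebesgue measure on R only: on R^n it is
   built here as the completion of the n-fold product measure on Borel sets. *)

Section BorelRows.
Context {R : realType}.

(* An alias, so that 'rV[R]_n itself carries no canonical sigma-algebra. *)
Definition borel_rV (n : nat) : Type := 'rV[R]_n.

Definition rV_coord n (i : 'I_n) (x : borel_rV n) : measurableTypeR R :=
  (x : 'rV[R]_n) ord0 i.

HB.instance Definition _ n := Pointed.copy (borel_rV n) 'rV[R]_n.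
HB.instance Definition _ n := @isMeasurable.Build default_measure_display
  (borel_rV n) (g_sigma_preimage (@rV_coord n)) (@sigma_algebra0 _ _ _)
  (@sigma_algebraC _ _) (@sigma_algebra_bigcup _ _ _).

Definition rV_cons n (p : measurableTypeR R * borel_rV n) : borel_rV n.+1 :=
  (row_mx p.1%:M (p.2 : 'rV[R]_n) : 'rV[R]_(1 + n)).

Lemma measurable_rV_coord n (i : 'I_n) :
  measurable_fun [set: borel_rV n] (@rV_coord n i).
Proof.
move=> _ Y mY; rewrite setTI; apply: sub_sigma_algebra => /=.
rewrite -bigcup_seq/=; exists i => /=; first by rewrite mem_index_enum.
by exists Y => //; rewrite setTI.
Qed.

Lemma measurable_fun_rVP d (T : measurableType d) n (f : T -> borel_rV n) :
  (forall i, measurable_fun setT (@rV_coord n i \o f)) -> measurable_fun setT f.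
Proof.
move=> mf _ A; rewrite setTI; move: A; apply: smallest_sub.
  split => //=.
  - by rewrite preimage_set0.
  - by move=> A mA; rewrite setTD preimage_setC; exact: measurableC.
  - by move=> F mF; rewrite preimage_bigcup; exact: bigcupT_measurable.
move=> A; rewrite -bigcup_seq => -[i _ [B mB <-]].
by rewrite setTI /= -comp_preimage -[X in measurable X]setTI; exact: mf.
Qed.

Definition rV_uncons n (x : borel_rV n.+1) : measurableTypeR R * borel_rV n :=
  (rV_coord ord0 x, (\row_j rV_coord (lift ord0 j) x : 'rV[R]_n)).

Lemma rV_cons0 n p : rV_coord ord0 (@rV_cons n p) = p.1.
Proof.
have -> : (ord0 : 'I_n.+1) = lshift n (ord0 : 'I_1) by exact/val_inj.
by apply: (etrans (row_mxEl _ _ _ _)); rewrite mxE.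
Qed.

Lemma rV_consS n p j : rV_coord (lift ord0 j) (@rV_cons n p) = rV_coord j p.2.
Proof.
have -> : lift ord0 j = rshift 1 j :> 'I_n.+1 by exact/val_inj.
exact: row_mxEr.
Qed.

Lemma rV_consK n : cancel (@rV_cons n) (@rV_uncons n).
Proof.
case=> a v; congr pair; first exact: rV_cons0.
by apply/rowP => j; rewrite mxE rV_consS.
Qed.

Lemma measurable_rV_cons n : measurable_fun setT (@rV_cons n).
Proof.
apply: measurable_fun_rVP => i; case: (unliftP ord0 i) => [j|] ->.
  rewrite (_ : _ \o _ = @rV_coord n j \o snd); last first.
    by apply/funext => p /=; exact: rV_consS.
  exact: measurableT_comp (@measurable_rV_coord n j) measurable_snd.
rewrite (_ : _ \o _ = fst); first exact: measurable_fst.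
by apply/funext => p /=; exact: rV_cons0.
Qed.

Lemma measurable_rV_uncons n : measurable_fun setT (@rV_uncons n).
Proof.
apply/measurable_fun_pairP; split; first exact: measurable_rV_coord.
apply: measurable_fun_rVP => i.
rewrite (_ : _ \o _ = rV_coord (lift ord0 i)); first exact: measurable_rV_coord.
by apply/funext => x; rewrite /rV_coord /= mxE.
Qed.

End BorelRows.
Arguments borel_rV : clear implicits.

Section LebesgueRows.
Context {R : realType}.

Section step.
Context n (mu : {sigma_finite_measure set (borel_rV R n) -> \bar R}).

Definition lebesgue_cons : set (borel_rV R n.+1) -> \bar R :=
  pushforward (@lebesgue_measure R \x mu)%E (@rV_cons R n).

Let preim_cons A : measurable A -> measurable (@rV_cons R n @^-1` A).
Proof. by rewrite -[_ @^-1` _]setTI; exact: measurable_rV_cons. Qed.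

Let lebesgue_cons0 : lebesgue_cons set0 = 0%E.
Proof. by rewrite /lebesgue_cons /pushforward preimage_set0 measure0. Qed.

Let lebesgue_cons_ge0 A : (0 <= lebesgue_cons A)%E.
Proof. exact: (measure_ge0 (product_measure1 (@lebesgue_measure R) mu)). Qed.

Let lebesgue_cons_sigma_additive : semi_sigma_additive lebesgue_cons.
Proof.
move=> F mF tF mUF; rewrite /lebesgue_cons /pushforward preimage_bigcup.
apply: measure_semi_sigma_additive.
- by move=> k; exact: preim_cons.
- apply/trivIsetP => /= i j _ _ ij; rewrite -preimage_setI.
  by move/trivIsetP : tF => /(_ _ _ _ _ ij) ->//; rewrite preimage_set0.
- by rewrite -preimage_bigcup; exact: preim_cons.
Qed.

HB.instance Definition _ := isMeasure.Build _ _ _ lebesgue_cons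
  lebesgue_cons0 lebesgue_cons_ge0 lebesgue_cons_sigma_additive.

Let lebesgue_cons_sigma_finite : sigma_finite setT lebesgue_cons.
Proof.
have /sigma_finiteP[F [FT ndF Foo]] := sigma_finiteT (@lebesgue_measure R).
have /sigma_finiteP[G [GT ndG Goo]] := sigma_finiteT mu.
exists (fun k => @rV_uncons R n @^-1` (F k `*` G k)) => [|k].
  apply/esym; rewrite -subTset => x _.
  have [i _ Fi] : (\bigcup_i F i) (rV_uncons x).1 by rewrite -FT.
  have [j _ Gj] : (\bigcup_j G j) (rV_uncons x).2 by rewrite -GT.
  exists (maxn i j) => //; split.
  - by move: Fi; exact/subsetPset/ndF/leq_maxl.
  - by move: Gj; exact/subsetPset/ndG/leq_maxr.
have [mF Fkoo] := Foo k; have [mG Gkoo] := Goo k; split.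
  rewrite -[_ @^-1` _]setTI; apply: measurable_rV_uncons => //.
  exact: measurableX.
rewrite /lebesgue_cons /pushforward -comp_preimage.
rewrite (_ : _ \o _ = id) ?preimage_id; last by apply/funext; exact: rV_consK.
by rewrite product_measure1E// lte_mul_pinfty// ge0_fin_numE.
Qed.

HB.instance Definition _ := Measure_isSigmaFinite.Build _ _ _ lebesgue_cons
  lebesgue_cons_sigma_finite.

End step.

Fixpoint borel_lebesgue (n : nat) :
    {sigma_finite_measure set (borel_rV R n) -> \bar R} :=
  match n with
  | 0 => @dirac _ (borel_rV R 0) (0 : 'rV[R]_0) R
  | m.+1 => lebesgue_cons (borel_lebesgue m)
  end.

(* 'rV[R]_n with the Lebesgue (Caratheodory) sigma-algebra, which is the
   completion of the Borel one. *)
Definition lebesgue_rV_type (n : nat) : measurableType _ :=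
  caratheodory_type (borel_lebesgue n)^*%mu.

Definition lebesgue_rV (n : nat) : set (lebesgue_rV_type n) -> \bar R :=
  @completed_measure_extension _ _ _ (borel_lebesgue n).

HB.instance Definition _ n := Measure.on (@lebesgue_rV n).

Let lebesgue_rV_sigma_finite n : sigma_finite setT (@lebesgue_rV n).
Proof. exact/completed_measure_extension_sigma_finite/sigma_finiteT. Qed.

HB.instance Definition _ n := @Measure_isSigmaFinite.Build _ _ _
  (@lebesgue_rV n) (@lebesgue_rV_sigma_finite n).

End LebesgueRows.
Arguments lebesgue_rV_type : clear implicits.
Arguments lebesgue_rV : clear implicits.

Section Norms.
Context {R : realType} {n : nat}.
Implicit Types (N : 'rV[R]_n -> R) (d : 'rV[R]_n -> 'rV[R]_n -> R).

Record is_norm N : Prop := IsNorm {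
  is_norm_triangle : forall x y, N (x + y) <= N x + N y;
  is_norm_homogeneous : forall (c : R) x, N (c *: x) = `|c| * N x;
  is_norm_definite : forall x, N x = 0 -> x = 0
}.

Definition norm_induced d : Prop :=
  exists2 N, is_norm N & forall x y, d x y = N (x - y).

Definition dball d (x : 'rV[R]_n) (r : R) : set 'rV[R]_n :=
  [set y | d x y < r].

End Norms.

Section WeakDerivatives.
Context {R : realType} {n : nat}.
Implicit Types (Omega : set 'rV[R]_n) (f g phi : 'rV[R]_n -> R).

Local Notation lambda := (lebesgue_rV R n).

Definition relatively_compact_in (A : set 'rV[R]_n) Omega : Prop :=
  compact (closure A) /\ closure A `<=` Omega.

Definition multi_index : Type := {ffun 'I_n -> nat}.

Definition mi_deg (a : multi_index) : nat := (\sum_(i < n) a i)%N.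

Definition mi_pow (x : 'rV[R]_n) (a : multi_index) : R :=
  \prod_(i < n) x ord0 i ^+ a i.

Definition partial (i : 'I_n) f : 'rV[R]_n -> R := 'D_(delta_mx ord0 i) f.

Definition mi_derive (a : multi_index) f : 'rV[R]_n -> R :=
  foldr (fun i g => iter (a i) (partial i) g) f (enum 'I_n).

Definition smooth f : Prop := forall s : seq 'I_n,
  continuous (foldr partial f s) /\
  forall i x, derivable (foldr partial f s) x (delta_mx ord0 i).

(* C_0^oo(Omega); its elements are extended by 0 to the whole space. *)
Definition test_function Omega phi : Prop :=
  smooth phi /\ relatively_compact_in [set x | phi x != 0] Omega.

Definition L1_loc Omega f : Prop := forall K, compact K -> K `<=` Omega ->
  lambda.-integrable K (EFin \o f).

Definition Linfty_loc Omega f : Prop := forall K, compact K -> K `<=` Omega ->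
  (f \_ K : lebesgue_rV_type R n -> R) \in Lfun lambda +oo%E.

Definition weak_derivative Omega (a : multi_index) f g : Prop :=
  [/\ L1_loc Omega f, L1_loc Omega g &
    forall phi, test_function Omega phi ->
      \int[lambda]_(x in Omega) (f x * mi_derive a phi x) =
      (-1) ^+ mi_deg a * \int[lambda]_(x in Omega) (g x * phi x)].

(* W^{k,oo}_loc(Omega) *)
Definition sobolev_infty_loc Omega (k : nat) f : Prop :=
  forall a, (mi_deg a <= k)%N ->
    exists2 g, weak_derivative Omega a f g & Linfty_loc Omega g.

End WeakDerivatives.
Arguments multi_index : clear implicits.

Section StronglyHarmonic.
Context {R : realType} {n : nat}.
Implicit Types (Omega : set 'rV[R]_n) (d : 'rV[R]_n -> 'rV[R]_n -> R).
Implicit Types (u w : 'rV[R]_n -> R).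

Local Notation lambda := (lebesgue_rV R n).

(* Local integrability is with respect to the measure w dx. *)
Definition strongly_harmonic Omega d w u : Prop :=
  [/\ measurable_fun (Omega : set (lebesgue_rV_type R n)) u,
      L1_loc Omega (fun y => u y * w y) &
      forall (x : 'rV[R]_n) (r : R), 0 < r -> relatively_compact_in (dball d x r) Omega ->
        u x = (\int[lambda]_(y in dball d x r) w y)^-1 *
              \int[lambda]_(y in dball d x r) (u y * w y)].

Definition multinomial (a : multi_index n) : R :=
  (mi_deg a)`!%:R / \prod_(i < n) (a i)`!%:R.

Definition pde_coef d (a : multi_index n) : R :=
  multinomial a * \int[lambda]_(x in dball d 0 1) mi_pow x a.

(* [Dw a] is the weak derivative of [w] of order [a], a function determined
   up to a null set.  [D^a (u w)] is in general only a distribution: its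
   pairing with [phi] is [(-1)^|a| \int u w D^a phi].  The integrability of
   [u * Dw a] is part of the definition because [Rintegral] is total. *)
Definition weak_solution Omega d w u (j : nat) : Prop :=
  (forall a, mi_deg a = j -> exists Dw, weak_derivative Omega a w Dw) /\
  forall Dw : multi_index n -> 'rV[R]_n -> R,
  (forall a, mi_deg a = j -> weak_derivative Omega a w (Dw a)) ->
  (forall a, mi_deg a = j -> L1_loc Omega (fun x => u x * Dw a x)) /\
  forall phi, test_function Omega phi ->
    \sum_(a \in [set a : multi_index n | mi_deg a = j])
      pde_coef d a *
        ((-1) ^+ mi_deg a *
            \int[lambda]_(x in Omega) (u x * w x * mi_derive a phi x) -
         \int[lambda]_(x in Omega) (phi x * (u x * Dw a x))) = 0.

End StronglyHarmonic.

(* Main.v *)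
(* Let phi be a test function, N the norm and B_r(x) the N-ball of radius r.
   Integrating the mean value property over the ball against phi gives, for small r,
     int phi(x) int_(B_r(x)) u w dy dx = int (phi u)(x) int_(B_r(x)) w dy dx.
   Both sides have an expansion in powers of r.  On the left, moving the
   translation onto phi and applying Taylor's formula to phi, the coefficient of
   r^(n+i)/i! is the sum over |a| = i of A_a int u w D^a phi.  On the right the same
   computation with a smooth psi instead of phi u yields the coefficients
   (-1)^i A_a int psi D^a w, and, since D^a w is bounded for |a| <= m := 2k, an
   error at most C r^(n+m) |psi|_1.  As u is locally bounded, phi u is an L^1
   limit of functions phi v with v smooth, for which the error is O(r^(n+m+1)).
   Hence the expansion holds for phi u with error o(r^(n+m)), and comparing the
   coefficients of r^(n+m) gives the equation. *)

Require Import Defs.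
From mathcomp Require Import all_boot all_order all_algebra.
From mathcomp Require Import all_classical all_reals all_analysis.
From mathcomp Require Import measurable_realfun ess_sup_inf ring lra.

Set Implicit Arguments.
Unset Strict Implicit.
Unset Printing Implicit Defensive.

Import Order.TTheory GRing.Theory Num.Theory.
Import numFieldNormedType.Exports.

Local Open Scope classical_set_scope.
Local Open Scope ring_scope.

(** * Lebesgue measure on rows *)

(** Everything is localised to two compact sets: [K] carries [phi], and [L] contains all points at
    distance at most [e] from [K]. Balls of small radius centred in [K] stay in [L], so [w] and
    [u w] may be cut off outside [L] and all integrals taken over the whole space. Translations and
    dilations are applied only to Borel functions (smooth functions, indicators of open sets and
    their products), never to [u] or [w], which are merely Lebesgue measurable. Density of smooth
    functions is needed in L^1 with the integrable weight |phi|. There constants have finite norm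
    and smooth functions form an algebra, so a sigma-algebra argument starting from half-spaces
    takes the place of mollification. The same density, with another weight, closes a second gap:
    the equation concerns an arbitrary weak derivative [Dw], whereas the estimates use one that is
    bounded everywhere. Their difference is orthogonal to all smooth multiples of [phi], hence to
    [u * phi]. Only even orders carry information: the ball is symmetric, so its moments of odd
    degree vanish. *)

Lemma lebesgue_measure_affine (R : realType) (b c : R) (c0 : 0 < c)
    (f : R -> \bar R) :
  measurable_fun setT f -> (forall x, 0 <= f x)%E ->
  (c%:E * \int[lebesgue_measure]_x f (b + c * x)%R =
   \int[lebesgue_measure]_x f x)%E.
Proof.
move=> mf f0.
pose h : measurableTypeR R -> measurableTypeR R := fun x => b + c * x.
have mh : measurable_fun setT h.
  by apply: measurable_funD => //; exact: measurable_funM.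
pose P := measure_function_pushforward__canonical__measure_function_Measure
  (@lebesgue_measure R) mh.
(* [nu] is the image of Lebesgue measure under [h], scaled by [c]. Agreement on half-open intervals
   identifies it with Lebesgue measure. *)
pose nu := mscale (NngNum (ltW c0)) P.
have nuE A : measurable A -> lebesgue_measure A = nu A.
  apply: lebesgue_measure_unique => _ [[x y] _ <-].
  have hE : h @^-1` [set` `]x, y]] = `](x - b) / c, (y - b) / c]%classic.
    apply/seteqP; split => z /=; rewrite !in_itv/= /h ltr_pdivrMr// ler_pdivlMr//;
    by rewrite ltrBlDl lerBrDl (mulrC z).
  transitivity (c%:E * lebesgue_measure (h @^-1` [set` `]x, y]]))%E; last by [].
  rewrite hE.
  rewrite !lebesgue_measure_itv/= !lte_fin ltr_pM2r ?invr_gt0// ltrD2r.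
  case: ifPn => [_|]; last by rewrite mule0.
  rewrite -EFinM; congr EFin; rewrite -mulrBl mulrCA divff ?gt_eqF// mulr1.
  by rewrite opprB addrA subrK.
transitivity (\int[nu]_x f x)%E; last first.
  by apply: eq_measure_integral => A mA _; exact/esym/nuE.
rewrite ge0_integral_mscale//=; congr (_ * _)%E.
by rewrite ge0_integral_pushforward.
Qed.

(** * Affine changes of variables *)

Section affine.
Context {R : realType}.

Lemma rV_coord_affine n (b : 'rV[R]_n) (c : R) (x : 'rV[R]_n) (i : 'I_n) :
  rV_coord i (b + c *: x) = b ord0 i + c * rV_coord i x.
Proof. by rewrite /rV_coord !mxE. Qed.

Lemma measurable_rV_affine n (b : 'rV[R]_n) (c : R) :
  measurable_fun setT
    ((fun x => b + c *: x : 'rV[R]_n) : borel_rV R n -> borel_rV R n).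
Proof.
apply: measurable_fun_rVP => i.
rewrite (_ : _ \o _ = (fun x => b ord0 i + c * rV_coord i x)); last first.
  by apply/funext => x; exact: rV_coord_affine.
apply: measurable_funD => //; apply: measurable_funM => //.
exact: measurable_rV_coord.
Qed.

Lemma borel_lebesgue0 (f : borel_rV R 0 -> \bar R) :
  measurable_fun setT f -> (\int[borel_lebesgue 0]_x f x = f (0%R : 'rV[R]_0))%E.
Proof. by move=> mf; rewrite /= integral_dirac// diracT mul1e. Qed.

Lemma borel_lebesgueS n (f : borel_rV R n.+1 -> \bar R) :
  measurable_fun setT f -> (forall x, 0 <= f x)%E ->
  (\int[borel_lebesgue n.+1]_x f x =
   \int[lebesgue_measure]_x \int[borel_lebesgue n]_v f (rV_cons (x, v)))%E.
Proof.
move=> mf f0.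
transitivity (\int[pushforward (@lebesgue_measure R \x borel_lebesgue n)%E
  (@rV_cons R n)]_x f x)%E => //.
rewrite ge0_integral_pushforward//; last exact: measurable_rV_cons.
rewrite fubini_tonelli1//; last by move=> x; exact: f0.
by apply: measurableT_comp => //; exact: measurable_rV_cons.
Qed.

(** Induction on the dimension: Tonelli peels off the first coordinate, the line contributes one
    factor [c] and the other coordinates contribute [c ^+ n]. Nonnegative functions come first, so
    that integrability is not an issue; signed ones follow from their positive and negative
    parts. *)
Lemma borel_lebesgue_affine n (b : 'rV[R]_n) (c : R) (c0 : 0 < c)
    (f : borel_rV R n -> \bar R) :
  measurable_fun setT f -> (forall x, 0 <= f x)%E ->
  ((c ^+ n)%:E * \int[borel_lebesgue n]_x f ((b + c *: (x : 'rV[R]_n))%R) =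
   \int[borel_lebesgue n]_x f x)%E.
Proof.
elim: n b f => [|n ih] b f mf f0.
  have mf' : measurable_fun setT
      (fun x : borel_rV R 0 => f (b + c *: (x : 'rV[R]_0))).
    exact: (measurableT_comp mf (measurable_rV_affine b c)).
  by rewrite !borel_lebesgue0// expr0 mul1e; congr f; apply/rowP => -[].
rewrite !borel_lebesgueS//; last first.
  exact: (measurableT_comp mf (measurable_rV_affine b c)).
have mfc x : measurable_fun setT (fun v : borel_rV R n => f (rV_cons (x, v))).
  have mp : measurable_fun setT (fun v : borel_rV R n => ((x : measurableTypeR R), v)).
    exact: measurable_pair1.
  exact: (measurableT_comp mf (measurableT_comp (@measurable_rV_cons R n) mp)).
have mF : measurable_fun setT
    (fun x => \int[borel_lebesgue n]_v f (rV_cons (x, v)))%E.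
  apply: (@measurable_fun_fubini_tonelli_F _ _ _ _ R (borel_lebesgue n)
    (f \o @rV_cons R n)); last by move=> x; exact: f0.
  exact: (measurableT_comp mf (@measurable_rV_cons R n)).
pose b' : 'rV[R]_n := \row_j b ord0 (lift ord0 j).
rewrite -(lebesgue_measure_affine (b ord0 ord0) c0 mF); last first.
  by move=> x; exact: integral_ge0.
rewrite exprS EFinM -muleA; congr (_ * _)%E.
rewrite -ge0_integralZl//; last 3 first.
- apply: (@measurable_fun_fubini_tonelli_F _ _ _ _ R (borel_lebesgue n)
   ((fun x : borel_rV R n.+1 => f (b + c *: (x : 'rV[R]_n.+1))) \o @rV_cons R n)); last by move=> x; exact: f0.
  exact: (measurableT_comp (measurableT_comp mf (measurable_rV_affine b c))
           (@measurable_rV_cons R n)).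
- by move=> x _; exact: integral_ge0.
- by rewrite lee_fin exprn_ge0// ltW.
apply: eq_integral => x _.
rewrite -(ih b' (fun v => f (rV_cons (b ord0 ord0 + c * x, v))))//.
congr (_ * _)%E; apply: eq_integral => v _; congr f.
apply/rowP => i; rewrite -[LHS]/(rV_coord i _) -[RHS]/(rV_coord i _).
rewrite rV_coord_affine; case: (unliftP ord0 i) => [j|] ->.
  by rewrite !rV_consS/= rV_coord_affine mxE.
by rewrite !rV_cons0.
Qed.

End affine.

(** * Cubes, open sets, and the passage from Borel to Lebesgue measure *)

Section cube.
Context {R : realType}.

Definition rV_box n (a b : 'I_n -> R) : set (borel_rV R n) :=
  [set x | forall i, a i < rV_coord i x < b i].

Lemma measurable_rV_box n (a b : 'I_n -> R) : measurable (rV_box a b).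
Proof.
rewrite (_ : rV_box a b =
    \bigcap_(i in [set: 'I_n]) (@rV_coord R n i @^-1` `]a i, b i[%classic)).
  apply: fin_bigcap_measurable => // i _.
  by rewrite -[X in measurable X]setTI; exact: measurable_rV_coord.
apply/seteqP; split => x /=; first by move=> h i _ /=; rewrite in_itv/= h.
by move=> h i; have := h i I; rewrite /= in_itv.
Qed.

Lemma borel_lebesgue_cube n (a b : R) : a < b ->
  borel_lebesgue n (@rV_box n (fun=> a) (fun=> b)) = ((b - a) ^+ n)%:E.
Proof.
move=> ab; elim: n => [|n ih].
  by rewrite /= expr0 diracE mem_set//= => -[].
transitivity ((@lebesgue_measure R \x borel_lebesgue n)%E
  (`]a, b[%classic `*` @rV_box n (fun=> a) (fun=> b))).
  rewrite /= /lebesgue_cons /pushforward; congr (_ _).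
  apply/seteqP; split => -[x v] /=.
    move=> h; split; first by have := h ord0; rewrite rV_cons0 in_itv.
    by move=> i; have := h (lift ord0 i); rewrite rV_consS.
  rewrite in_itv/= => -[h1 h2] i; case: (unliftP ord0 i) => [j|] ->.
    by rewrite rV_consS.
  by rewrite rV_cons0.
rewrite product_measure1E//; last exact: measurable_rV_box.
transitivity ((b - a)%:E * ((b - a) ^+ n)%:E)%E; last by rewrite exprS.
congr (_ * _)%E; last exact: ih.
by have := @lebesgue_measure_itv R `]a, b[; rewrite /= lte_fin ab -EFinB.
Qed.

(** The sigma-algebra is generated by the coordinates, not by the topology. The two are linked by
    writing [U] as the union of the cubes with rational centre and half-width [1 / (k + 1)] that it
    contains; these are countably many. *)
Lemma open_measurable_rV n (U : set 'rV[R]_n) :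
  open U -> measurable (U : set (borel_rV R n)).
Proof.
move=> oU.
pose B (p : 'rV[rat]_n * nat) : set (borel_rV R n) :=
  rV_box (fun i => ratr (p.1 ord0 i) - p.2.+1%:R^-1)
         (fun i => ratr (p.1 ord0 i) + p.2.+1%:R^-1).
have -> : (U : set (borel_rV R n)) =
    \bigcup_p (if `[< B p `<=` U >] then B p else set0).
  apply/seteqP; split; last by move=> x [p _]; case: asboolP => // h /h.
  move=> x Ux.
  have /nbhs_ballP[e /= e0 eU] : nbhs (x : 'rV[R]_n) U by exact: open_nbhs_nbhs.
  (* A cube whose centre is within [1 / (k + 1)] of [x] reaches at most [2 / (k + 1)] away from
     [x]. *)
  have [k ke] : exists k : nat, 2 * k.+1%:R^-1 < e.
    exists (Num.truncn (2 / e)).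
    by rewrite ltr_pdivrMr// mulrC -ltr_pdivrMr// truncnS_gt.
  have qx i : exists q : rat, `|ratr q - rV_coord i x| < k.+1%:R^-1.
    have [q /andP[]] : exists q : rat, rV_coord i x - k.+1%:R^-1 < ratr q
        < rV_coord i x + k.+1%:R^-1.
      have [|q] := @rat_in_itvoo R (rV_coord i x - k.+1%:R^-1) (rV_coord i x + k.+1%:R^-1).
        by rewrite ltrD2l gt0_cp// invr_gt0.
      by rewrite in_itv/= => h; exists q.
    by move=> h1 h2; exists q; rewrite ltr_distl h1 h2.
  pose q : 'rV[rat]_n := \row_i sval (cid (qx i)).
  exists (q, k) => //; case: asboolP => [_|[]].
    move=> i; rewrite /q mxE; have := svalP (cid (qx i)).
    by rewrite distrC ltr_distl.
  move=> y hy; apply: eU; split=> // i j; have -> : i = ord0 by exact: ord1.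
  have := hy j; rewrite /q mxE/=; have := svalP (cid (qx j)).
  set r := ratr _; rewrite ltr_distl /ball/= ltr_distl /rV_coord.
  have key (a b s d : R) : 2 * d < e -> a - d < s -> s < a + d ->
    s - d < b -> b < s + d -> b - e < a < b + e by lra.
  by move=> /andP[h1 h2] /andP[h3 h4]; exact: key h1 h2 h3 h4.
apply: countable_bigcupT_measurable; first exact: countableP.
by move=> p; case: asboolP => // _; exact: measurable_rV_box.
Qed.

Lemma measurable_rV_continuous n (f : 'rV[R]_n -> R) :
  continuous f -> measurable_fun [set: borel_rV R n] f.
Proof.
move=> /continuousP cf; apply: (measurability _ (RGenOpens.measurableE R)).
move=> _ [_ [a [b ->] <-]]; rewrite setTI.
apply: open_measurable_rV; apply: cf; exact: interval_open.
Qed.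

Lemma measurable_borel_lebesgue n (A : set (borel_rV R n)) :
  measurable A -> measurable (A : set (lebesgue_rV_type R n)).
Proof. exact: caratheodory_measurable_mu_ext. Qed.

Lemma measurable_fun_borel_lebesgue n d (T : measurableType d)
    (f : borel_rV R n -> T) :
  measurable_fun setT f -> measurable_fun [set: lebesgue_rV_type R n] f.
Proof.
move=> mf _ B mB; apply: measurable_borel_lebesgue; exact: mf.
Qed.

Lemma lebesgue_rVE n (A : set (borel_rV R n)) :
  measurable A -> lebesgue_rV R n A = borel_lebesgue n A.
Proof. exact: measurable_mu_extE. Qed.

(** The two measures live on different sigma-algebras. The identity is measurable from the Lebesgue
    one to the Borel one, and the image measure under it is [borel_lebesgue]. *)
Lemma ge0_integral_lebesgue_rV n (f : borel_rV R n -> \bar R) :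
  measurable_fun setT f -> (forall x, 0 <= f x)%E ->
  (\int[lebesgue_rV R n]_x f x = \int[borel_lebesgue n]_x f x)%E.
Proof.
move=> mf f0.
pose i : lebesgue_rV_type R n -> borel_rV R n := id.
have mi : measurable_fun setT i.
  by apply: measurable_fun_borel_lebesgue; exact: measurable_id.
transitivity (\int[pushforward (lebesgue_rV R n) i]_x f x)%E.
  by rewrite ge0_integral_pushforward.
by apply: eq_measure_integral => A mA _; exact: lebesgue_rVE.
Qed.

Lemma ge0_lebesgue_rV_affine n (b : 'rV[R]_n) (c : R) (c0 : 0 < c)
    (f : borel_rV R n -> \bar R) :
  measurable_fun setT f -> (forall x, 0 <= f x)%E ->
  ((c ^+ n)%:E * \int[lebesgue_rV R n]_x f ((b + c *: (x : 'rV[R]_n))%R) =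
   \int[lebesgue_rV R n]_x f x)%E.
Proof.
move=> mf f0; rewrite !ge0_integral_lebesgue_rV//; first exact: borel_lebesgue_affine.
exact: (measurableT_comp mf (measurable_rV_affine b c)).
Qed.

End cube.

(** * Compact sets of rows *)

Section rows.
Context {R : realType} {n : nat}.
Implicit Types (x y : 'rV[R]_n) (K : set 'rV[R]_n).

Lemma rV_coord_le_norm x i : `|x ord0 i| <= `|x|.
Proof.
rewrite [leRHS]/Num.norm/= mx_normrE; apply/bigmax_geP; right => /=.
by exists (ord0, i).
Qed.

Lemma rV_norm_le x (M : R) : 0 <= M -> (forall i, `|x ord0 i| <= M) -> `|x| <= M.
Proof.
move=> M0 xM; rewrite [leLHS]/Num.norm/= mx_normrE; apply/bigmax_leP; split => //.
by move=> [i j] _ /=; have -> : i = ord0 by exact: ord1.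
Qed.

Lemma compact_measurable_rV K : compact K -> measurable (K : set (borel_rV R n)).
Proof.
move=> /(compact_closed (@norm_hausdorff _ _))/closed_openC/open_measurable_rV.
by move=> /measurableC; rewrite setCK.
Qed.

Lemma compact_lebesgue_fin K : compact K -> (lebesgue_rV R n K < +oo)%E.
Proof.
move=> cK; have [M [_ /(_ (M + 1))]] := compact_bounded cK.
rewrite ltrDl ltr01 => /(_ isT) KM.
apply: (@le_lt_trans _ _ (lebesgue_rV R n (@rV_box R n (fun=> - (`|M| + 2)) (fun=> `|M| + 2)))).
  apply: le_measure; rewrite ?inE.
  - exact: (measurable_borel_lebesgue (compact_measurable_rV cK)).
  - exact: (measurable_borel_lebesgue (measurable_rV_box _ _)).
  - move=> x Kx i; rewrite -ltr_norml.
    apply: (le_lt_trans (rV_coord_le_norm x i)); apply: (le_lt_trans (KM _ Kx)).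
    by have := ler_norm M; lra.
rewrite lebesgue_rVE ?borel_lebesgue_cube ?ltry//; last exact: measurable_rV_box.
by have := normr_ge0 M; lra.
Qed.

Lemma ball_lebesgue_gt0 (e : R) : 0 < e ->
  (0 < lebesgue_rV R n [set x : 'rV[R]_n | (`|x| < e)%R])%E.
Proof.
move=> e0; apply: (@lt_le_trans _ _ (lebesgue_rV R n
    (@rV_box R n (fun=> - (e / 2)) (fun=> e / 2)))).
  rewrite lebesgue_rVE; last exact: measurable_rV_box.
  rewrite borel_lebesgue_cube; last by lra.
  by rewrite lte_fin exprn_gt0//; lra.
have mb : measurable ([set x : 'rV[R]_n | `|x| < e] : set (lebesgue_rV_type R n)).
  apply: measurable_borel_lebesgue; apply: open_measurable_rV.
  exact: (open_comp (fun x _ => @norm_continuous _ _ x) (@open_lt _ e)).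
apply: le_measure; rewrite ?inE//.
  exact: (measurable_borel_lebesgue (measurable_rV_box _ _)).
move=> x xe; apply: (@le_lt_trans _ _ (e / 2)); last by lra.
apply: rV_norm_le; first by lra.
by move=> i; have := xe i; rewrite -ltr_norml => /ltW.
Qed.

(** Room for translations: a function supported in [K] may be shifted by any vector of length at
    most [e] and remains supported in [L], the sum of [K] and a closed ball. *)
Lemma compact_thicken K (U : set 'rV[R]_n) : compact K -> open U -> K `<=` U ->
  exists2 e : R, 0 < e & exists L, [/\ compact L, L `<=` U &
    forall x y, K x -> `|y - x| <= e -> L y].
Proof.
move=> cK oU KU.
have [e [e0 eU]] : exists e : R, 0 < e /\ forall x y, K x -> `|y - x| <= e -> U y.
  have := (compact_near_coveringP K).1 cK R (at_right 0)
    (fun e x => forall y, `|y - x| <= e -> U y) _.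
  have H : forall x, K x -> \forall x' \near x & e \near (0 : R)^'+,
      forall y, `|y - x'| <= e -> U y.
    move=> x Kx; have /nbhs_ballP[d /= d0 dU] : nbhs x U.
      by apply: open_nbhs_nbhs; split => //; exact: KU.
    (* Half of [d] is spent on moving the centre, half on the displacement. *)
    exists (ball x (d / 2), [set e | e < d / 2]).
      split; first by apply/nbhs_ballP; exists (d / 2) => //=; lra.
      by apply: nbhs_right_lt; lra.
    move=> [x' e] /= []; rewrite -ball_normE/= => xx' ed y yx'.
    apply: dU; rewrite -ball_normE/= -(subrKA x').
    apply: (le_lt_trans (ler_normD _ _)).
    by move: yx'; rewrite (distrC y); lra.
  move=> /(_ _ H) H'.
  near (0 : R)^'+ => e; exists e; split; first by near: e; exact: nbhs_right_gt.
  by move=> x y Kx; apply: (near H' e).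
exists e => //.
exists ((fun p : 'rV[R]_n * 'rV[R]_n => p.1 + p.2) @` (K `*` [set z | `|z| <= e])).
split.
- apply: continuous_compact; last first.
    apply: compact_setX => //; apply: bounded_closed_compact.
      exists e; split; first exact: num_real.
      by move=> M eM z /= ze; exact: le_trans ze (ltW eM).
    exact: (closed_comp (fun x _ => @norm_continuous _ _ x) (@closed_le _ e)).
  apply: continuous_subspaceT => p; exact: add_continuous.
- move=> _ [[x z]/= [Kx ze] <-]; apply: (eU x) => //.
  by rewrite addrAC subrr add0r.
- move=> x y Kx yx; exists (x, y - x) => //=.
  by rewrite addrC subrK.
Unshelve. all: by end_near. Qed.

End rows.

(** * Equivalence of norms *)

Section norms.
Context {R : realType} {n : nat} (N : 'rV[R]_n -> R) (hN : is_norm N).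

Lemma is_norm0 : N 0 = 0.
Proof. by rewrite -(scale0r 0) (is_norm_homogeneous hN) normr0 mul0r. Qed.

Lemma is_normN x : N (- x) = N x.
Proof. by rewrite -scaleN1r (is_norm_homogeneous hN) normrN1 mul1r. Qed.

Lemma is_normB x y : N (x - y) = N (y - x).
Proof. by rewrite -is_normN opprB. Qed.

Lemma is_norm_ge0 x : 0 <= N x.
Proof.
have := is_norm_triangle hN x (- x); rewrite subrr is_norm0 is_normN.
by lra.
Qed.

Lemma is_norm_ub : exists2 C : R, 0 < C & forall x, N x <= C * `|x|.
Proof.
pose S := \sum_i N (delta_mx ord0 i).
have S0 : 0 <= S by apply: sumr_ge0 => i _; exact: is_norm_ge0.
exists (1 + S) => [|x]; first by lra.
apply: (@le_trans _ _ (S * `|x|)); last first.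
  by rewrite ler_wpM2r// lerDr.
rewrite [x in leLHS]row_sum_delta /S mulr_suml.
apply: (big_ind2 (fun (a : 'rV[R]_n) b => N a <= b)).
- by rewrite is_norm0.
- by move=> a b c d ab cd; exact: le_trans (is_norm_triangle hN _ _) (lerD ab cd).
- move=> i _; rewrite (is_norm_homogeneous hN) mulrC ler_wpM2l ?is_norm_ge0//.
  exact: rV_coord_le_norm.
Qed.

Lemma is_norm_continuous : continuous N.
Proof.
have [C C0 NC] := is_norm_ub.
move=> x; apply/(@cvgrPdist_lt _ _ _ (nbhs x) (nbhs_filter x)) => e e0.
apply/nbhs_ballP; exists (e / C) => /=; first exact: divr_gt0.
move=> y; rewrite -ball_normE/= ltr_pdivlMr// mulrC => xy.
apply: le_lt_trans xy; apply: le_trans (NC _).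
have := is_norm_triangle hN (x - y) y; have := is_norm_triangle hN (y - x) x.
by rewrite !subrK is_normB ler_norml; lra.
Qed.

(** [c] is the minimum of [N] on the unit sphere, attained by compactness and positive by
    definiteness. *)
Lemma is_norm_lb : exists2 c : R, 0 < c & forall x, c * `|x| <= N x.
Proof.
pose S := [set x : 'rV[R]_n | `|x| = 1].
have cS : compact S.
  apply: bounded_closed_compact.
    by exists 1; split => // M M1 x /= ->; exact: ltW.
  exact: (closed_comp (fun x _ => @norm_continuous _ _ x) (@closed_eq _ 1)).
(* The sphere is empty in dimension 0, where every vector is zero and any constant works. *)
have [S0|/set0P S0] := eqVneq S set0.
  exists 1 => // x; have [->|x0] := eqVneq x 0.
    by rewrite normr0 mulr0 is_norm_ge0.
  suff : S (`|x|^-1 *: x) by rewrite S0.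
  by rewrite /S/= normrZ normfV normr_id mulVf// normr_eq0.
have [m] := EVT_min_rV S0 cS (continuous_subspaceT is_norm_continuous).
rewrite inE => Sm mN; exists (N m).
  rewrite lt_neqAle is_norm_ge0 andbT eq_sym; apply/eqP => /(is_norm_definite hN) m0.
  by move: Sm; rewrite /S/= m0 normr0 => /esym/eqP; rewrite oner_eq0.
move=> x; have [->|x0] := eqVneq x 0.
  by rewrite normr0 mulr0 is_norm_ge0.
have Sx : S (`|x|^-1 *: x).
  by rewrite /S/= normrZ normfV normr_id mulVf// normr_eq0.
have := mN _ (mem_set Sx).
by rewrite (is_norm_homogeneous hN) normfV normr_id mulrC ler_pdivlMr ?normr_gt0.
Qed.

End norms.

(** * Smooth functions and Taylor expansion *)

Section line_derivative.
Context {R : realType} {n : nat}.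
Implicit Types (f g : 'rV[R]_n -> R) (x y z v : 'rV[R]_n).

(** The difference quotients of [f] along [v] and of its restriction to the line are the same
    function, so derivability and the value of the derivative transfer together. *)
Lemma line_quotientE f y v (t : R) :
  (fun h : R => h^-1 *: (((fun s : R => f (y + s *: v)) \o shift t) (h *: 1) -
     f (y + t *: v))) =
  (fun h : R => h^-1 *: ((f \o shift (y + t *: v)) (h *: v) - f (y + t *: v))).
Proof.
apply/funext => h /=; congr (_ *: (f _ - _)).
by rewrite [h *: 1]mulr1 scalerDl addrCA.
Qed.

Lemma is_derive_line f y v (t df : R) :
  is_derive (y + t *: v) v f df ->
  is_derive t 1 (fun s : R => f (y + s *: v)) df.
Proof.
move=> [dfv <-]; apply: DeriveDef.
  by rewrite /derivable line_quotientE.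
by rewrite /derive line_quotientE.
Qed.

Lemma is_derive_of_line f y v (df : R) :
  is_derive (0 : R) 1 (fun s : R => f (y + s *: v)) df -> is_derive y v f df.
Proof.
move=> [+ <-]; have y0 : y = y + 0 *: v by rewrite scale0r addr0.
rewrite /derivable /derive line_quotientE -y0 => h.
exact: DeriveDef.
Qed.

Lemma is_derive_mulr (c t : R) : is_derive t 1 (fun s : R => s * c) c.
Proof. by apply: is_derive_eq; rewrite scaler0 add0r; exact: mulr1. Qed.

(** The intermediate point is parametrised by [t] in [0, 1], which makes the formula insensitive to
    the sign of [s]. *)
Lemma MVT_line f y v : (forall x, derivable f x v) ->
  forall s : R, exists2 t : R, 0 <= t <= 1 &
    f (y + s *: v) - f y = s * 'D_v f (y + (t * s) *: v).
Proof.
move=> df s.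
pose g t := f (y + t *: (s *: v)).
have dg (t : R) : is_derive t 1 g (s * 'D_v f (y + (t * s) *: v)).
  have dl : is_derive (t * s) 1 (fun u : R => f (y + u *: v))
      ('D_v f (y + (t * s) *: v)).
    by apply: is_derive_line; exact: DeriveDef.
  have -> : g = (fun u : R => f (y + u *: v)) \o (fun t : R => t * s).
    by apply/funext => u; rewrite /g/= scalerA.
  by rewrite mulrC; exact: (@is_derive1_comp _ (fun u : R => f (y + u *: v))
    (fun t : R => t * s) t _ _ dl (is_derive_mulr s t)).
have [|t] := @MVT_segment R g (fun t => s * 'D_v f (y + (t * s) *: v)) 0 1 ler01
    (fun t _ => dg t).
  apply: continuous_subspaceT => t; apply: differentiable_continuous.
  by apply/derivable1_diffP; have [] := dg t.
rewrite in_itv/= => t01; rewrite subr0 mulr1 /g scale0r addr0 scale1r => ->.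
by exists t.
Qed.

End line_derivative.

(** * The algebra of smooth functions *)

Section smooth.
Context {R : realType} {n : nat}.
Implicit Types (f g : 'rV[R]_n -> R) (x y z : 'rV[R]_n).
Local Notation e i := (delta_mx ord0 i : 'rV[R]_n).

(** A coinduction principle: closure of one well-chosen class under [partial] replaces an induction
    on the list of derivatives in each of the closure properties below. *)
Lemma smooth_class (S : ('rV[R]_n -> R) -> Prop) :
  (forall f, S f -> [/\ continuous f, forall i x, derivable f x (e i) &
    forall i, S (partial i f)]) ->
  forall f, S f -> smooth f.
Proof.
move=> HS f Sf s.
have /HS[] // : S (foldr partial f s).
by elim: s => //= i s /HS[].
Qed.

Lemma smooth_continuous f : smooth f -> continuous f.
Proof. by move=> sf; have [] := sf [::]. Qed.

Lemma smooth_derivable f i x : smooth f -> derivable f x (e i).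
Proof. by move=> sf; have [_] := sf [::]; exact. Qed.

Lemma smooth_partial f i : smooth f -> smooth (partial i f).
Proof. by move=> sf s; have := sf (rcons s i); rewrite foldr_rcons. Qed.

Lemma partial_cst (a : R) i : partial i (cst a) = cst 0 :> ('rV[R]_n -> R).
Proof. by apply/funext => x; rewrite /partial derive_cst. Qed.

Lemma partialD f g i : smooth f -> smooth g ->
  partial i (f + g) = partial i f + partial i g.
Proof.
move=> sf sg; apply/funext => x; rewrite /partial.
by rewrite deriveD//; exact: smooth_derivable.
Qed.

Lemma partialM f g i : smooth f -> smooth g ->
  partial i (f * g) = f * partial i g + g * partial i f.
Proof.
move=> sf sg; apply/funext => x; rewrite /partial.
by rewrite deriveM//; exact: smooth_derivable.
Qed.

Lemma smooth_cst (a : R) : smooth (cst a : 'rV[R]_n -> R).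
Proof.
refine (@smooth_class (fun f => exists b, f = cst b) _ _ _); last by exists a.
move=> _ [b ->]; split; first exact: cst_continuous.
  by move=> i x; exact: derivable_cst.
by move=> i; exists 0; rewrite partial_cst.
Qed.

Lemma smoothD f g : smooth f -> smooth g -> smooth (f + g).
Proof.
move=> sf sg; refine (@smooth_class (fun h => exists f1 g1,
  [/\ smooth f1, smooth g1 & h = f1 + g1]) _ _ _); last by exists f, g; split.
move=> _ [f1 [g1 [sf1 sg1 ->]]]; split.
- by move=> x; apply: continuousD; exact: smooth_continuous.
- by move=> i x; apply: derivableD; exact: smooth_derivable.
- move=> i; exists (partial i f1), (partial i g1).
  split; [exact: (@smooth_partial f1 i sf1)|exact: (@smooth_partial g1 i sg1)|].
  exact: (@partialD f1 g1 i sf1 sg1).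
Qed.

(** By Leibniz's rule a partial derivative of a product is a sum of products; closing under sums
    yields a class to which [smooth_class] applies. *)
Inductive product_span : ('rV[R]_n -> R) -> Prop :=
| product_spanM f g : smooth f -> smooth g -> product_span (f * g)
| product_spanD f g : product_span f -> product_span g -> product_span (f + g).

Lemma smoothM f g : smooth f -> smooth g -> smooth (f * g).
Proof.
move=> sf sg; refine (@smooth_class product_span _ _ _); last exact: product_spanM.
move=> h; elim => {h} [f1 g1 sf1 sg1|f1 g1 _ [cf df pf] _ [cg dg pg]].
  split.
  - by move=> x; apply: continuousM; exact: smooth_continuous.
  - by move=> i x; apply: derivableM; exact: smooth_derivable.
  - move=> i; rewrite (@partialM f1 g1 i sf1 sg1); apply: product_spanD.
      exact: (product_spanM sf1 (@smooth_partial g1 i sg1)).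
    exact: (product_spanM sg1 (@smooth_partial f1 i sf1)).
split.
- by move=> x; apply: continuousD; [exact: cf|exact: cg].
- by move=> i x; apply: derivableD.
- move=> i; have -> : partial i (f1 + g1) = partial i f1 + partial i g1.
    by apply/funext => x; rewrite /partial deriveD.
  exact: product_spanD.
Qed.

Lemma is_derive_exp f x v : derivable f x v ->
  is_derive x v (expR \o f) (expR (f x) * 'D_v f x).
Proof.
move=> df; apply: is_derive_of_line.
have x0 : f x = f (x + 0 *: v) by rewrite scale0r addr0.
have dl : is_derive (0 : R) 1 (fun s : R => f (x + s *: v)) ('D_v f x).
  by apply: is_derive_line; rewrite scale0r addr0; exact: DeriveDef.
rewrite [in expR _]x0.
exact: (@is_derive1_comp _ expR (fun s : R => f (x + s *: v)) 0 _ _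
  (is_derive_expR (f (x + 0 *: v))) dl).
Qed.

Lemma smooth_exp f : smooth f -> smooth (expR \o f).
Proof.
(* The class of products [g * exp f] is stable, since differentiation replaces [g] by
   [partial i g + g * partial i f]. *)
move=> sf; refine (@smooth_class (fun h => exists2 g, smooth g & h = g * (expR \o f)) _ _ _).
  move=> _ [g sg ->].
  have de i x : derivable (expR \o f) x (e i).
    by have [] := is_derive_exp (@smooth_derivable f i x sf).
  split.
  - move=> x; apply: continuousM; first exact: smooth_continuous.
    apply: continuous_comp; first exact: smooth_continuous.
    exact: continuous_expR.
  - move=> i x; apply: derivableM; [exact: (@smooth_derivable g i x sg)|exact: de].
  - move=> i; exists (partial i g + g * partial i f).
      exact: (smoothD (@smooth_partial g i sg) (smoothM sg (@smooth_partial f i sf))).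
    apply/funext => x.
    rewrite /partial (deriveM (@smooth_derivable g i x sg) (de i x)).
    have [_ ->] := is_derive_exp (@smooth_derivable f i x sf).
    rewrite !fctE /= /GRing.scale/=; ring.
by exists (cst 1); [exact: smooth_cst|apply/funext => x; rewrite fctE/= mul1r].
Qed.

Lemma smooth_coord i : smooth (fun x : 'rV[R]_n => x ord0 i).
Proof.
have dc x j : is_derive x (e j) (fun x : 'rV[R]_n => x ord0 i) (i == j)%:R.
  apply: is_derive_of_line.
  have -> : (fun s : R => (x + s *: e j) ord0 i) = (fun s => x ord0 i + s * (i == j)%:R).
    by apply/funext => s; rewrite !mxE eqxx.
  rewrite -[X in is_derive _ _ _ X]add0r.
  exact: (is_deriveD (is_derive_cst _ _ _) (is_derive_mulr _ _)).
refine (@smooth_class (fun h => h = (fun x : 'rV[R]_n => x ord0 i) \/ smooth h) _ _ _); last by left.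
move=> h [->|sh]; split.
- by move=> x; exact: coord_continuous.
- by move=> j x; have [] := dc x j.
- move=> j; right; have -> : partial j (fun x : 'rV[R]_n => x ord0 i) = cst (i == j)%:R.
    by apply/funext => x; have [_] := dc x j.
  exact: smooth_cst.
- exact: smooth_continuous.
- by move=> j x; exact: smooth_derivable.
- by move=> j; right; exact: smooth_partial.
Qed.

Lemma smoothN f : smooth f -> smooth (- f).
Proof.
move=> sf; have -> : - f = cst (-1) * f by apply/funext => x; rewrite !fctE mulN1r.
exact: (smoothM (smooth_cst (-1)) sf).
Qed.

Lemma smoothB f g : smooth f -> smooth g -> smooth (f - g).
Proof. by move=> sf sg; exact: (smoothD sf (smoothN sg)). Qed.

Lemma shift_quotientE f (a x v : 'rV[R]_n) :
  (fun h : R => h^-1 *: (((f \o shift a) \o shift x) (h *: v) - (f \o shift a) x)) =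
  (fun h : R => h^-1 *: ((f \o shift (x + a)) (h *: v) - f (x + a))).
Proof. by apply/funext => h /=; rewrite addrA. Qed.

Lemma partial_shift f (a : 'rV[R]_n) i :
  partial i (f \o shift a) = partial i f \o shift a.
Proof.
by apply/funext => x; rewrite /partial /derive shift_quotientE.
Qed.

Lemma foldr_partial_shift f (a : 'rV[R]_n) s :
  foldr partial (f \o shift a) s = foldr partial f s \o shift a.
Proof. by elim: s => //= i s ->; rewrite partial_shift. Qed.

Lemma smooth_shift f (a : 'rV[R]_n) : smooth f -> smooth (f \o shift a).
Proof.
move=> sf s; rewrite foldr_partial_shift; have [cf df] := sf s; split.
  move=> x; apply: continuous_comp; last exact: cf.
  by apply: continuousD; [exact: id|exact: cst_continuous].
by move=> i x; rewrite /derivable shift_quotientE; exact: df.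
Qed.

Lemma partial_support f (K : set 'rV[R]_n) i : closed K ->
  (forall x, ~ K x -> f x = 0) -> forall x, ~ K x -> partial i f x = 0.
Proof.
move=> cK f0 x Kx; rewrite /partial.
have /near_eq_derive -> : \forall y \near x, f y = cst 0 y.
  have : nbhs x (~` K) by apply: open_nbhs_nbhs; split => //; exact: closed_openC.
  by apply: filterS => y; exact: f0.
by rewrite derive_cst.
Qed.

Lemma foldr_partial_support f (K : set 'rV[R]_n) s : closed K ->
  (forall x, ~ K x -> f x = 0) -> forall x, ~ K x -> foldr partial f s x = 0.
Proof. by move=> cK f0; elim: s => //= i s; exact: partial_support. Qed.

End smooth.

(** * Directional derivatives and the symmetry of second derivatives *)

Section smooth_theory.
Context {R : realType} {n : nat}.
Implicit Types (f g : 'rV[R]_n -> R) (x y z : 'rV[R]_n).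
Local Notation e i := (delta_mx ord0 i : 'rV[R]_n).

Lemma continuous_dist f x (eps : R) : continuous f -> 0 < eps ->
  exists2 d : R, 0 < d & forall y, `|y - x| < d -> `|f y - f x| < eps.
Proof.
move=> cf e0; have /(@cvgrPdist_lt _ _ _ (nbhs x) (nbhs_filter x)) := cf x.
move=> /(_ _ e0)/nbhs_ballP[d /= d0 dx]; exists d => // y yx.
by rewrite distrC; apply: dx; rewrite -ball_normE/= distrC.
Qed.

Let trunc z (m : nat) : 'rV[R]_n := \row_k (if (k < m)%N then z ord0 k else 0).

Let truncS z (m : 'I_n) : trunc z m.+1 = trunc z m + z ord0 m *: e m.
Proof.
apply/rowP => k; rewrite !mxE eqxx/= ltnS leq_eqVlt.
have [->|km] := eqVneq k m; first by rewrite eqxx ltnn mulr1 add0r.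
by rewrite (negbTE (_ : (k != m :> nat)))//= mulr0 addr0.
Qed.

(** [smooth] speaks only of the coordinate directions. The step from [x] to [x + h *: z] is made one
    coordinate at a time ([trunc z m] keeps the first [m] coordinates); the mean value theorem on
    each leg and continuity of the partial derivatives give the limit. *)
Lemma smooth_is_derive f x z : smooth f ->
  is_derive x z f (\sum_i z ord0 i * partial i f x).
Proof.
move=> sf.
have H : (fun h : R => h^-1 *: ((f \o shift x) (h *: z) - f x)) @ 0^' -->
    \sum_i z ord0 i * partial i f x.
  have -> : (fun h : R => h^-1 *: ((f \o shift x) (h *: z) - f x)) =
      (fun h : R => \sum_(m < n)
        h^-1 * (f (x + h *: trunc z m.+1) - f (x + h *: trunc z m))).
    apply/funext => h; rewrite -mulr_sumr.
    rewrite -(big_mkord xpredT (fun m => f (x + h *: trunc z m.+1) - f (x + h *: trunc z m))).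
    rewrite telescope_sumr//; congr (_ * (f _ - f _)).
      rewrite /= addrC (_ : trunc z n = z)//.
      by apply/rowP => k; rewrite mxE ltn_ord.
    rewrite (_ : trunc z 0 = 0) ?scaler0 ?addr0//.
    by apply/rowP => k; rewrite !mxE ltn0.
  apply: cvg_big; [exact: add_continuous|move=> m _].
  apply/cvgrPdist_lt => eps eps0.
  have cm : continuous (cst (z ord0 m) * partial m f).
    move=> y; apply: continuousM; first exact: cst_continuous.
    exact: (@smooth_continuous _ _ _ (@smooth_partial _ _ f m sf) y).
  have [d d0 Hd] := continuous_dist x cm eps0.
  have z0 := normr_ge0 z.
  near=> h.
  have h0 : h != 0 by near: h; exact: nbhs_dnbhs_neq.
  (* Every intermediate point is within [|h| * |z|] of [x]; the added 1 keeps the divisor positive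
     when [z = 0]. *)
  have hd : `|h| * (1 + `|z|) < d.
    rewrite -ltr_pdivlMr; last by lra.
    near: h; apply: dnbhs0_lt; apply: divr_gt0 => //; lra.
  rewrite truncS scalerDr scalerA addrA.
  have [t t01 ->] := MVT_line (x + h *: trunc z m)
    (fun y => @smooth_derivable _ _ f m y sf) (h * z ord0 m).
  rewrite -mulrA mulKf// distrC.
  apply: (Hd (x + h *: trunc z m + (t * (h * z ord0 m)) *: e m)).
  rewrite addrC !addrA addNr add0r.
  apply: le_lt_trans hd; apply: rV_norm_le.
    by rewrite mulr_ge0//; lra.
  move=> k; rewrite !mxE eqxx/=.
  have zk := rV_coord_le_norm z k.
  have [->|km] := eqVneq k m.
    rewrite ltnn mulr0 add0r mulr1 !normrM.
    case/andP: t01 => t0 t1; rewrite (ger0_norm t0).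
    apply: (@le_trans _ _ (`|h| * `|z ord0 m|)).
      by rewrite ler_piMl// mulr_ge0.
    by rewrite ler_wpM2l//; have := rV_coord_le_norm z m; lra.
  rewrite mulr0 addr0; case: ifP => _; rewrite ?mulr0 ?normr0 ?normrM.
    by rewrite ler_wpM2l//; lra.
  by rewrite mulr_ge0//; lra.
apply: DeriveDef.
  by apply/cvg_ex; exists (\sum_i z ord0 i * partial i f x).
exact/cvg_lim.
Unshelve. all: by end_near. Qed.

Let second_difference f x i j (h : R) :=
  f (x + h *: e i + h *: e j) - f (x + h *: e i) - f (x + h *: e j) + f x.

Let second_difference_MVT f x i j (h : R) : smooth f -> 0 <= h ->
  exists2 p, `|p - x| <= 2 * h &
    second_difference f x i j h = h ^+ 2 * partial j (partial i f) p.
Proof.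
move=> sf h0.
pose g := f \o shift (h *: e j) - f.
have sg : smooth g := smoothB (@smooth_shift _ _ f (h *: e j) sf) sf.
have [t /andP[t0 t1] tE] := MVT_line x (fun y => @smooth_derivable _ _ g i y sg) h.
have [s /andP[s0 s1] sE] := MVT_line (x + (t * h) *: e i)
  (fun y => @smooth_derivable _ _ _ j y (@smooth_partial _ _ f i sf)) h.
exists (x + (t * h) *: e i + (s * h) *: e j).
  rewrite addrC !addrA addNr add0r; apply: (le_trans (ler_normD _ _)).
  rewrite !normrZ.
  have e1 k : `|e k| <= 1.
    by apply: rV_norm_le => // l; rewrite !mxE eqxx/=; case: (l == k); rewrite ?normr1 ?normr0.
  rewrite !ger0_norm//.
  have := e1 i; have := e1 j; have := normr_ge0 (e i); have := normr_ge0 (e j).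
  move=> *.
  have : t * h * `|e i| <= h.
    by rewrite -[leRHS]mulr1 ler_pM ?mulr_ge0// ler_piMl.
  have : s * h * `|e j| <= h.
    by rewrite -[leRHS]mulr1 ler_pM ?mulr_ge0// ler_piMl.
  by lra.
transitivity (g (x + h *: e i) - g x).
  by rewrite /second_difference /g !fctE/=; ring.
rewrite tE expr2 -mulrA; congr (_ * _).
have -> y : 'D_(e i) g y = partial i f (y + h *: e j) - partial i f y.
  rewrite /g deriveB; last 2 first.
  - exact: (@smooth_derivable _ _ _ i y (@smooth_shift _ _ f (h *: e j) sf)).
  - exact: smooth_derivable.
  by congr (_ - _); exact: (congr1 (@^~ y) (partial_shift f (h *: e j) i)).
by rewrite sE.
Qed.

(** Schwarz's theorem. The second difference is symmetric in [i] and [j], and two uses of the mean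
    value theorem express it as [h ^+ 2] times either mixed derivative at a point within [2 * h] of
    [x]; continuity does the rest. *)
Lemma partialC f i j : smooth f ->
  partial i (partial j f) = partial j (partial i f).
Proof.
move=> sf; apply/funext => x.
apply/eqP; rewrite -subr_eq0 -normr_le0; apply/ler_addgt0Pr => eps eps0.
have eps2 : 0 < eps / 2 by lra.
have key (a b c : R) : `|c - a| < eps / 2 -> `|c - b| < eps / 2 -> `|a - b| <= 0 + eps.
  by rewrite !ltr_norml ler_norml; lra.
have cc k l : continuous (partial k (partial l f)).
  apply: smooth_continuous; apply: smooth_partial; exact: smooth_partial.
have [d1 d10 H1] := continuous_dist x (cc i j) eps2.
have [d2 d20 H2] := continuous_dist x (cc j i) eps2.
pose h := Num.min d1 d2 / 4.
have m0 : 0 < Num.min d1 d2 by rewrite lt_min d10 d20.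
have h0 : 0 < h by rewrite /h; lra.
have hd1 : 2 * h < d1.
  by apply: (@lt_le_trans _ _ (Num.min d1 d2)); [rewrite /h; lra|rewrite ge_min lexx].
have hd2 : 2 * h < d2.
  by apply: (@lt_le_trans _ _ (Num.min d1 d2)); [rewrite /h; lra|rewrite ge_min lexx orbT].
have [p px pE] := second_difference_MVT x j i sf (ltW h0).
have [q qx qE] := second_difference_MVT x i j sf (ltW h0).
have pq : partial i (partial j f) p = partial j (partial i f) q.
  apply: (mulfI (lt0r_neq0 (exprn_gt0 2 h0))).
  apply: (etrans (esym pE)); apply: (etrans _ qE).
  rewrite /second_difference (addrAC x).
  by rewrite (addrAC (f (x + h *: e i + h *: e j))).
apply: key (H1 _ (le_lt_trans px hd1)) _.
by rewrite pq; exact: H2 _ (le_lt_trans qx hd2).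
Qed.

End smooth_theory.

(** * Derivatives indexed by multi-indices *)

Section multi_index_derivative.
Context {R : realType} {n : nat}.
Implicit Types (f g : 'rV[R]_n -> R) (x y z : 'rV[R]_n) (a : multi_index n).

Definition mi_incr a k : multi_index n := [ffun i => (a i + (i == k))%N].

Lemma mi_deg_incr a k : mi_deg (mi_incr a k) = (mi_deg a).+1.
Proof.
rewrite /mi_deg; under eq_bigr do rewrite ffunE.
rewrite big_split/= -[RHS]addn1; congr (_ + _)%N.
by rewrite (bigD1 k)//= eqxx big1// => i /negbTE ->.
Qed.

Lemma mi_pow_incr x a k : mi_pow x (mi_incr a k) = x ord0 k * mi_pow x a.
Proof.
rewrite /mi_pow; under eq_bigr do rewrite ffunE exprD.
rewrite big_split/= mulrC; congr (_ * _).
rewrite (bigD1 k)//= eqxx expr1 big1 ?mulr1// => i /negbTE ->.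
by rewrite expr0.
Qed.

Lemma smooth_iter_partial f i m : smooth f -> smooth (iter m (partial i) f).
Proof.
by move=> sf; elim: m => [|m ih]; [exact: sf|exact: (@smooth_partial _ _ _ i ih)].
Qed.

Let mi_derive_seq a f (s : seq 'I_n) :=
  foldr (fun i g => iter (a i) (partial i) g) f s.

Let smooth_mi_derive_seq a f s : smooth f -> smooth (mi_derive_seq a f s).
Proof.
by move=> sf; elim: s => [|i s ih]; [exact: sf|exact: (@smooth_iter_partial _ i (a i) ih)].
Qed.

Lemma smooth_mi_derive a f : smooth f -> smooth (mi_derive a f).
Proof. exact: smooth_mi_derive_seq. Qed.

Lemma iter_partialC f i k m : smooth f ->
  iter m (partial i) (partial k f) = partial k (iter m (partial i) f).
Proof.
move=> sf; elim: m => [|m ih]; first by [].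
by rewrite !iterS ih (partialC i k (@smooth_iter_partial f i m sf)).
Qed.

(** [mi_derive] applies the partial derivatives in the order of [enum], so the additional one arises
    in the middle and is commuted to the outside. *)
Lemma mi_derive_incr a f k : smooth f ->
  mi_derive (mi_incr a k) f = partial k (mi_derive a f).
Proof.
move=> sf.
(* Generalised to duplicate-free lists for the induction; [k] meets at most one entry. *)
have H s : uniq s -> mi_derive_seq (mi_incr a k) f s =
    if k \in s then partial k (mi_derive_seq a f s) else mi_derive_seq a f s.
  elim: s => //= i s ih /andP[is_ us]; rewrite in_cons ffunE ih// => {ih}.
  have [<-|ki] := eqVneq i k.
    by rewrite /= (negbTE is_) addn1 iterS.
  rewrite /= addn0; case: ifP => // _.
  by apply: iter_partialC; exact: (@smooth_mi_derive_seq a f s sf).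
by rewrite /mi_derive [LHS](H _ (enum_uniq _)) mem_enum.
Qed.

Lemma mi_deriveE a f : exists s, mi_derive a f = foldr partial f s.
Proof.
rewrite /mi_derive; elim: (enum _) => [|i s [t ih]]; first by exists [::].
exists (nseq (a i) i ++ t); rewrite foldr_cat -ih /=.
by elim: (a i) => //= m ->.
Qed.

Lemma mi_derive0 a f : mi_deg a = 0%N -> mi_derive a f = f.
Proof.
move=> /eqP; rewrite sum_nat_eq0 => /forallP a0.
by rewrite /mi_derive; elim: (enum _) => //= i s ->; rewrite (eqP (a0 i)).
Qed.

End multi_index_derivative.

(** * Taylor's formula, and polynomials that are small near 0 *)

Section taylor.
Context {R : realType}.

Lemma is_derive_pow_fact (c : R) (i : nat) (t : R) :
  is_derive t 1 (fun s : R => c * s ^+ i.+1 / i.+1`!%:R) (c * t ^+ i / i`!%:R).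
Proof.
have -> : (fun s : R => c * s ^+ i.+1 / i.+1`!%:R) =
    (c / i.+1`!%:R) \*: (fun s : R => s ^+ i.+1).
  by apply/funext => s /=; rewrite /GRing.scale/= mulrAC.
have D : is_derive t 1 (fun s : R => s ^+ i.+1) (i.+1%:R * t ^+ i).
  apply: DeriveDef; first exact: exprn_derivable.
  by rewrite exp_derive /GRing.scale/= mulr1.
apply: is_derive_eq; rewrite /GRing.scale/= factS natrM invfM.
have f0 : i`!%:R != 0 :> R by rewrite pnatr_eq0 -lt0n fact_gt0.
have s0 : i.+1%:R != 0 :> R by rewrite pnatr_eq0.
by field; apply/andP.
Qed.

(** [F i] plays the role of the [i]-th derivative. The derivative of the remainder of order [m + 1]
    is the remainder of order [m] of the shifted family, and the mean value theorem costs a factor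
    [t <= 1]. The usual [1 / m!] is given up, as only the order of magnitude matters later. *)
Lemma taylor_bound (F : nat -> R -> R) (m : nat) (M : R) :
  (forall i (t : R), is_derive t 1 (F i) (F i.+1 t)) ->
  (forall t, 0 <= t <= 1 -> `|F m t| <= M) ->
  forall t, 0 <= t <= 1 -> `|F 0%N t - \sum_(i < m) F i 0 * t ^+ i / i`!%:R| <= M.
Proof.
elim: m F => [|m ih] F dF FM t t01; first by rewrite big_ord0 subr0 FM.
have {ih}IH := ih (fun i => F i.+1) (fun i => dF i.+1) FM.
pose P s := F 0%N s - \sum_(i < m.+1) F i 0 * s ^+ i / i`!%:R.
pose p s := F 1%N s - \sum_(i < m) F i.+1 0 * s ^+ i / i`!%:R.
have dP (s : R) : is_derive s 1 P (p s).
  have -> : P = F 0%N - (cst (F 0%N 0) +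
      \sum_(i < m) (fun s => F i.+1 0 * s ^+ i.+1 / i.+1`!%:R)).
    apply/funext => r; rewrite !fctE fct_sumE /P big_ord_recl expr0 mulr1 divr1.
    by [].
  apply: is_deriveB; rewrite -[X in is_derive _ _ _ X]add0r.
  apply: is_deriveD.
  elim/big_ind2 : _ => [|f a g b df dg|i _].
  - exact: is_derive_cst.
  - exact: is_deriveD.
  - exact: is_derive_pow_fact.
have P0 : P 0 = 0.
  rewrite /P big_ord_recl expr0 mulr1 divr1 big1 ?addr0 ?subrr// => i _.
  by rewrite exprS mul0r mulr0 mul0r.
have [t0 t1] := andP t01.
have [|s sI] := @MVT_segment R P p 0 t t0 (fun s _ => dP s).
  apply: continuous_subspaceT => s; apply: differentiable_continuous.
  by apply/derivable1_diffP; have [] := dP s.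
rewrite P0 !subr0 -/(P t) => ->.
move: sI; rewrite in_itv/= => /andP[s0 st].
rewrite normrM (ger0_norm t0).
have s01 : 0 <= s <= 1 by rewrite s0 (le_trans st).
have := IH s s01; rewrite -/(p s) => ps.
by rewrite -[leRHS]mulr1 ler_pM.
Qed.

(** Letting [r] tend to 0 kills the constant coefficient; after division by [r] the remaining
    polynomial satisfies the same hypothesis with [m] lowered by one. *)
Lemma poly_little_o (m : nat) (c : nat -> R) :
  (forall eps : R, 0 < eps -> exists2 rho : R, 0 < rho &
    forall r, 0 < r -> r < rho -> `|\sum_(i < m.+1) c i * r ^+ i| <= eps * r ^+ m) ->
  forall i, (i <= m)%N -> c i = 0.
Proof.
elim: m c => [|m ih] c H.
  move=> [|//] _; apply/eqP; rewrite -normr_le0; apply/ler_addgt0Pr => eps e0.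
  have [rho rho0 /(_ (rho / 2))] := H _ e0.
  by rewrite big_ord_recl big_ord0 !expr0 !mulr1 addr0 add0r; apply; lra.
have c0 : c 0%N = 0.
  apply/eqP; rewrite -normr_le0; apply/ler_addgt0Pr => eps e0; rewrite add0r.
  pose S := \sum_(i < m.+1) `|c i.+1|.
  have S0 : 0 <= S by apply: sumr_ge0.
  have [rho rho0 Hr] := H 1 ltr01.
  (* [r < rho] makes the hypothesis available, [r <= 1] bounds every higher power by [r], and the
     last term gives [|c 0| <= r * (1 + S) <= eps]. *)
  pose r := Num.min (Num.min (rho / 2) 1) (eps / (1 + S)).
  have q0 : 0 < eps / (1 + S) by apply: divr_gt0 => //; lra.
  have r0 : 0 < r by rewrite /r !lt_min q0 ltr01 andbT/=; lra.
  have r1 : r <= 1 by rewrite /r ge_min ge_min lexx orbT.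
  have rr : r < rho.
    apply: (@le_lt_trans _ _ (rho / 2)); last by lra.
    by rewrite /r ge_min ge_min lexx.
  have re : r * (1 + S) <= eps.
    by rewrite -ler_pdivlMr; [rewrite /r ge_min lexx orbT|lra].
  have := Hr _ r0 rr; rewrite big_ord_recl expr0 mulr1 mul1r => h.
  have h1 : `|\sum_(i < m.+1) c (bump 0 i) * r ^+ bump 0 i| <= r * S.
    apply: (le_trans (ler_norm_sum _ _ _)); rewrite /S mulr_sumr.
    apply: ler_sum => i _; rewrite normrM exprS normrM (ger0_norm (ltW r0)).
    rewrite mulrCA ler_wpM2l ?(ltW r0)// ler_piMr//.
    by rewrite ger0_norm ?exprn_ge0 ?(ltW r0)// exprn_ile1// ltW.
  have h2 : r ^+ m.+1 <= r.
    by rewrite exprS ler_piMr ?(ltW r0)// exprn_ile1// ltW.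
  apply: le_trans re; rewrite mulrDr mulr1.
  set A := c 0%N; set B := \sum_(i < _) _ in h h1.
  have : `|c 0%N| <= `|c 0%N + B| + `|B|.
    by rewrite -{1}(addrK B (c 0%N)); exact: ler_normB.
  by move: h; rewrite /B /A; lra.
move=> [//|i] im.
apply: (ih (fun i => c i.+1)) => // eps e0.
have [rho rho0 Hr] := H _ e0; exists rho => // r r0 rr.
have := Hr _ r0 rr; rewrite big_ord_recl c0 mul0r add0r.
under eq_bigr do rewrite exprS mulrCA.
rewrite -mulr_sumr normrM (ger0_norm (ltW r0)) [in X in _ <= X]exprS mulrCA.
by rewrite ler_pM2l.
Qed.

End taylor.

(** * Sums over multi-indices of given degree *)

Section multi_index_sum.
Context {R : realType} {n : nat}.

Lemma finite_mi_deg j : finite_set [set a : multi_index n | mi_deg a = j].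
Proof.
apply: (@sub_finite_set _ _ ((fun g : {ffun 'I_n -> 'I_j.+1} =>
  [ffun i => val (g i)] : multi_index n) @` [set: _])).
  move=> a /= aj.
  have aij i : (a i < j.+1)%N by rewrite ltnS -aj /mi_deg (bigD1 i)//= leq_addr.
  exists [ffun i => Ordinal (aij i)] => //.
  by apply/ffunP => i; rewrite !ffunE.
exact/finite_image/finite_finset.
Qed.

Definition mi_seq j : seq (multi_index n) :=
  finmap.enum_fset (fset_set [set a : multi_index n | mi_deg a = j]).

Lemma mi_seq_uniq j : uniq (mi_seq j).
Proof. exact: finmap.fset_uniq. Qed.

Lemma mem_mi_seq j a : (a \in mi_seq j) = (mi_deg a == j).
Proof.
rewrite /mi_seq in_fset_set; last exact: finite_mi_deg.
by apply/idP/eqP; rewrite inE.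
Qed.

Lemma fsum_mi_deg j (F : multi_index n -> R) :
  \sum_(a \in [set a : multi_index n | mi_deg a = j]) F a =
  \sum_(a <- mi_seq j) F a.
Proof. by rewrite fsbig_finite//; exact: finite_mi_deg. Qed.

Lemma mi_seq0 : mi_seq 0 = [:: [ffun=> 0%N]].
Proof.
apply: perm_small_eq => //; apply: uniq_perm => //; first exact: mi_seq_uniq.
move=> a; rewrite mem_mi_seq inE; apply/eqP/eqP => [|->].
  move=> /eqP; rewrite sum_nat_eq0 => /forallP a0.
  by apply/ffunP => i; rewrite ffunE; exact/eqP/a0.
by rewrite /mi_deg big1// => i _; rewrite ffunE.
Qed.

Lemma multinomial0 : multinomial ([ffun=> 0%N] : multi_index n) = 1 :> R.
Proof.
rewrite /multinomial big1 ?divr1; last by move=> i _; rewrite ffunE.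
by rewrite /mi_deg big1// => i _; rewrite ffunE.
Qed.

(** Pascal's rule for multinomial coefficients: since the entries of [b] sum to [j + 1],
    [(j + 1)! / b!] is the sum over [k] of [b k * j! / b!], and [b k / b!] is the inverse factorial
    of [b] lowered at [k]. This makes an iterated directional derivative collapse to one sum over
    multi-indices. *)
Lemma sum_multinomialS j (G : multi_index n -> R) :
  \sum_(b <- mi_seq j.+1) multinomial b * G b =
  \sum_(k < n) \sum_(a <- mi_seq j) multinomial a * G (mi_incr a k).
Proof.
pose P (b : multi_index n) : R := \prod_(i < n) (b i)`!%:R.
have P0 b : P b != 0.
  by apply/prodf_neq0 => i _; rewrite pnatr_eq0 -lt0n fact_gt0.
transitivity (\sum_(k < n) \sum_(b <- mi_seq j.+1) (b k)%:R * (j`!%:R / P b * G b)).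
  rewrite exchange_big/= big_seq [RHS]big_seq; apply: eq_bigr => b.
  rewrite mem_mi_seq => /eqP bj; rewrite -mulr_suml -natr_sum.
  rewrite -[(\sum_(i < n) _)%N]/(mi_deg b) /multinomial bj factS natrM -/(P b).
  by rewrite !mulrA.
apply: eq_bigr => k _.
transitivity (\sum_(b <- [seq mi_incr a k | a <- mi_seq j])
    (b k)%:R * (j`!%:R / P b * G b)); last first.
  rewrite big_map; rewrite big_seq [RHS]big_seq; apply: eq_bigr => a.
  rewrite mem_mi_seq => /eqP aj; rewrite mulrA; congr (_ * _).
  rewrite /multinomial aj -/(P a) ffunE eqxx addn1.
  have -> : P (mi_incr a k) = (a k).+1%:R * P a.
    rewrite /P (bigD1 k)//= [in RHS](bigD1 k)//= ffunE eqxx addn1 factS natrM.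
    rewrite mulrA; congr (_ * _); apply: eq_bigr => i /negbTE ik.
    by rewrite ffunE ik addn0.
  have k0 : (a k).+1%:R != 0 :> R by rewrite pnatr_eq0.
  by field; rewrite P0 nat1r k0.
(* Multi-indices with [b k = 0] contribute nothing; the others are exactly the values of
   [mi_incr ^~ k]. *)
rewrite (bigID (fun b : multi_index n => (0 < b k)%N))/= [X in _ + X]big1 ?addr0; last first.
  by move=> b; rewrite lt0n negbK => /eqP ->; rewrite mul0r.
rewrite -big_filter; apply: perm_big; apply: uniq_perm.
- exact/filter_uniq/mi_seq_uniq.
- rewrite map_inj_uniq; first exact: mi_seq_uniq.
  move=> a b /ffunP ab; apply/ffunP => i; have := ab i; rewrite !ffunE.
  exact: addIn.
- move=> b; rewrite mem_filter mem_mi_seq; apply/andP/mapP => [[bk /eqP bj]|[a + ->]].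
    exists [ffun i => (b i - (i == k))%N : nat].
      have E : b = mi_incr [ffun i => (b i - (i == k))%N : nat] k.
        apply/ffunP => i; rewrite !ffunE subnK//.
        by case: eqVneq => [->|].
      by rewrite mem_mi_seq -eqSS -(mi_deg_incr _ k) -E bj.
    apply/ffunP => i; rewrite !ffunE subnK//.
    by case: eqVneq => [->|].
  by rewrite mem_mi_seq => /eqP <-; rewrite mi_deg_incr ffunE eqxx addn1.
Qed.

End multi_index_sum.

(** * Weighted density of smooth functions *)

Import HBNNSimple.

Section weighted_density.
Context d (T : measurableType d) {R : realType}.
Variables (mu : {measure set T -> \bar R}) (h : T -> R).
Hypothesis h0 : forall x, 0 <= h x.
Hypothesis ih : mu.-integrable setT (EFin \o h).

Let mh : measurable_fun setT h.
Proof. exact/measurable_EFinP/(measurable_int mu). Qed.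

(** An L^1 norm with integrable weight [h]. Bounded functions have finite norm whatever their
    support, so approximants need no cutoff; [h] will be the absolute value of a test function or of
    another integrable function. *)
Definition wnorm (f : T -> R) : \bar R :=
  (\int[mu]_x (`|f x| * h x)%:E)%E.

(* The smooth functions in the application; all that matters is that they form
   an algebra of measurable functions with constants. *)
Variable V : (T -> R) -> Prop.
Hypothesis V_measurable : forall v, V v -> measurable_fun setT v.
Hypothesis V_cst : forall c : R, V (cst c).
Hypothesis VD : forall v w, V v -> V w -> V (v + w).
Hypothesis VM : forall v w, V v -> V w -> V (v * w).

Let VB v w : V v -> V w -> V (v - w).
Proof.
move=> Vv Vw; rewrite (_ : v - w = v + cst (-1) * w); first exact/VD/VM.
by apply/funext => x; rewrite !fctE mulN1r.
Qed.

Let mw (f : T -> R) : measurable_fun setT f ->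
  measurable_fun setT (fun x => (`|f x| * h x)%:E).
Proof.
move=> mf; apply/measurable_EFinP.
apply: (@measurable_funM _ T R setT (fun x => `|f x|) h); last exact: mh.
exact: (measurableT_comp (@normr_measurable R setT) mf).
Qed.

Let w0 (f : T -> R) x : (0 <= (`|f x| * h x)%:E)%E.
Proof. by rewrite lee_fin mulr_ge0. Qed.

Lemma wnormD (f g : T -> R) :
  measurable_fun setT f -> measurable_fun setT g ->
  (wnorm (f \+ g)%R <= wnorm f + wnorm g)%E.
Proof.
move=> mf mg; rewrite /wnorm -ge0_integralD//; [|exact: mw|exact: mw].
apply: ge0_le_integral => //.
- by apply: mw; exact: measurable_funD.
- by apply: emeasurable_funD; exact: mw.
- move=> x _; rewrite -EFinD lee_fin -mulrDl ler_wpM2r//; exact: ler_normD.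
Qed.

Lemma le_wnorm (f g : T -> R) :
  measurable_fun setT f -> measurable_fun setT g ->
  (forall x, `|f x| <= `|g x|) -> (wnorm f <= wnorm g)%E.
Proof.
move=> mf mg fg; apply: ge0_le_integral => //; [exact: mw|exact: mw|].
by move=> x _; rewrite lee_fin ler_wpM2r.
Qed.

Lemma wnorm_cvg (f_ : nat -> T -> R) (f : T -> R) (C : R) :
  (forall k, measurable_fun setT (f_ k)) -> measurable_fun setT f ->
  (forall x, f_ k x @[k --> \oo] --> f x) -> (forall k x, `|f_ k x| <= C) ->
  forall eps : R, 0 < eps -> exists k, (wnorm (f \- f_ k)%R <= eps%:E)%E.
Proof.
move=> mf_ mf cf bf eps eps0.
have [] := @dominated_convergence _ T R mu setT measurableT
  (fun k x => (f_ k x * h x)%:E) (fun x => (f x * h x)%:E)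
  (fun x => (C * h x)%:E).
- by move=> k; apply/measurable_EFinP; exact: measurable_funM.
- by apply/measurable_EFinP; exact: measurable_funM.
- apply: aeW => x _; apply: cvg_EFin; first exact: nearW.
  by apply: cvgM; [exact: cf|exact: cvg_cst].
- by rewrite (_ : (fun x => _) = (fun x => C%:E * (EFin \o h) x)%E)//;
    apply: integrableZl.
- apply: aeW => x k _; rewrite abse_EFin lee_fin normrM (ger0_norm (h0 x)).
  by rewrite ler_wpM2r.
move=> _ /fine_cvgP[fin] /cvgrPdist_lt /(_ _ eps0) H _.
near \oo => k; exists k.
have finE : wnorm (f \- f_ k) =
    (\int[mu]_x `|(f_ k x * h x)%:E - (f x * h x)%:E|)%E.
  apply: eq_integral => x _; rewrite -EFinB abse_EFin -mulrBl normrM distrC.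
  by rewrite (ger0_norm (h0 x)).
have fk : (\int[mu]_x `|(f_ k x * h x)%:E - (f x * h x)%:E|)%E \is a fin_num.
  by near: k.
rewrite finE -(fineK fk) lee_fin.
have : `|0 - fine (\int[mu]_x `|(f_ k x * h x)%:E - (f x * h x)%:E|)%E| < eps.
  by near: k.
by rewrite sub0r normrN => /ltW; exact/le_trans/ler_norm.
Unshelve. all: by end_near. Qed.

(* Approximants with values in [0, 1], so that products of approximants
   approximate products. *)
Definition approx01 (f : T -> R) := forall eps : R, 0 < eps ->
  exists2 v : T -> R, V v /\ (forall x, 0 <= v x <= 1) &
    (wnorm (f \- v)%R <= eps%:E)%E.

Lemma approx01_cvg (f_ : nat -> T -> R) (f : T -> R) (C : R) :
  (forall k, measurable_fun setT (f_ k)) -> measurable_fun setT f ->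
  (forall x, f_ k x @[k --> \oo] --> f x) -> (forall k x, `|f_ k x| <= C) ->
  (forall k, approx01 (f_ k)) -> approx01 f.
Proof.
move=> mf_ mf cf bf sf eps eps0.
have e2 : 0 < eps / 2 by rewrite divr_gt0.
have [k fk] := wnorm_cvg mf_ mf cf bf e2.
have [v [sv v01] vk] := sf k _ e2.
exists v => //.
rewrite (_ : f \- v = (f \- f_ k) \+ (f_ k \- v)); last first.
  by apply/funext => x /=; rewrite subrKA.
apply: (le_trans (wnormD _ _)).
- exact: measurable_funB.
- by apply: measurable_funB => //; exact: V_measurable.
- by rewrite [eps in leRHS]splitr EFinD leeD.
Qed.

(** These sets will form a sigma-algebra, so a generating family is all that has to be approximated
    by hand. *)
Definition approx_set (A : set T) := measurable A /\ approx01 (\1_A : T -> R).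

Lemma approx_setC A : approx_set A -> approx_set (~` A).
Proof.
move=> [mA sA]; split; first exact: measurableC.
move=> eps eps0; have [v [sv v01] vA] := sA _ eps0.
exists (cst 1 - v).
  split; first by exact: VB.
  by move=> x; rewrite !fctE/=; have := v01 x; lra.
apply: le_trans vA; apply: le_wnorm.
- apply: measurable_funB; first exact/measurable_indicP/measurableC.
  by apply: V_measurable; exact: VB.
- by apply: measurable_funB; [exact/measurable_indicP|exact: V_measurable].
- move=> x; rewrite /= !indicE in_setC [_ - _ in leLHS](_ : _ = - ((x \in A)%:R - v x)) ?normrN//.
  by rewrite !fctE/=; case: (x \in A) => /=; ring.
Qed.

Lemma approx_setI A B : approx_set A -> approx_set B -> approx_set (A `&` B).
Proof.
move=> [mA sA] [mB sB]; split; first exact: measurableI.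
move=> eps eps0; have e2 : 0 < eps / 2 by rewrite divr_gt0.
have [v [sv v01] vA] := sA _ e2; have [w [sw w01] wB] := sB _ e2.
exists (v * w).
  split; first exact: VM.
  move=> x; rewrite !fctE/=; have /andP[? ?] := v01 x; have /andP[? ?] := w01 x.
  by rewrite mulr_ge0//= mulr_ile1.
have mv := V_measurable sv; have mw' := V_measurable sw.
have mvA : measurable_fun setT (\1_A \- v).
  by apply: measurable_funB => //; exact/measurable_indicP.
have mwB : measurable_fun setT (\1_B \- w).
  by apply: measurable_funB => //; exact/measurable_indicP.
have mN (f : T -> R) : measurable_fun setT f -> measurable_fun setT (fun x => `|f x|).
  exact: measurableT_comp.
apply: (@le_trans _ _ (wnorm (fun x => `|(\1_A \- v) x| + `|(\1_B \- w) x|))).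
  apply: le_wnorm.
  - apply: measurable_funB; first exact/measurable_indicP/measurableI.
    exact: measurable_funM.
  - by apply: measurable_funD; apply: mN.
  - move=> x; rewrite [leRHS]ger0_norm ?addr_ge0//= !indicE in_setI -mulnb natrM.
    rewrite -[(v * w) x]/(v x * w x).
    have /andP[v0 v1] := v01 x; have /andP[q0 q1] := w01 x.
    (* In this splitting both cofactors [a] and [w x] have absolute value at most 1, so the errors
       simply add. *)
    have -> a b : a * b - v x * w x = a * (b - w x) + w x * (a - v x) :> R by ring.
    rewrite addrC; apply: (le_trans (ler_normD _ _)); rewrite !normrM; apply: lerD.
      by rewrite ler_piMl// ger0_norm.
    by rewrite ler_piMl//; case: (x \in A); rewrite ?normr1 ?normr0.
apply: (le_trans (wnormD (mN _ mvA) (mN _ mwB))).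
rewrite [eps in leRHS]splitr EFinD leeD//.
- apply: le_trans vA; apply: le_wnorm => //; first exact: mN.
  by move=> x; rewrite normr_id.
- apply: le_trans wB; apply: le_wnorm => //; first exact: mN.
  by move=> x; rewrite normr_id.
Qed.

Lemma approx_setT : approx_set setT.
Proof.
split => // eps eps0; exists (cst 1).
  by split; [exact: V_cst|move=> x; rewrite /= ler01 lexx].
rewrite /wnorm integral0_eq ?lee_fin ?ltW// => x _.
by rewrite /= indicT subrr normr0 mul0r.
Qed.

Lemma approx_set0 : approx_set set0. Proof. by rewrite -setCT; exact: approx_setC approx_setT. Qed.

Lemma approx_setU A B : approx_set A -> approx_set B -> approx_set (A `|` B).
Proof.
by move=> gA gB; rewrite -(setCK (A `|` B)) setCU; apply/approx_setC/approx_setI; exact: approx_setC.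
Qed.

Lemma approx_set_bigcup (F : (set T)^nat) : (forall k, approx_set (F k)) -> approx_set (\bigcup_k F k).
Proof.
move=> gF; have gU k : approx_set (\big[setU/set0]_(i < k) F i).
  elim/big_ind : _ => [|A B gA gB|i _]; [exact: approx_set0|exact: approx_setU|exact: gF].
split; first by apply: bigcupT_measurable => k; have [] := gF k.
apply: (@approx01_cvg (fun k => \1_(\big[setU/set0]_(i < k) F i)) _ 1).
- by move=> k; apply/measurable_indicP; have [] := gU k.
- by apply/measurable_indicP; apply: bigcupT_measurable => k; have [] := gF k.
- move=> x; have [[k _ Fk]|nF] := pselect ((\bigcup_k F k) x).
    apply: cvg_near_cst; near=> m; rewrite !indicE !mem_set//; first by exists k.
    rewrite -bigcup_mkord; exists k => //=; near: m; exact: nbhs_infty_gt.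
  apply: cvg_near_cst; near=> m; rewrite !indicE !memNset//.
  by rewrite -bigcup_mkord => -[k _ Fk]; apply: nF; exists k.
- move=> k x; rewrite indicE; case: (_ \in _); rewrite ?normr1 ?normr0//.
- by move=> k; have [] := gU k.
Unshelve. all: by end_near. Qed.

(** The weighted norm ignores null sets; this carries the property from Borel to Lebesgue measurable
    sets. *)
Lemma approx_set_ae (A B : set T) : measurable A -> approx_set B -> A `<=` B ->
  mu (B `\` A) = 0%E -> approx_set A.
Proof.
move=> mA [mB sB] AB BA0; split => // eps eps0.
have [v [sv v01] vB] := sB _ eps0; exists v => //.
apply: le_trans vB; rewrite /wnorm (@ae_eq_integral _ _ _ mu setT
  (fun x => (`|(\1_A \- v) x| * h x)%:E) (fun x => (`|(\1_B \- v) x| * h x)%:E))//.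
- apply: mw; apply: measurable_funB; first exact/measurable_indicP.
  exact: V_measurable.
- apply: mw; apply: measurable_funB; first exact/measurable_indicP.
  exact: V_measurable.
- exists (B `\` A); split => //; first exact: measurableD.
  move=> x /=; apply: contra_notP => nBA _; rewrite !indicE.
  suff -> : (x \in A) = (x \in B) by [].
  apply/idP/idP; rewrite !inE => Ax; first exact: AB.
  by apply: contrapT => nA; apply: nBA; split.
Qed.


Definition approx (f : T -> R) := forall eps : R, 0 < eps ->
  exists2 v : T -> R, V v & (wnorm (f \- v)%R <= eps%:E)%E.

Lemma approx_cvg (f_ : nat -> T -> R) (f : T -> R) (C : R) :
  (forall k, measurable_fun setT (f_ k)) -> measurable_fun setT f ->
  (forall x, f_ k x @[k --> \oo] --> f x) -> (forall k x, `|f_ k x| <= C) ->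
  (forall k, approx (f_ k)) -> approx f.
Proof.
move=> mf_ mf cf bf sf eps eps0.
have e2 : 0 < eps / 2 by rewrite divr_gt0.
have [k fk] := wnorm_cvg mf_ mf cf bf e2.
have [v Vv vk] := sf k _ e2; exists v => //.
rewrite (_ : f \- v = (f \- f_ k) \+ (f_ k \- v)); last first.
  by apply/funext => x /=; rewrite subrKA.
apply: (le_trans (wnormD _ _)).
- exact: measurable_funB.
- by apply: measurable_funB => //; exact: V_measurable.
- by rewrite [eps in leRHS]splitr EFinD leeD.
Qed.

Lemma approxD (f g : T -> R) : measurable_fun setT f -> measurable_fun setT g ->
  approx f -> approx g -> approx (f \+ g).
Proof.
move=> mf mg af ag eps eps0.
have e2 : 0 < eps / 2 by rewrite divr_gt0.
have [v Vv vf] := af _ e2; have [w Vw wg] := ag _ e2.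
exists (v + w); first exact: VD.
rewrite (_ : _ \- _ = (f \- v) \+ (g \- w)); last first.
  by apply/funext => x /=; rewrite !fctE; ring.
apply: (le_trans (wnormD _ _)).
- by apply: measurable_funB => //; exact: V_measurable.
- by apply: measurable_funB => //; exact: V_measurable.
- by rewrite [eps in leRHS]splitr EFinD leeD.
Qed.

Lemma approxZ (f : T -> R) (c : R) : measurable_fun setT f ->
  approx f -> approx (fun x => c * f x).
Proof.
move=> mf af eps eps0.
have c0 : 0 < 1 + `|c| by have := normr_ge0 c; lra.
have e2 : 0 < eps / (1 + `|c|) by rewrite divr_gt0.
have [v Vv vf] := af _ e2.
exists (cst c * v); first by apply: VM.
have mfv : measurable_fun setT (f \- v).
  by apply: measurable_funB => //; exact: V_measurable.
apply: (@le_trans _ _ ((1 + `|c|)%:E * wnorm (f \- v)%R)%E); last first.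
  rewrite -[eps in leRHS](mulfVK (lt0r_neq0 c0)) mulrC EFinM.
  by rewrite lee_wpmul2l// lee_fin ltW.
rewrite /wnorm -ge0_integralZl//; last exact: mw.
apply: ge0_le_integral => //.
- by apply: mw; apply: measurable_funB; [exact: measurable_funM|exact/V_measurable/VM].
- by apply: emeasurable_funM => //; exact: mw.
- move=> x _; rewrite -EFinM lee_fin mulrA ler_wpM2r// !fctE/= -mulrBr normrM.
  by rewrite ler_wpM2r// lerDr.
Qed.

Lemma approx_bounded (f : T -> R) (C : R) :
  (forall A : set T, measurable A -> approx_set A) ->
  measurable_fun setT f -> (forall x, `|f x| <= C) -> approx f.
Proof.
move=> approx_setA mf fC.
have ga (A : set T) : measurable A -> approx \1_A.
  move=> mA eps eps0; have [_ /(_ _ eps0)[v [Vv _] vA]] := approx_setA _ mA.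
  by exists v.
have gs (g : {nnsfun T >-> R}) : approx g.
  rewrite (_ : (g : T -> R) =
      fun x => \sum_(y <- finmap.enum_fset (fset_set (range g))) y * \1_(g @^-1` [set y]) x); last first.
    by apply/funext => x; rewrite [LHS]fimfunE fsbig_finite.
  have mi (y : R) : measurable_fun setT (fun x => y * \1_(g @^-1` [set y]) x).
    by apply: measurable_funM => //; exact/measurable_indicP.
  elim: (finmap.enum_fset _) => [|y s IHs].
    move=> eps eps0; exists (cst 0) => //.
    rewrite /wnorm integral0_eq ?lee_fin ?ltW// => x _.
    by rewrite /= big_nil subrr normr0 mul0r.
  rewrite (_ : (fun x => _) = (fun x => y * \1_(g @^-1` [set y]) x) \+
      (fun x => \sum_(y <- s) y * \1_(g @^-1` [set y]) x)); last first.
    by apply/funext => x; rewrite big_cons.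
  apply: approxD => //.
    by apply: measurable_sum => i; exact: mi.
  by apply: approxZ; [exact/measurable_indicP|exact: ga].
have gp (g : T -> R) (D : R) : measurable_fun setT g -> (forall x, 0 <= g x <= D) -> approx g.
  move=> mg gD.
  have mEg : measurable_fun setT (EFin \o g) by exact/measurable_EFinP.
  have approx_set0 x : setT x -> (0 <= (EFin \o g) x)%E.
    by move=> _; rewrite lee_fin; have /andP[] := gD x.
  apply: (@approx_cvg (fun k => nnsfun_approx measurableT mEg k : T -> R) g D) => //.
  - by move=> x; have /fine_cvgP[_] := cvg_nnsfun_approx measurableT mEg approx_set0 (x := x) I.
  - move=> k x; rewrite ger0_norm//.
    have /andP[_] := gD x; apply: le_trans.
    by have := le_approx k approx_set0 (x := x) I; rewrite -nnsfun_approxE lee_fin.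
(* Adding the constant [C] moves the values into [0, 2C], where increasing simple approximations
   apply; the constant is then subtracted again. *)
rewrite (_ : f = (fun x => f x + C) \+ cst (- C)); last first.
  by apply/funext => x /=; rewrite addrK.
apply: approxD => //.
- exact: measurable_funD.
- apply: (gp _ (C + C)); first exact: measurable_funD.
  by move=> x; have := fC x; rewrite ler_norml; lra.
- move=> eps eps0; exists (cst (- C)) => //.
  rewrite /wnorm integral0_eq ?lee_fin ?ltW// => x _.
  by rewrite /= subrr normr0 mul0r.
Qed.

End weighted_density.

Lemma measurable_smooth (R : realType) (n : nat) (v : 'rV[R]_n -> R) :
  smooth v -> measurable_fun [set: lebesgue_rV_type R n] v.
Proof.
move=> sv; apply: measurable_fun_borel_lebesgue.
by apply: measurable_rV_continuous; exact: smooth_continuous.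
Qed.

(** * Density of smooth functions in weighted L^1 *)

Section smooth_density.
Context {R : realType} {n : nat}.
Local Notation lambda := (lebesgue_rV R n).
Local Notation T := (lebesgue_rV_type R n).
Variable h : T -> R.
Hypothesis h0 : forall x, 0 <= h x.
Hypothesis ih : lambda.-integrable [set: T] (EFin \o h).

Let V (v : T -> R) : Prop := smooth (v : 'rV[R]_n -> R).
Let V_measurable v : V v -> measurable_fun [set: T] v.
Proof. exact: measurable_smooth. Qed.
Let V_cst (c : R) : V (cst c). Proof. exact: smooth_cst. Qed.
Let VD v w : V v -> V w -> V (v + w). Proof. exact: smoothD. Qed.
Let VM v w : V v -> V w -> V (v * w). Proof. exact: smoothM. Qed.

Local Notation approx_set := (approx_set lambda h V).

Let approx_setC A : approx_set A -> approx_set (~` A).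
Proof. exact: (approx_setC h0 ih V_measurable V_cst VD VM). Qed.

Let approx_set_bigcup (F : (set T)^nat) : (forall k, approx_set (F k)) -> approx_set (\bigcup_k F k).
Proof. exact: (approx_set_bigcup h0 ih V_measurable V_cst VD VM). Qed.

Let approx_set0 : approx_set set0.
Proof. exact: (approx_set0 h0 ih V_measurable V_cst VD VM). Qed.

(* exp (- exp (k - k^2 (b - x_i))) tends to 1 if x_i < b and to 0 otherwise,
   including at x_i = b, where it is exp (- exp k). *)
Let approx_set_ray i (b : R) : approx_set [set x : T | (x : 'rV[R]_n) ord0 i < b].
Proof.
have mA : measurable ([set x : T | (x : 'rV[R]_n) ord0 i < b]).
  apply: measurable_borel_lebesgue.
  rewrite (_ : mkset _ = @rV_coord R n i @^-1` `]-oo, b[%classic); last first.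
    by apply/seteqP; split => x /=; rewrite in_itv.
  by rewrite -[X in measurable X]setTI; exact: measurable_rV_coord.
split => //.
pose v (k : nat) : 'rV[R]_n -> R :=
  expR \o (cst (-1) * (expR \o (cst (k%:R - k%:R ^+ 2 * b) + cst (k%:R ^+ 2) * (fun x => x ord0 i)))).
have vE k x : v k x = expR (- expR (k%:R - k%:R ^+ 2 * (b - x ord0 i))).
  rewrite /v !fctE/= mulN1r; congr (expR (- expR _)); ring.
have sv k : smooth (v k).
  apply: smooth_exp; apply: smoothM; first exact: smooth_cst.
  apply: smooth_exp; apply: smoothD; first exact: smooth_cst.
  by apply: smoothM; [exact: smooth_cst|exact: smooth_coord].
have v01 k x : 0 <= v k x <= 1.
  by rewrite vE expR_ge0/= -expR0 ler_expR oppr_le0 expR_ge0.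
apply: (@approx01_cvg _ _ _ lambda h h0 ih V V_measurable v _ 1).
- by move=> k; exact: measurable_smooth.
- exact/measurable_indicP.
- move=> x; rewrite indicE; case: (ltP (x ord0 i) b) => xb.
    rewrite mem_set//=; apply/cvgrPdist_le => eps eps0.
    near=> k; rewrite vE; set c := b - x ord0 i.
    have c0 : 0 < c by rewrite subr_gt0.
    set E := expR (k%:R - _).
    have E1 : E <= k.+1%:R^-1.
      rewrite -[E]invrK -expRN lef_pV2 ?posrE ?expR_gt0//.
      apply: le_trans (expR_ge1Dx _); rewrite -nat1r lerD2l.
      (* Once [k * c >= 2] the exponent [k - k^2 * c] is at most [- k]. *)
      have kc : 2 <= k%:R * c.
        by rewrite -ler_pdivrMr//; near: k; exact: nbhs_infty_ger.
      have : 0 <= k%:R * (k%:R * c - 2) by rewrite mulr_ge0// subr_ge0.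
      by lra.
    have := expR_ge1Dx (- E); have /andP[_ v1] := v01 k x; rewrite vE -/c -/E in v1.
    have : k.+1%:R^-1 <= eps by apply: ltW; near: k; exact: near_infty_natSinv_lt (PosNum eps0).
    rewrite ger0_norm ?subr_ge0// => h1 h2; apply: le_trans (le_trans E1 h1); lra.
  rewrite memNset/=; last by rewrite ltNge xb.
  apply/cvgrPdist_le => eps eps0.
  near=> k; rewrite sub0r normrN vE ger0_norm ?expR_ge0//.
  have : k.+1%:R^-1 <= eps by apply: ltW; near: k; exact: near_infty_natSinv_lt (PosNum eps0).
  apply: le_trans; rewrite expRN lef_pV2 ?posrE ?expR_gt0//.
  set E := expR (k%:R - _).
  have : 1 + k%:R <= E.
    apply: le_trans (expR_ge1Dx _); rewrite lerD2l lerBrDr gerDl.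
    by rewrite mulr_ge0_le0// subr_le0.
  have := expR_ge1Dx E; rewrite -nat1r; lra.
- by move=> k x; have /andP[? ?] := v01 k x; rewrite ger0_norm.
- move=> k eps eps0; exists (v k); first by split; [exact: sv|exact: v01].
  rewrite /wnorm integral0_eq ?lee_fin ?ltW// => x _.
  by rewrite /= subrr normr0 mul0r.
Unshelve. all: by end_near. Qed.

(** Two nested generation arguments: coordinate preimages generate the Borel sets of rows, and open
    rays generate those of the line. *)
Let approx_set_borel (A : set (borel_rV R n)) : measurable A -> approx_set A.
Proof.
move: A; apply: smallest_sub.
  split; [exact: approx_set0|by move=> A gA; rewrite setTD; exact: approx_setC|exact: approx_set_bigcup].
move=> A; rewrite -bigcup_seq => -[i _ [B mB <-]]; rewrite setTI.
suff : measurable `<=` [set B : set (measurableTypeR R) | approx_set (@rV_coord R n i @^-1` B)].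
  exact.
rewrite RGenInftyO.measurableE; apply: smallest_sub.
  split; first by rewrite /= preimage_set0; exact: approx_set0.
    by move=> C gD; rewrite setTD /= preimage_setC; exact: approx_setC.
  by move=> F gF; rewrite /= preimage_bigcup; exact: approx_set_bigcup.
move=> _ [b ->] /=.
rewrite (_ : _ @^-1` _ = [set x : T | (x : 'rV[R]_n) ord0 i < b]); first exact: approx_set_ray.
by apply/seteqP; split => x /=; rewrite in_itv.
Qed.

(** Outer regularity: the infimum defining the outer measure yields Borel covers of [A] with excess
    at most [1 / (k + 1)]. Their intersection is Borel and exceeds [A] by a null set, because
    [lambda A] is finite. *)
Let approx_set_lebesgue_fin (A : set T) : measurable A -> (lambda A < +oo)%E -> approx_set A.
Proof.
move=> mA Aoo.
have inv0 k : 0 < k.+1%:R^-1 :> R by rewrite invr_gt0.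
have cov (k : nat) : exists U : set (borel_rV R n), [/\ measurable U, A `<=` U &
    (lambda U <= lambda A + (k.+1%:R^-1)%:E)%E].
  have : lambda A \is a fin_num by rewrite ge0_fin_numE.
  move/lb_ereal_inf_adherent => /(_ _ (inv0 k))[_/= [F [mF AF] <-] Fk].
  exists (\bigcup_i F i); split => //; first exact: bigcupT_measurable.
  apply: le_trans (ltW Fk).
  apply: (le_trans (outer_measure_sigma_subadditive (borel_lebesgue n)^*%mu F)).
  by apply: lee_nneseries => // i _; rewrite -lebesgue_rVE.
pose U k := sval (cid (cov k)).
have [mU AU lU] : [/\ forall k, measurable (U k : set (borel_rV R n)), forall k, A `<=` U k &
    forall k, (lambda (U k) <= lambda A + (k.+1%:R^-1)%:E)%E].
  by split => k; have [] := svalP (cid (cov k)).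
pose B := \bigcap_k U k.
have mB : measurable (B : set (borel_rV R n)) by exact: bigcapT_measurable.
have mB' := measurable_borel_lebesgue mB.
have AB : A `<=` B by exact: sub_bigcap.
apply: (approx_set_ae ih V_measurable mA (approx_set_borel mB) AB).
have lBA : (lambda B <= lambda A)%E.
  apply/lee_addgt0Pr => eps eps0.
  near \oo => k.
  apply: (@le_trans _ _ (lambda (U k))).
    apply: le_measure; rewrite ?inE//; first exact: (measurable_borel_lebesgue (mU k)).
    exact: bigcap_inf.
  apply: (le_trans (lU k)); rewrite leeD2l// lee_fin.
  apply: ltW; near: k; exact: near_infty_natSinv_lt (PosNum eps0).
rewrite measureD//; last exact: le_lt_trans lBA Aoo.
rewrite setIidr//; apply/eqP; rewrite eq_le; apply/andP; split.
  by rewrite lee_subel_addl ?adde0// ge0_fin_numE.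
rewrite sube_ge0; first by apply: le_measure => //; rewrite inE.
by rewrite !ge0_fin_numE// Aoo ?orbT.
Unshelve. all: by end_near. Qed.

Let approx_set_lebesgue (A : set T) : measurable A -> approx_set A.
Proof.
move=> mA; have /sigma_finiteP[F [UF _ mF]] := sigma_finiteT lambda.
rewrite -(setIT A) UF setI_bigcupr; apply: approx_set_bigcup => k.
have [mFk Fk] := mF k.
apply: approx_set_lebesgue_fin; first exact: measurableI.
by apply: le_lt_trans Fk; apply: le_measure; rewrite ?inE//; exact: measurableI.
Qed.


Lemma smooth_dense (f : T -> R) (C : R) : measurable_fun [set: T] f ->
  (forall x, `|f x| <= C) -> forall eps : R, 0 < eps ->
  exists2 v : 'rV[R]_n -> R, smooth v &
    (\int[lambda]_x (`|f x - v x| * h x)%:E <= eps%:E)%E.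
Proof.
move=> mf fC eps eps0.
by have [v sv vf] := approx_bounded h0 ih V_measurable V_cst VD VM approx_set_lebesgue mf fC eps0; exists v.
Qed.

End smooth_density.

(** * Expansion of ball averages *)

Section kernel_fubini.
Context d1 d2 (T1 : measurableType d1) (T2 : measurableType d2) {R : realType}.
Variables (m1 : {sigma_finite_measure set T1 -> \bar R}).
Variables (m2 : {sigma_finite_measure set T2 -> \bar R}).
Variables (p : T1 -> R) (q : T2 -> R) (k : T1 * T2 -> R) (C : R).
Hypothesis ip : m1.-integrable setT (EFin \o p).
Hypothesis iq : m2.-integrable setT (EFin \o q).
Hypothesis mk : measurable_fun setT k.
Hypothesis kC : forall z, `|k z| <= C.

Let mp : measurable_fun setT p.
Proof. exact/measurable_EFinP/(measurable_int m1). Qed.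

Let mq : measurable_fun setT q.
Proof. exact/measurable_EFinP/(measurable_int m2). Qed.

Lemma integrable_kernel2 x : m2.-integrable setT (EFin \o (fun y => k (x, y) * q y)).
Proof.
have mkx : measurable_fun setT (fun y => k (x, y)).
  exact: (measurableT_comp mk (measurable_pair1 x)).
apply: (@le_integrable _ _ _ m2 setT measurableT _ (EFin \o (fun y => C * q y))).
- by apply/measurable_EFinP; apply: measurable_funM.
- move=> y _; rewrite /= lee_fin !normrM ler_wpM2r//.
  exact: le_trans (kC _) (ler_norm _).
- rewrite (_ : _ \o _ = fun y => (C%:E * (EFin \o q) y)%E)//.
  exact: integrableZl.
Qed.

Lemma integrable_kernel1 y : m1.-integrable setT (EFin \o (fun x => k (x, y) * p x)).
Proof.
have mky : measurable_fun setT (fun x => k (x, y)).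
  exact: (measurableT_comp mk (measurable_pair2 y)).
apply: (@le_integrable _ _ _ m1 setT measurableT _ (EFin \o (fun x => C * p x))).
- by apply/measurable_EFinP; apply: measurable_funM.
- move=> x _; rewrite /= lee_fin !normrM ler_wpM2r//.
  exact: le_trans (kC _) (ler_norm _).
- rewrite (_ : _ \o _ = fun y => (C%:E * (EFin \o p) y)%E)//.
  exact: integrableZl.
Qed.

Let F (z : T1 * T2) : \bar R := (p z.1 * (k z * q z.2))%:E.

Let mF : measurable_fun setT F.
Proof.
apply/measurable_EFinP; apply: measurable_funM; first exact: measurableT_comp.
by apply: measurable_funM => //; exact: measurableT_comp.
Qed.

Let iF : (m1 \x m2)%E.-integrable setT F.
Proof.
apply: (integrable12ltyP _ _ mF).2.
have q0 : (0 <= \int[m2]_y `|(q y)%:E|)%E by exact: integral_ge0.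
have qoo : (\int[m2]_y `|(q y)%:E| < +oo)%E by have /integrableP[] := iq.
have poo : (\int[m1]_x `|(p x)%:E| < +oo)%E by have /integrableP[] := ip.
(* Tonelli's criterion: the iterated integral of [|F|] is at most [|C|] times the product of the L^1
   norms of [p] and [q]. *)
apply: (@le_lt_trans _ _ (\int[m1]_x (`|(p x)%:E| * (`|C|%:E * \int[m2]_y `|(q y)%:E|)))%E).
  apply: ge0_le_integral => //.
  - by move=> x _; exact: integral_ge0.
  - apply: (@measurable_fun_fubini_tonelli_F _ _ _ _ R m2 (fun z => `|F z|%E)) => //.
    exact: measurableT_comp.
  - apply: emeasurable_funM => //; apply: measurableT_comp => //.
    exact/measurable_EFinP.
  - move=> x _; rewrite -ge0_integralZl//; last by apply: measurableT_comp => //; exact/measurable_EFinP.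
    rewrite -ge0_integralZl//; last first.
      by apply: emeasurable_funM => //; apply: measurableT_comp => //; exact/measurable_EFinP.
    apply: ge0_le_integral => //.
    + by apply: measurableT_comp => //; exact: (measurableT_comp mF (measurable_pair1 x)).
    + apply: emeasurable_funM => //; apply: emeasurable_funM => //.
      by apply: measurableT_comp => //; exact/measurable_EFinP.
    + move=> y _; rewrite -!EFinM lee_fin !normrM ler_wpM2l// ler_wpM2r//.
      exact: le_trans (kC _) (ler_norm _).
rewrite ge0_integralZr//.
- apply: lte_mul_pinfty; first exact: integral_ge0.
    by rewrite ge0_fin_numE//; exact: integral_ge0.
  exact: lte_mul_pinfty.
- by apply: measurableT_comp => //; exact/measurable_EFinP.
- by rewrite mule_ge0.
Qed.

Let inner2 x : (\int[m2]_y F (x, y))%E = (p x * \int[m2]_y (k (x, y) * q y))%:E.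
Proof.
rewrite /Rintegral EFinM fineK; last exact: (integrable_fin_num measurableT (integrable_kernel2 x)).
rewrite -integralZl//; exact: integrable_kernel2.
Qed.

Let inner1 y : (\int[m1]_x F (x, y))%E = (q y * \int[m1]_x (k (x, y) * p x))%:E.
Proof.
rewrite /Rintegral EFinM fineK; last exact: (integrable_fin_num measurableT (integrable_kernel1 y)).
rewrite -integralZl//; last exact: integrable_kernel1.
by apply: eq_integral => x _; rewrite /F/= -EFinM; congr EFin; ring.
Qed.

Lemma integrable_kernel :
  m1.-integrable setT (EFin \o (fun x => p x * \int[m2]_y (k (x, y) * q y))).
Proof.
have := integrable_fubini_F iF; rewrite /fubini_F.
by congr (integrable _ _ _); apply/funext => x; exact: inner2.
Qed.

Lemma Fubini_kernel :
  \int[m1]_x (p x * \int[m2]_y (k (x, y) * q y)) =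
  \int[m2]_y (q y * \int[m1]_x (k (x, y) * p x)).
Proof.
rewrite [LHS]/Rintegral [RHS]/Rintegral; congr fine.
under eq_integral do rewrite -inner2.
by rewrite (Fubini iF); apply: eq_integral => y _; exact: inner1.
Qed.

Lemma normr_kernel_le :
  `|\int[m1]_x (p x * \int[m2]_y (k (x, y) * q y))| <=
  C * \int[m2]_y `|q y| * \int[m1]_x `|p x|.
Proof.
have iap : m1.-integrable setT (EFin \o (fun x => `|p x|)).
  by have /= := integrable_abse ip.
have iaq : m2.-integrable setT (EFin \o (fun x => `|q x|)).
  by have /= := integrable_abse iq.
apply: (le_trans (le_normr_Rintegral measurableT integrable_kernel)).
rewrite -RintegralZl//.
apply: le_Rintegral => //.
- by have /= := integrable_abse integrable_kernel.
- rewrite (_ : _ \o _ = (fun x => (C * \int[m2]_y `|q y|)%R%:E * (EFin \o (fun x => `|p x|)%R) x)%E).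
    exact: integrableZl.
  by apply/funext => x /=; rewrite EFinM.
- move=> x _; rewrite normrM mulrC ler_wpM2r//.
  apply: (le_trans (le_normr_Rintegral measurableT (integrable_kernel2 x))).
  rewrite -RintegralZl//; apply: le_Rintegral => //.
  + by have /= := integrable_abse (integrable_kernel2 x).
  + rewrite (_ : _ \o _ = (fun x => C%:E * (EFin \o (fun x => `|q x|)%R) x)%E)//.
    exact: integrableZl.
  + by move=> y _; rewrite normrM ler_wpM2r.
Qed.

End kernel_fubini.

Lemma integrable_bounded_support d (T : measurableType d) (R : realType)
    (mu : {measure set T -> \bar R}) (K : set T) (f : T -> R) (C : R) :
  measurable K -> (mu K < +oo)%E -> measurable_fun setT f ->
  (forall x, `|f x| <= C) -> (forall x, ~ K x -> f x = 0) ->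
  mu.-integrable setT (EFin \o f).
Proof.
move=> mK Koo mf fC f0.
have -> : EFin \o f = (EFin \o f) \_ K.
  apply/funext => x; rewrite patchE; case: ifPn => //; rewrite notin_setE => Kx.
  by rewrite /= f0.
rewrite -(integrable_mkcond _ mK); apply: measurable_bounded_integrable => //.
  exact: measurable_funTS.
by exists C; split; [exact: num_real|move=> M CM x _ /=; exact: le_trans (fC x) (ltW CM)].
Qed.

(** * Measurability, translations and dilations on rows *)

Section rows_integral.
Context {R : realType} {n : nat}.
Local Notation lambda := (lebesgue_rV R n).
Local Notation T := (lebesgue_rV_type R n).

(** The joint measurability behind both uses of Fubini's theorem: [c = -1] gives the ball kernel,
    [c = 1] a translated test function. *)
Lemma measurable_fun_rV_comb (f : borel_rV R n -> R) (c : R) :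
  measurable_fun setT f ->
  measurable_fun [set: T * T]
    (fun p => f (((p.1 : 'rV[R]_n) + c *: (p.2 : 'rV[R]_n)) : 'rV[R]_n)).
Proof.
move=> mf; apply: (measurableT_comp mf); apply: measurable_fun_rVP => i.
rewrite (_ : _ \o _ = (fun p : T * T => rV_coord i (p.1 : borel_rV R n) +
    c * rV_coord i (p.2 : borel_rV R n))); last first.
  by apply/funext => p; exact: rV_coord_affine.
have mi : measurable_fun [set: T] (fun x => rV_coord i (x : borel_rV R n) : R).
  exact: (measurable_fun_borel_lebesgue (@measurable_rV_coord R n i)).
apply: measurable_funD; first exact: (measurableT_comp mi measurable_fst).
by apply: measurable_funM; [exact: measurable_cst|exact: (measurableT_comp mi measurable_snd)].
Qed.

Lemma measurable_rV_affine_lebesgue (f : borel_rV R n -> R) (b : 'rV[R]_n) (c : R) :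
  measurable_fun setT f ->
  measurable_fun setT (fun x : borel_rV R n => f ((b + c *: (x : 'rV[R]_n)) : 'rV[R]_n)).
Proof. by move=> mf; exact: (measurableT_comp mf (measurable_rV_affine b c)). Qed.

Lemma integrable_rV_affine (f : borel_rV R n -> R) (b : 'rV[R]_n) (c : R) :
  0 < c -> measurable_fun setT f ->
  lambda.-integrable [set: T] (EFin \o (f : T -> R)) ->
  lambda.-integrable [set: T]
    (EFin \o (fun x => f ((b + c *: (x : 'rV[R]_n)) : 'rV[R]_n))).
Proof.
move=> c0 mf fi; apply/integrableP; split.
  apply/measurable_EFinP; apply: measurable_fun_borel_lebesgue.
  exact: measurable_rV_affine_lebesgue.
have mE : measurable_fun setT (fun x : borel_rV R n => `|(f x)%:E|%E).
  by apply: (measurableT_comp (@abse_measurable R setT)); exact/measurable_EFinP.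
have := ge0_lebesgue_rV_affine b c0 mE (fun x => abse_ge0 _).
have /integrableP[_ foo] := fi.
have cn0 : 0 < c ^+ n by exact: exprn_gt0.
move=> E; rewrite -E in foo.
rewrite ltNge leye_eq; apply/negP => /eqP goo.
by move: foo; rewrite goo gt0_muley ?lte_fin.
Qed.

Lemma Rintegral_rV_affine (f : borel_rV R n -> R) (b : 'rV[R]_n) (c : R) :
  0 < c -> measurable_fun setT f ->
  lambda.-integrable [set: T] (EFin \o (f : T -> R)) ->
  c ^+ n * \int[lambda]_x f ((b + c *: (x : 'rV[R]_n)) : 'rV[R]_n) =
  \int[lambda]_x f x.
Proof.
move=> c0 mf fi.
have gi := integrable_rV_affine b c0 mf fi.
have mfE : measurable_fun setT (EFin \o f) by exact/measurable_EFinP.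
have cn0 : 0 < c ^+ n by exact: exprn_gt0.
have Ep := ge0_lebesgue_rV_affine b c0 (measurable_funepos mfE) (@funepos_ge0 _ _ _).
have En := ge0_lebesgue_rV_affine b c0 (measurable_funeneg mfE) (@funeneg_ge0 _ _ _).
have gpf := integrable_pos_fin_num measurableT gi.
have gnf := integrable_neg_fin_num measurableT gi.
pose g (x : T) : \bar R := (f ((b + c *: (x : 'rV[R]_n)) : 'rV[R]_n))%:E.
have Ef : (\int[lambda]_x (f x)%:E)%E = ((c ^+ n)%:E * \int[lambda]_x g^\+ x -
    (c ^+ n)%:E * \int[lambda]_x g^\- x)%E.
  apply: (etrans (integralE _ _ _)); congr (_ - _)%E.
    apply: (etrans _ (etrans (esym Ep) _)); first by apply: eq_integral.
    by congr (_ * _)%E; apply: eq_integral => x _; rewrite !funeposE.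
  apply: (etrans _ (etrans (esym En) _)); first by apply: eq_integral.
  by congr (_ * _)%E; apply: eq_integral => x _; rewrite !funenegE.
have Eg : (\int[lambda]_x g x)%E = (\int[lambda]_x g^\+ x - \int[lambda]_x g^\- x)%E.
  exact: integralE.
rewrite /Rintegral Ef -/(g _) [X in _ * fine X]Eg.
by rewrite -(fineK gpf) -(fineK gnf) -!EFinM -!EFinB /= -mulrBr.
Qed.

Lemma Rintegral_rV_shift (f : borel_rV R n -> R) (b : 'rV[R]_n) :
  measurable_fun setT f ->
  lambda.-integrable [set: T] (EFin \o (f : T -> R)) ->
  \int[lambda]_x f ((b + (x : 'rV[R]_n)) : 'rV[R]_n) = \int[lambda]_x f x.
Proof.
move=> mf fi; rewrite -(Rintegral_rV_affine b ltr01 mf fi) expr1n mul1r.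
by congr (Rintegral _ _ _); apply/funext => x; rewrite scale1r.
Qed.

Lemma continuous_support_bounded (K : set 'rV[R]_n) (f : 'rV[R]_n -> R) :
  compact K -> continuous f -> (forall x, ~ K x -> f x = 0) ->
  exists2 C : R, 0 <= C & forall x, `|f x| <= C.
Proof.
move=> cK cf f0.
have /compact_bounded[M [_ HM]] : compact (f @` K).
  by apply: continuous_compact => //; exact: continuous_subspaceT.
exists (`|M| + 1); first by have := normr_ge0 M; lra.
move=> x; have [Kx|nKx] := pselect (K x); last first.
  by rewrite f0// normr0; have := normr_ge0 M; lra.
apply: (HM (`|M| + 1)); last by exists x.
by have := ler_norm M; lra.
Qed.

Lemma continuous_support_integrable (K : set 'rV[R]_n) (f : 'rV[R]_n -> R) :
  compact K -> continuous f -> (forall x, ~ K x -> f x = 0) ->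
  lambda.-integrable [set: T] (EFin \o (f : T -> R)).
Proof.
move=> cK cf f0; have [C C0 fC] := continuous_support_bounded cK cf f0.
apply: (@integrable_bounded_support _ T R lambda K f C).
- exact: (measurable_borel_lebesgue (compact_measurable_rV cK)).
- exact: compact_lebesgue_fin.
- exact: (measurable_fun_borel_lebesgue (measurable_rV_continuous cf)).
- exact: fC.
- exact: f0.
Qed.

End rows_integral.

(** * Norm balls and their moments *)

Section norm_ball.
Context {R : realType} {n : nat} (N : 'rV[R]_n -> R) (hN : is_norm N).
Local Notation lambda := (lebesgue_rV R n).
Local Notation T := (lebesgue_rV_type R n).

Definition norm_ball (r : R) (x : 'rV[R]_n) : R := (N x < r)%R%:R.

Lemma norm_ball01 r x : 0 <= norm_ball r x <= 1.
Proof. by rewrite /norm_ball; case: (N x < r); rewrite /= ?lexx ?ler01. Qed.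

Lemma normr_norm_ball r x : `|norm_ball r x| <= 1.
Proof. by have /andP[? ?] := norm_ball01 r x; rewrite ger0_norm. Qed.

Lemma measurable_norm_ball r : measurable_fun setT (norm_ball r : borel_rV R n -> R).
Proof.
have oN : open [set x : 'rV[R]_n | N x < r].
  have /continuousP cN := is_norm_continuous hN.
  by apply: (cN [set y | y < r]); exact: open_lt.
have mN := @measurable_indic _ _ R setT _ (open_measurable_rV oN).
apply: (eq_measurable_fun _ _ mN) => x _; rewrite /norm_ball indicE.
by congr (nat_of_bool _)%:R; apply/idP/idP; rewrite inE.
Qed.

Lemma norm_ball_compact r : exists2 K : set 'rV[R]_n, compact K &
  forall x, ~ K x -> norm_ball r x = 0.
Proof.
have [c c0 cN] := is_norm_lb hN.
exists [set x : 'rV[R]_n | `|x| <= r / c].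
  apply: bounded_closed_compact.
    exists (r / c); split; first exact: num_real.
    by move=> M eM z /= ze; exact: le_trans ze (ltW eM).
  exact: (closed_comp (fun x _ => @norm_continuous _ _ x) (@closed_le _ (r / c))).
move=> x xr; rewrite /norm_ball; case: ltP => // Nx; exfalso; apply: xr => /=.
by rewrite ler_pdivlMr// mulrC; apply: le_trans (cN x) (ltW Nx).
Qed.

Lemma integrable_norm_ball (f : 'rV[R]_n -> R) (r : R) : continuous f ->
  lambda.-integrable [set: T] (EFin \o (fun x => norm_ball r x * f x)).
Proof.
move=> cf; have [K cK K0] := norm_ball_compact r.
have /compact_bounded[M [_ HM]] : compact (f @` K).
  by apply: continuous_compact => //; exact: continuous_subspaceT.
have MM : M < `|M| + 1 by have := ler_norm M; lra.
apply: (@integrable_bounded_support _ T R lambda K _ (`|M| + 1)).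
- exact: (measurable_borel_lebesgue (compact_measurable_rV cK)).
- exact: compact_lebesgue_fin.
- apply: measurable_funM.
    exact: (measurable_fun_borel_lebesgue (measurable_norm_ball r)).
  exact: (measurable_fun_borel_lebesgue (measurable_rV_continuous cf)).
- move=> x; have [Kx|nKx] := pselect (K x); last first.
    by rewrite K0// mul0r normr0; have := normr_ge0 M; lra.
  rewrite normrM; apply: (@le_trans _ _ `|f x|).
    by rewrite ler_piMl// normr_norm_ball.
  by apply: (HM (`|M| + 1)) => //; exists x.
- by move=> x nKx; rewrite K0// mul0r.
Qed.

Lemma mi_pow_continuous (a : multi_index n) : continuous (mi_pow ^~ a : 'rV[R]_n -> R).
Proof.
apply: smooth_continuous; rewrite /mi_pow.
have sX i m : smooth (fun x : 'rV[R]_n => x ord0 i ^+ m).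
  elim: m => [|m ih]; first exact: (smooth_cst 1).
  rewrite (_ : (fun x => _) = (fun x : 'rV[R]_n => x ord0 i) * (fun x => x ord0 i ^+ m)).
    by apply: smoothM; [exact: smooth_coord|exact: ih].
  by apply/funext => x; rewrite exprS.
elim: (index_enum _) => [|i s ih].
  rewrite (_ : (fun x => _) = cst 1); first exact: smooth_cst.
  by apply/funext => x; rewrite big_nil.
rewrite (_ : (fun x => _) = (fun x : 'rV[R]_n => x ord0 i ^+ a i) *
    (fun x => \prod_(j <- s) x ord0 j ^+ a j)).
  by apply: smoothM; [exact: sX|exact: ih].
by apply/funext => x; rewrite big_cons.
Qed.

Lemma mi_powZ (r : R) x (a : multi_index n) :
  mi_pow (r *: x) a = r ^+ mi_deg a * mi_pow x a.
Proof.
rewrite /mi_pow /mi_deg -prodrXr -big_split/=; apply: eq_bigr => i _.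
by rewrite mxE exprMn.
Qed.

(** The origin of the powers of [r] in the expansions: substituting [r *: x] yields [r ^+ n] from
    the measure and [r ^+ mi_deg a] from the monomial. *)
Lemma norm_ball_moment (r : R) (a : multi_index n) : 0 < r ->
  \int[lambda]_x (norm_ball r x * mi_pow x a) =
  r ^+ (n + mi_deg a) * \int[lambda]_x (norm_ball 1 x * mi_pow x a).
Proof.
move=> r0.
have mf : measurable_fun setT
    ((fun x => norm_ball r x * mi_pow x a) : borel_rV R n -> R).
  apply: measurable_funM; first exact: measurable_norm_ball.
  exact: (measurable_rV_continuous (@mi_pow_continuous a)).
rewrite -(Rintegral_rV_affine 0 r0 mf); last first.
  exact: (integrable_norm_ball r (@mi_pow_continuous a)).
rewrite exprD -mulrA; congr (_ * _).
rewrite -RintegralZl; [|exact: measurableT|]; last first.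
  exact: (integrable_norm_ball 1 (@mi_pow_continuous a)).
apply: eq_Rintegral => x _; rewrite add0r mi_powZ mulrCA; congr (_ * (_ * _)).
rewrite /norm_ball (is_norm_homogeneous hN) (ger0_norm (ltW r0)).
by rewrite -[X in _ < X]mulr1 ltr_pM2l.
Qed.

End norm_ball.

(** * Real-valued integrals and differentiation under the integral sign *)

Section Rintegral_lemmas.
Context d (T : measurableType d) {R : realType} (mu : {measure set T -> \bar R}).

Lemma integrable_boundedM (k q : T -> R) (C : R) : measurable_fun setT k ->
  (forall x, `|k x| <= C) -> mu.-integrable setT (EFin \o q) ->
  mu.-integrable setT (EFin \o (fun x => k x * q x)).
Proof.
move=> mk kC iq.
have mq : measurable_fun setT q by exact/measurable_EFinP/(measurable_int mu).
apply: (@le_integrable _ _ _ mu setT measurableT _ (EFin \o (fun y => C * q y))).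
- by apply/measurable_EFinP; apply: measurable_funM.
- move=> y _; rewrite /= lee_fin !normrM ler_wpM2r//.
  exact: le_trans (kC _) (ler_norm _).
- rewrite (_ : _ \o _ = fun y => (C%:E * (EFin \o q) y)%E)//.
  exact: integrableZl.
Qed.

Lemma integrable_Rsum (I : Type) (s : seq I) (F : I -> T -> R) :
  (forall i, mu.-integrable setT (EFin \o F i)) ->
  mu.-integrable setT (EFin \o (fun x => \sum_(i <- s) F i x)).
Proof.
move=> iF; elim: s => [|i s ih].
  rewrite (_ : _ \o _ = cst 0%E); first exact: integrable0.
  by apply/funext => x /=; rewrite big_nil.
rewrite (_ : _ \o _ = ((EFin \o F i) \+ (EFin \o (fun x => (\sum_(i <- s) F i x)%R)))%E).
  exact: integrableD.
by apply/funext => x /=; rewrite big_cons EFinD.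
Qed.

Lemma Rintegral_sum (I : Type) (s : seq I) (F : I -> T -> R) :
  (forall i, mu.-integrable setT (EFin \o F i)) ->
  \int[mu]_x (\sum_(i <- s) F i x) = \sum_(i <- s) \int[mu]_x F i x.
Proof.
move=> iF; elim: s => [|i s ih].
  rewrite big_nil /Rintegral integral0_eq// => x _; by rewrite big_nil.
rewrite big_cons -ih -RintegralD//; last exact: integrable_Rsum.
by apply: eq_Rintegral => x _; rewrite big_cons.
Qed.

Lemma integrable_RZ (q : T -> R) (c : R) : mu.-integrable setT (EFin \o q) ->
  mu.-integrable setT (EFin \o (fun x => c * q x)).
Proof.
move=> iq; rewrite (_ : _ \o _ = fun y => (c%:E * (EFin \o q) y)%E)//.
exact: integrableZl.
Qed.

Lemma integrable_RD (f g : T -> R) : mu.-integrable setT (EFin \o f) ->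
  mu.-integrable setT (EFin \o g) -> mu.-integrable setT (EFin \o (fun x => f x + g x)).
Proof.
by move=> fi gi; rewrite (_ : _ \o _ = (EFin \o f) \+ (EFin \o g))%E//; exact: integrableD.
Qed.

Lemma integrable_RB (f g : T -> R) : mu.-integrable setT (EFin \o f) ->
  mu.-integrable setT (EFin \o g) -> mu.-integrable setT (EFin \o (fun x => f x - g x)).
Proof.
by move=> fi gi; rewrite (_ : _ \o _ = (EFin \o f) \- (EFin \o g))%E//; exact: integrableB.
Qed.

Lemma integrable_Rnorm (f : T -> R) : mu.-integrable setT (EFin \o f) ->
  mu.-integrable setT (EFin \o (fun x => `|f x|)).
Proof. by move=> fi; have /= := integrable_abse fi. Qed.

Lemma normr_Rintegral_boundedM (k q : T -> R) (C : R) : measurable_fun setT k ->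
  (forall x, `|k x| <= C) -> mu.-integrable setT (EFin \o q) ->
  `|\int[mu]_x (k x * q x)| <= C * \int[mu]_x `|q x|.
Proof.
move=> mk kC iq; have ikq := integrable_boundedM mk kC iq.
apply: (le_trans (le_normr_Rintegral measurableT ikq)).
rewrite -RintegralZl//; last exact: integrable_Rnorm.
apply: le_Rintegral => //; first exact: integrable_Rnorm.
  exact/integrable_RZ/integrable_Rnorm.
by move=> x _; rewrite normrM ler_wpM2r.
Qed.

Lemma is_derive_under_Rintegral (f df : R -> T -> R) (G : T -> R) (t : R) :
  (forall s, mu.-integrable setT (EFin \o f s)) ->
  (forall (s : R) y, is_derive s 1 (fun s => f s y) (df s y)) ->
  mu.-integrable setT (EFin \o G) -> (forall s y, `|df s y| <= G y) ->
  is_derive t 1 (fun s => \int[mu]_y f s y) (\int[mu]_y df t y).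
Proof.
move=> fi fd Gi dG.
(* The derivative at [t] is a local matter, so any open interval around [t] serves. *)
have It : `]t - 1, t + 1[%classic t.
  by rewrite /= in_itv/= ltrDl ltr01 gtrBl ltr01.
have G0 y : 0 <= G y by exact: le_trans (normr_ge0 _) (dG t y).
have d1E s y : partial1of2 f s y = df s y.
  by rewrite partial1of2E; have [] := fd s y.
have der s y : (`]t - 1, t + 1[%classic : set R) s -> setT y -> derivable (f ^~ y) s 1.
  by move=> _ _; have [] := fd s y.
have ub s y : (`]t - 1, t + 1[%classic : set R) s -> setT y -> `|partial1of2 f s y| <= G y.
  by move=> _ _; rewrite d1E.
have fi' s : (`]t - 1, t + 1[%classic : set R) s -> mu.-integrable setT (EFin \o f s).
  by move=> _; exact: fi.
apply: DeriveDef.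
  exact: (derivable_under_integral measurableT It fi' der G0 Gi ub).
rewrite -derive1E (differentiation_under_integral measurableT It fi' der G0 Gi ub).
by apply: eq_Rintegral => y _; exact: d1E.
Qed.

End Rintegral_lemmas.

Lemma is_derive_sum_seq (R : realType) (I : Type) (s : seq I) (F : I -> R -> R)
    (dF : I -> R) (t : R) :
  (forall i, is_derive t 1 (F i) (dF i)) ->
  is_derive t 1 (fun x => \sum_(i <- s) F i x) (\sum_(i <- s) dF i).
Proof.
move=> HF; elim: s => [|i s ih].
  rewrite big_nil (_ : (fun x => _) = cst 0); first exact: is_derive_cst.
  by apply/funext => x; rewrite big_nil.
rewrite big_cons (_ : (fun x => _) = F i + (fun x => \sum_(i <- s) F i x)).
  exact: is_deriveD.
by apply/funext => x; rewrite big_cons.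
Qed.

Lemma is_derive_cmul (R : realType) (F : R -> R) (dF c t : R) :
  is_derive t 1 F dF -> is_derive t 1 (fun x => c * F x) (c * dF).
Proof. by move=> H; exact: (@is_deriveZ _ _ _ F c t 1 dF H). Qed.

(** * Taylor expansion of translated pairings *)

Section expansion.
Context {R : realType} {n : nat}.
Local Notation lambda := (lebesgue_rV R n).
Local Notation T := (lebesgue_rV_type R n).
Variables (K : set 'rV[R]_n) (q : T -> R).
Hypothesis cK : compact K.
Hypothesis iq : lambda.-integrable [set: T] (EFin \o q).

(** The correlation of [f] with [q]. The translation sits on [f], so that differentiation in [z]
    falls on the smooth factor while [q] is only integrable. *)
Definition pairing (f : 'rV[R]_n -> R) (z : 'rV[R]_n) : R :=
  \int[lambda]_y (f ((y : 'rV[R]_n) + z) * q y).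

Lemma smooth_support_bounded (f : 'rV[R]_n -> R) : smooth f ->
  (forall x, ~ K x -> f x = 0) -> exists2 C : R, 0 <= C & forall x, `|f x| <= C.
Proof.
move=> sf; exact: (continuous_support_bounded cK (smooth_continuous sf)).
Qed.

Lemma measurable_smooth_shift (f : 'rV[R]_n -> R) (z : 'rV[R]_n) : smooth f ->
  measurable_fun [set: T] (fun y : T => f ((y : 'rV[R]_n) + z)).
Proof. by move=> sf; exact: (measurable_smooth (@smooth_shift _ _ f z sf)). Qed.

Lemma integrable_pairing (f : 'rV[R]_n -> R) (z : 'rV[R]_n) : smooth f ->
  (forall x, ~ K x -> f x = 0) ->
  lambda.-integrable [set: T] (EFin \o (fun y : T => f ((y : 'rV[R]_n) + z) * q y)).
Proof.
move=> sf f0; have [C _ fC] := smooth_support_bounded sf f0.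
exact: (integrable_boundedM (measurable_smooth_shift z sf) (fun y => fC _) iq).
Qed.

Lemma is_derive_pairing (f : 'rV[R]_n -> R) (z : 'rV[R]_n) (t : R) : smooth f ->
  (forall x, ~ K x -> f x = 0) ->
  is_derive t 1 (fun s : R => pairing f (s *: z))
    (\sum_(k <- enum 'I_n) z ord0 k * pairing (partial k f) (t *: z)).
Proof.
move=> sf f0.
have clK : closed K by exact: (compact_closed (@norm_hausdorff _ _) cK).
have p0 k x : ~ K x -> partial k f x = 0 by exact: partial_support.
have sp k : smooth (partial k f) by exact: smooth_partial.
have /choice[C HC] : forall k, exists C : R, forall x, `|partial k f x| <= C.
  by move=> k; have [C _ fC] := smooth_support_bounded (sp k) (p0 k); exists C.
pose df (s : R) (y : T) : R := \sum_(k <- enum 'I_n)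
  z ord0 k * (partial k f ((y : 'rV[R]_n) + s *: z) * q y).
have E : \int[lambda]_y df t y =
    \sum_(k <- enum 'I_n) z ord0 k * pairing (partial k f) (t *: z).
  rewrite Rintegral_sum; last first.
    move=> k; apply: integrable_RZ; exact: (integrable_pairing (t *: z) (sp k) (p0 k)).
  apply: eq_bigr => k _; rewrite RintegralZl; [by []|exact: measurableT|].
  exact: (integrable_pairing (t *: z) (sp k) (p0 k)).
(* A majorant independent of [s]: the partial derivatives have compact support and are therefore
   bounded, by constants [C k]. *)
rewrite -E; pose G (y : T) : R := (\sum_(k <- enum 'I_n) `|z ord0 k| * C k) * `|q y|.
apply: (@is_derive_under_Rintegral _ T R lambda
  (fun (s : R) (y : T) => f ((y : 'rV[R]_n) + s *: z) * q y) df G t).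
- by move=> s; exact: (integrable_pairing (s *: z) sf f0).
- move=> s y.
  have := is_derive_line (@smooth_is_derive _ _ f (y + s *: z) z sf).
  move=> /(is_derive_cmul (q y)) H.
  rewrite (_ : (fun s => _) = (fun x : R => q y * f ((y : 'rV[R]_n) + x *: z))); last first.
    by apply/funext => x; rewrite mulrC.
  rewrite (_ : df s y = q y * \sum_i z ord0 i * partial i f (y + s *: z)); first exact: H.
  rewrite /df mulr_sumr big_enum; apply: eq_bigr => k _.
  by rewrite mulrA mulrC.
- exact: (integrable_RZ _ (integrable_Rnorm iq)).
- move=> s y; rewrite /df /G mulr_suml; apply: (le_trans (ler_norm_sum _ _ _)).
  apply: ler_sum => k _; rewrite !normrM mulrA ler_wpM2r ?normr_ge0//.
  by rewrite ler_wpM2l ?normr_ge0.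
Qed.

Variable psi : 'rV[R]_n -> R.
Hypothesis spsi : smooth psi.
Hypothesis psi0 : forall x, ~ K x -> psi x = 0.

Let D (a : multi_index n) := mi_derive a psi.

Let sD a : smooth (D a). Proof. exact: smooth_mi_derive. Qed.

Let D0 a x : ~ K x -> D a x = 0.
Proof.
have clK : closed K by exact: (compact_closed (@norm_hausdorff _ _) cK).
rewrite /D; have [s ->] := mi_deriveE a psi.
exact: (foldr_partial_support s clK psi0).
Qed.

(* The [i]-th derivative of [t |-> pairing psi (t *: z)]. *)
Definition line_derivative (i : nat) (z : 'rV[R]_n) (t : R) : R :=
  \sum_(a <- mi_seq i) multinomial a * (mi_pow z a * pairing (mi_derive a psi) (t *: z)).

(** Each term produces a sum over [k] of [z_k] times a [k]-th partial derivative; [sum_multinomialS]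
    regroups these into the multi-indices of degree [i + 1]. *)
Lemma is_derive_line_derivative i z (t : R) :
  is_derive t 1 (line_derivative i z) (line_derivative i.+1 z t).
Proof.
pose dF a : R := multinomial a * (mi_pow z a *
  \sum_(k <- enum 'I_n) z ord0 k * pairing (partial k (D a)) (t *: z)).
rewrite (_ : line_derivative i.+1 z t = \sum_(a <- mi_seq i) dF a); last first.
  rewrite /line_derivative (sum_multinomialS (R := R) i
    (fun a => mi_pow z a * pairing (D a) (t *: z))).
  rewrite exchange_big/=; apply: eq_bigr => a _; rewrite -mulr_sumr /dF; congr (_ * _).
  rewrite mulr_sumr [RHS]big_enum; apply: eq_bigr => k _.
  rewrite /D (mi_derive_incr _ _ spsi) mi_pow_incr -mulrA mulrCA.
  by [].
apply: (@is_derive_sum_seq R _ (mi_seq i) (fun a s => multinomial a *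
  (mi_pow z a * pairing (D a) (s *: z)))) => a.
apply: is_derive_cmul; apply: is_derive_cmul.
exact: (is_derive_pairing _ _ (sD a) (D0 a)).
Qed.

Lemma line_derivative0 z : line_derivative 0 z 1 = pairing psi z.
Proof.
rewrite /line_derivative mi_seq0 big_seq1 multinomial0 mul1r scale1r.
have d0 : mi_deg ([ffun=> 0%N] : multi_index n) = 0%N.
  by rewrite /mi_deg big1// => i _; rewrite ffunE.
have -> : mi_pow z [ffun=> 0%N] = 1.
  by rewrite /mi_pow big1// => i _; rewrite ffunE expr0.
rewrite mul1r; exact: (congr1 (pairing ^~ z) (mi_derive0 psi d0)).
Qed.

Lemma line_derivative_taylor (m : nat) (z : 'rV[R]_n) (M : R) :
  (forall t, 0 <= t <= 1 -> `|line_derivative m z t| <= M) ->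
  `|pairing psi z - \sum_(i < m) line_derivative i z 0 / i`!%:R| <= M.
Proof.
move=> HM.
have t1 : 0 <= (1 : R) <= 1 by rewrite ler01 lexx.
have := @taylor_bound R (fun i => line_derivative i z) m M
  (fun i t => is_derive_line_derivative i z t) HM 1 t1.
rewrite line_derivative0; congr (`|_ - _| <= _).
by apply: eq_bigr => i _; rewrite expr1n mulr1.
Qed.

End expansion.

(** * Expansion of ball pairings in powers of the radius *)

Section ball_expansion.
Context {R : realType} {n : nat}.
Local Notation lambda := (lebesgue_rV R n).
Local Notation T := (lebesgue_rV_type R n).
Variables (N : 'rV[R]_n -> R) (hN : is_norm N).

(** Both sides of the integrated mean value property have this shape: [(p, q)] is [(phi, u w)] on
    one side and [(u phi, w)] on the other. *)
Definition ball_pairing (r : R) (p q : T -> R) : R :=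
  \int[lambda]_x (p x * \int[lambda]_y
    (norm_ball N r ((x : 'rV[R]_n) - (y : 'rV[R]_n)) * q y)).

Definition ball_moment (a : multi_index n) : R :=
  multinomial a * \int[lambda]_x (norm_ball N 1 x * mi_pow x a).

Definition ball_volume : R := \int[lambda]_x norm_ball N 1 x.

Lemma ball_volume_ge0 : 0 <= ball_volume.
Proof. by apply: Rintegral_ge0 => x _; have /andP[] := norm_ball01 N 1 x. Qed.

Lemma integrable_norm_ball1 r : lambda.-integrable [set: T] (EFin \o (norm_ball N r : T -> R)).
Proof.
have := integrable_norm_ball hN r (@cst_continuous 'rV[R]_n R 1).
by congr (integrable _ _ (EFin \o _)); apply/funext => x; rewrite mulr1.
Qed.

Lemma norm_ball_volume (r : R) : 0 < r ->
  \int[lambda]_x norm_ball N r x = r ^+ n * ball_volume.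
Proof.
move=> r0; pose a0 : multi_index n := [ffun=> 0%N].
have p1 x : mi_pow x a0 = 1 :> R.
  by rewrite /mi_pow big1// => i _; rewrite ffunE expr0.
have d0 : mi_deg a0 = 0%N by rewrite /mi_deg big1// => i _; rewrite ffunE.
have := norm_ball_moment hN a0 r0; rewrite d0 addn0 /ball_volume.
by congr (_ = _ * _); apply: eq_Rintegral => x _; rewrite p1 mulr1.
Qed.

Lemma measurable_norm_ball2 r : measurable_fun [set: T * T]
  (fun p => norm_ball N r ((p.1 : 'rV[R]_n) - (p.2 : 'rV[R]_n))).
Proof.
have := measurable_fun_rV_comb (-1) (measurable_norm_ball hN r).
by congr (measurable_fun _ _); apply/funext => p; rewrite scaleN1r.
Qed.

Let nb1 r (z : T * T) :
  `|norm_ball N r ((z.1 : 'rV[R]_n) - (z.2 : 'rV[R]_n))| <= 1.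
Proof. exact: normr_norm_ball. Qed.

Lemma ball_pairing_sym r (p q : T -> R) :
  lambda.-integrable [set: T] (EFin \o p) -> lambda.-integrable [set: T] (EFin \o q) ->
  ball_pairing r p q = ball_pairing r q p.
Proof.
move=> ip iq.
rewrite /ball_pairing (@Fubini_kernel _ _ _ _ R lambda lambda p q
  (fun z => norm_ball N r ((z.1 : 'rV[R]_n) - (z.2 : 'rV[R]_n))) 1 ip iq
  (measurable_norm_ball2 r) (nb1 r)).
apply: eq_Rintegral => y _; congr (_ * _); apply: eq_Rintegral => x _.
by congr (_ * _); rewrite /norm_ball (is_normB hN).
Qed.

Lemma normr_ball_pairing_le r (p q : T -> R) :
  lambda.-integrable [set: T] (EFin \o p) -> lambda.-integrable [set: T] (EFin \o q) ->
  `|ball_pairing r p q| <= \int[lambda]_y `|q y| * \int[lambda]_x `|p x|.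
Proof.
move=> ip iq; rewrite -[X in _ <= X * _]mul1r.
exact: (@normr_kernel_le _ _ _ _ R lambda lambda p q
  (fun z => norm_ball N r ((z.1 : 'rV[R]_n) - (z.2 : 'rV[R]_n))) 1 ip iq
  (measurable_norm_ball2 r) (nb1 r)).
Qed.

Lemma ball_pairingB r (p1 p2 q : T -> R) :
  lambda.-integrable [set: T] (EFin \o p1) -> lambda.-integrable [set: T] (EFin \o p2) ->
  lambda.-integrable [set: T] (EFin \o q) ->
  ball_pairing r (fun x => p1 x - p2 x) q = ball_pairing r p1 q - ball_pairing r p2 q.
Proof.
move=> i1 i2 iq.
have ik p (ip : lambda.-integrable [set: T] (EFin \o p)) :=
  @integrable_kernel _ _ _ _ R lambda lambda p q
  (fun z => norm_ball N r ((z.1 : 'rV[R]_n) - (z.2 : 'rV[R]_n))) 1 ip iq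
  (measurable_norm_ball2 r) (nb1 r).
rewrite /ball_pairing -RintegralB; [|exact: measurableT|exact: ik|exact: ik].
by apply: eq_Rintegral => x _; rewrite mulrBl.
Qed.

Variables (K : set 'rV[R]_n) (cK : compact K).
Variables (q : T -> R) (iq : lambda.-integrable [set: T] (EFin \o q)).
Variable psi : 'rV[R]_n -> R.
Hypothesis spsi : smooth psi.
Hypothesis psi0 : forall x, ~ K x -> psi x = 0.

Let ipsi : lambda.-integrable [set: T] (EFin \o (psi : T -> R)).
Proof. exact: (continuous_support_integrable cK (smooth_continuous spsi) psi0). Qed.

Let psi_bound : exists2 C : R, 0 <= C & forall x, `|psi x| <= C.
Proof. exact: (continuous_support_bounded cK (smooth_continuous spsi) psi0). Qed.

Let mpsi2 : measurable_fun [set: T * T]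
  (fun p => psi ((p.2 : 'rV[R]_n) + (p.1 : 'rV[R]_n))).
Proof.
have := measurable_fun_rV_comb 1 (measurable_rV_continuous (smooth_continuous spsi)).
by congr (measurable_fun _ _); apply/funext => p; rewrite scale1r addrC.
Qed.

(** The double integral becomes an integral of translated pairings over the ball centred at 0, which
    Taylor's formula can expand. Symmetry of the norm first brings [psi] into the inner integral:
    the shift by [y] then acts on a Borel function only. *)
Lemma ball_pairingE r :
  ball_pairing r psi q = \int[lambda]_z (norm_ball N r z * pairing q psi z).
Proof.
rewrite (ball_pairing_sym r ipsi iq) /ball_pairing.
have [C C0 psiC] := psi_bound.
rewrite [RHS](@Fubini_kernel _ _ _ _ R lambda lambda (norm_ball N r : T -> R) q
  (fun z => psi ((z.2 : 'rV[R]_n) + (z.1 : 'rV[R]_n))) C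
  (integrable_norm_ball1 r) iq _ (fun z => psiC _)); last first.
  exact: mpsi2.
apply: eq_Rintegral => y _; apply: (congr1 (GRing.mul (q y))).
have mb : measurable_fun setT ((fun x => norm_ball N r (y - x)) : borel_rV R n -> R).
  have := measurable_rV_affine_lebesgue y (-1) (measurable_norm_ball hN r).
  by congr (measurable_fun _ _); apply/funext => x; rewrite scaleN1r.
have mf : measurable_fun setT
    ((fun x => norm_ball N r (y - x) * psi x) : borel_rV R n -> R).
  apply: measurable_funM; first exact: mb.
  exact: (measurable_rV_continuous (smooth_continuous spsi)).
rewrite -(Rintegral_rV_shift y mf); last first.
  exact: (integrable_boundedM (measurable_fun_borel_lebesgue mb)
    (fun x => normr_norm_ball N r (y - x)) ipsi).
apply: eq_Rintegral => z _; rewrite mulrC /norm_ball.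
by rewrite opprD addNKr (is_normN hN).
Qed.

Let mult_moment i (r : R) : 0 < r ->
  \int[lambda]_z (norm_ball N r z * (line_derivative q psi i z 0 / i`!%:R)) =
  r ^+ (n + i) / i`!%:R *
    \sum_(a <- mi_seq i) ball_moment a * pairing q (mi_derive a psi) 0.
Proof.
move=> r0.
pose c a : R := multinomial a * pairing q (mi_derive a psi) 0 / i`!%:R.
transitivity (\int[lambda]_z (\sum_(a <- mi_seq i) c a * (norm_ball N r z * mi_pow z a))).
  apply: eq_Rintegral => z _; rewrite /line_derivative mulr_suml mulr_sumr.
  by apply: eq_bigr => a _; rewrite scale0r /c; ring.
rewrite Rintegral_sum; last first.
  by move=> a; apply: integrable_RZ; exact: (integrable_norm_ball hN r (@mi_pow_continuous _ _ a)).
rewrite mulr_sumr big_seq [RHS]big_seq; apply: eq_bigr => a.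
rewrite mem_mi_seq => /eqP ai.
rewrite RintegralZl; [|exact: measurableT|]; last first.
  exact: (integrable_norm_ball hN r (@mi_pow_continuous _ _ a)).
by rewrite (norm_ball_moment hN a r0) ai /c /ball_moment; ring.
Qed.

(** Taylor's formula integrated over the ball, whose volume is [r ^+ n * ball_volume]. The bound [M]
    is asked for only inside the ball, so it may depend on [r]. *)
Lemma ball_expansion_le (m : nat) (r M : R) : 0 < r -> 0 <= M ->
  (forall z t, N z < r -> 0 <= t <= 1 -> `|line_derivative q psi m z t| <= M) ->
  `|ball_pairing r psi q - \sum_(i < m) r ^+ (n + i) / i`!%:R *
      \sum_(a <- mi_seq i) ball_moment a * pairing q (mi_derive a psi) 0| <=
  M * (r ^+ n * ball_volume).
Proof.
move=> r0 M0 HM.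
pose L i (z : T) := norm_ball N r z * (line_derivative q psi i z 0 / i`!%:R).
have iL i : lambda.-integrable [set: T] (EFin \o L i).
  have -> : L i = fun z => \sum_(a <- mi_seq i) (multinomial a *
      pairing q (mi_derive a psi) 0 / i`!%:R) * (norm_ball N r z * mi_pow z a).
    apply/funext => z; rewrite /L /line_derivative mulr_suml mulr_sumr.
    by apply: eq_bigr => a _; rewrite scale0r; ring.
  apply: integrable_Rsum => a; apply: integrable_RZ.
  exact: (integrable_norm_ball hN r (@mi_pow_continuous _ _ a)).
have iP : lambda.-integrable [set: T] (EFin \o (fun z => norm_ball N r z * pairing q psi z)).
  have [C C0 psiC] := psi_bound.
  exact: (@integrable_kernel _ _ _ _ R lambda lambda (norm_ball N r : T -> R) q
    (fun z => psi ((z.2 : 'rV[R]_n) + (z.1 : 'rV[R]_n))) C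
    (integrable_norm_ball1 r) iq mpsi2 (fun z => psiC _)).
have iS : lambda.-integrable [set: T] (EFin \o (fun z => \sum_(i < m) L i z)).
  exact: (integrable_Rsum _ (fun i : 'I_m => iL i)).
have -> : \sum_(i < m) r ^+ (n + i) / i`!%:R *
    \sum_(a <- mi_seq i) ball_moment a * pairing q (mi_derive a psi) 0 =
    \int[lambda]_z (\sum_(i < m) L i z).
  rewrite (Rintegral_sum _ (fun i : 'I_m => iL i)).
  by apply: eq_bigr => i _; rewrite mult_moment.
rewrite ball_pairingE -RintegralB; [|exact: measurableT|exact: iP|exact: iS].
apply: (le_trans (le_normr_Rintegral measurableT _)).
  exact: integrable_RB.
rewrite -norm_ball_volume// -RintegralZl; [|exact: measurableT|exact: integrable_norm_ball1].
apply: le_Rintegral.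
- exact: measurableT.
- exact/integrable_Rnorm/integrable_RB.
- exact/integrable_RZ/integrable_norm_ball1.
move=> z _; rewrite /L -mulr_sumr -mulrBr normrM.
have /andP[b0 _] := norm_ball01 N r z; rewrite (ger0_norm b0) mulrC.
rewrite /norm_ball; case: ltP => zr; last by rewrite !mulr0.
rewrite !mulr1.
exact: (line_derivative_taylor cK iq spsi psi0 (fun t => HM z t zr)).
Qed.

Lemma normr_mi_pow_le (z : 'rV[R]_n) (a : multi_index n) :
  `|mi_pow z a| <= `|z| ^+ mi_deg a.
Proof.
rewrite /mi_pow /mi_deg normr_prod -prodrXr; apply: ler_prod => i _.
by rewrite normr_ge0 normrX lerXn2r ?nnegrE// rV_coord_le_norm.
Qed.

Lemma multinomial_ge0 (a : multi_index n) : 0 <= multinomial a :> R.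
Proof. by rewrite /multinomial divr_ge0// prodr_ge0. Qed.

Lemma normr_line_derivative_le (m : nat) (z : 'rV[R]_n) (t : R) (B : multi_index n -> R) :
  (forall a, mi_deg a = m -> `|pairing q (mi_derive a psi) (t *: z)| <= B a) ->
  `|line_derivative q psi m z t| <= `|z| ^+ m * \sum_(a <- mi_seq m) multinomial a * B a.
Proof.
move=> HB; rewrite /line_derivative mulr_sumr; apply: (le_trans (ler_norm_sum _ _ _)).
rewrite big_seq [leRHS]big_seq; apply: ler_sum => a; rewrite mem_mi_seq => /eqP am.
have c0 := multinomial_ge0 a.
rewrite normrM (ger0_norm c0) normrM mulrCA; apply: ler_pM.
- exact: normr_ge0.
- by rewrite mulr_ge0 ?normr_ge0.
- by rewrite -am; exact: normr_mi_pow_le.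
- by rewrite ler_wpM2l ?HB.
Qed.

End ball_expansion.

(** * Positivity of integrals and bounded representatives *)

Section measure_lemmas.
Context d (T : measurableType d) {R : realType} (mu : {measure set T -> \bar R}).

Lemma Rintegral_gt0 (A : set T) (w : T -> R) : measurable A -> (0 < mu A)%E ->
  mu.-integrable A (EFin \o w) -> {ae mu, forall x, A x -> 0 < w x} ->
  0 < \int[mu]_(x in A) w x.
Proof.
move=> mA A0 iw w0.
have mw := measurable_int mu iw.
have E : (\int[mu]_(x in A) (w x)%:E = \int[mu]_(x in A) `|(w x)%:E|)%E.
  apply: ae_eq_integral => //; first exact: measurableT_comp.
  by apply: filterS w0 => x h Ax; rewrite /= gtr0_norm// h.
have ge0 : (0 <= \int[mu]_(x in A) (w x)%:E)%E by rewrite E; exact: integral_ge0.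
have fin : (\int[mu]_(x in A) (w x)%:E)%E \is a fin_num by exact: integrable_fin_num.
rewrite /Rintegral fine_gt0// ltey_eq fin andbT lt_neqAle ge0 andbT eq_sym.
rewrite E; apply/eqP => /(ae_eq_integral_abs mu mA mw).1 w00.
suff : mu A = 0%E by move=> h; move: A0; rewrite h ltxx.
apply: measure_negligible => //.
have : {ae mu, forall x, ~ A x}.
  apply: filterS2 w0 w00 => x h1 h2 Ax.
  by have := h1 Ax; have /= [->] := h2 Ax; rewrite ltxx.
by apply: negligibleS => x Ax /=; apply.
Qed.

Lemma ae_eq_RintegralT (f g : T -> R) : measurable_fun setT f -> measurable_fun setT g ->
  {ae mu, forall x, f x = g x} -> \int[mu]_x f x = \int[mu]_x g x.
Proof.
move=> mf mg fg; rewrite /Rintegral; congr fine; apply: ae_eq_integral => //.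
- exact/measurable_EFinP.
- exact/measurable_EFinP.
- by apply: filterS fg => x /= -> _.
Qed.

(** Truncation at the essential supremum alters the function on a null set only and yields a
    representative bounded at every point. *)
Lemma Lfun_infty_bounded (f : T -> R) : f \in Lfun mu +oo%E ->
  exists (g : T -> R) (M : R), [/\ measurable_fun setT f, measurable_fun setT g, 0 <= M,
    (forall x, `|g x| <= M) & {ae mu, forall x, f x = g x}].
Proof.
rewrite inE => /andP[/set_mem mf /set_mem].
rewrite /= /finite_norm unlock => fin.
have [M [M0 fM]] : exists M : R, 0 <= M /\ {ae mu, forall x, `|f x| <= M}.
  move: fin; case: ifPn => [mu0 fin|mu0 _].
    have [M ML] : exists M : R, (ess_sup mu (abse \o (EFin \o f)) <= M%:E)%E.
      move: fin; case: (ess_sup _ _) => [r _| // |_]; first by exists r.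
      by exists 0; rewrite leNye.
    exists `|M|; split => //; have := @ess_sup_ge _ _ _ mu (abse \o (EFin \o f)).
    apply: filterS => x /= h.
    have := le_trans h ML; rewrite lee_fin => /le_trans; apply; exact: ler_norm.
  (* If the whole space is null, every bound holds almost everywhere. *)
  exists 0; split => //; have mT0 : mu setT = 0%E.
    by apply/eqP; rewrite eq_le measure_ge0 andbT leNgt.
  by exists setT; split.
exists (fun x => Num.max (- M) (Num.min (f x) M)), M; split => //.
- apply: measurable_maxr; first exact: measurable_cst.
  by apply: measurable_minr => //; exact: measurable_cst.
- move=> x; rewrite ler_norml le_max lexx/= ge_max ge_min lexx orbT andbT.
  by move: M0; lra.
- apply: filterS fM => x; rewrite ler_norml => /andP[h1 h2].
  by rewrite (min_idPl h2) (max_idPr h1).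
Qed.

End measure_lemmas.

Section test_functions.
Context {R : realType} {n : nat}.
Local Notation lambda := (lebesgue_rV R n).
Local Notation T := (lebesgue_rV_type R n).

Lemma smooth_test_function (Omega L : set 'rV[R]_n) (f : 'rV[R]_n -> R) :
  smooth f -> compact L -> L `<=` Omega -> (forall x, ~ L x -> f x = 0) ->
  test_function Omega f.
Proof.
move=> sf cL LO f0; split; first exact: sf.
have clL : closed L by exact: (compact_closed (@norm_hausdorff _ _) cL).
have sub : closure [set x | f x != 0] `<=` L.
  rewrite closureE => x; apply; split => // y /= fy.
  by apply: contrapT => Ly; move: fy; rewrite f0 ?eqxx.
split; last exact: subset_trans sub LO.
exact: subclosed_compact (@closed_closure _ _) cL sub.
Qed.

Lemma mi_derive_shift (f : 'rV[R]_n -> R) (a : multi_index n) (z : 'rV[R]_n) :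
  mi_derive a (f \o shift z) = mi_derive a f \o shift z.
Proof.
rewrite /mi_derive; elim: (enum _) => [|i s ih]; first by [].
rewrite /= ih; elim: (a i) => [|m ihm]; first by [].
by rewrite !iterS ihm partial_shift.
Qed.

Lemma Rintegral_normr_shift (f : 'rV[R]_n -> R) (z : 'rV[R]_n) (K : set 'rV[R]_n) :
  compact K -> smooth f -> (forall x, ~ K x -> f x = 0) ->
  \int[lambda]_y `|f ((y : 'rV[R]_n) + z)| = \int[lambda]_y `|f y|.
Proof.
move=> cK sf f0.
have cf : continuous (fun x => `|f x|).
  move=> x; apply: (@continuous_comp _ _ _ f Num.norm).
    exact: smooth_continuous.
  exact: norm_continuous.
rewrite -(Rintegral_rV_shift z (measurable_rV_continuous cf)).
  by apply: eq_Rintegral => y _; rewrite addrC.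
apply: (continuous_support_integrable cK cf) => x Kx.
by rewrite f0// normr0.
Qed.

End test_functions.

Section expansion_bigO.
Context {R : realType} {n : nat}.
Local Notation lambda := (lebesgue_rV R n).
Local Notation T := (lebesgue_rV_type R n).
Variables (N : 'rV[R]_n -> R) (hN : is_norm N).
Variables (K : set 'rV[R]_n) (cK : compact K).

Lemma mi_derive_support (a : multi_index n) (f : 'rV[R]_n -> R) :
  (forall x, ~ K x -> f x = 0) -> forall x, ~ K x -> mi_derive a f x = 0.
Proof.
have [s ->] := mi_deriveE a f.
exact: (foldr_partial_support s (compact_closed (@norm_hausdorff _ _) cK)).
Qed.

Variables (q : T -> R) (iq : lambda.-integrable [set: T] (EFin \o q)).
Variables (psi : 'rV[R]_n -> R) (spsi : smooth psi).
Hypothesis psi0 : forall x, ~ K x -> psi x = 0.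

Lemma pairing_mi_derive_bounded (a : multi_index n) :
  exists2 C : R, 0 <= C & forall z, `|pairing q (mi_derive a psi) z| <= C.
Proof.
have [C C0 HC] := continuous_support_bounded cK
  (smooth_continuous (smooth_mi_derive a spsi)) (mi_derive_support a psi0).
exists (C * \int[lambda]_y `|q y|).
  by apply: mulr_ge0; [exact: C0|apply: Rintegral_ge0 => y _; exact: normr_ge0].
move=> z; apply: normr_Rintegral_boundedM; last exact: iq.
  exact: (measurable_smooth_shift z (smooth_mi_derive a spsi)).
by move=> y; exact: HC.
Qed.

(** The ball is star-shaped, so [t *: z] stays inside, and [|z| <= r / c] supplies the factor of
    order [r ^+ m]. [HB] is restricted to the ball because weak derivatives can be used only for
    small shifts. *)
Lemma line_derivative_norm_ball_le (c r : R) (m : nat) (B : multi_index n -> R) :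
  0 < c -> (forall x, c * `|x| <= N x) ->
  (forall a z, mi_deg a = m -> N z < r -> `|pairing q (mi_derive a psi) z| <= B a) ->
  0 < r -> forall z t, N z < r -> 0 <= t <= 1 ->
  `|line_derivative q psi m z t| <= (r / c) ^+ m * \sum_(a <- mi_seq m) multinomial a * B a.
Proof.
move=> c0 cN HB r0 z t zr /andP[t0 t1].
have tz : N (t *: z) < r.
  rewrite (is_norm_homogeneous hN) (ger0_norm t0); apply: le_lt_trans zr.
  by rewrite ler_piMl// (is_norm_ge0 hN).
have B0 : 0 <= \sum_(a <- mi_seq m) multinomial a * B a.
  rewrite big_seq; apply: sumr_ge0 => a; rewrite mem_mi_seq => /eqP am.
  apply: mulr_ge0; first exact: multinomial_ge0.
  exact: (le_trans (normr_ge0 _) (HB a (t *: z) am tz)).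
apply: (le_trans (normr_line_derivative_le (fun a am => HB a (t *: z) am tz))).
apply: ler_wpM2r; first exact: B0.
apply: lerXn2r; rewrite ?nnegrE ?normr_ge0 ?divr_ge0 ?ltW//.
rewrite ltr_pdivlMr// mulrC; exact: (le_lt_trans (cN z) zr).
Qed.

(** The constant involves the suprema of the derivatives of [psi] of order [m], so it is uniform in
    [r] but not in [psi]. *)
Lemma ball_expansion_bigO (m : nat) : exists2 C : R, 0 <= C & forall r, 0 < r ->
  `|ball_pairing N r psi q - \sum_(i < m) r ^+ (n + i) / i`!%:R *
      \sum_(a <- mi_seq i) ball_moment N a * pairing q (mi_derive a psi) 0| <=
  C * r ^+ (n + m).
Proof.
have [c c0 cN] := is_norm_lb hN.
have /choice[B HB] : forall a : multi_index n, exists C : R, 0 <= C /\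
    forall z, `|pairing q (mi_derive a psi) z| <= C.
  by move=> a; have [C C0 HC] := pairing_mi_derive_bounded a; exists C.
pose S := \sum_(a <- mi_seq m) multinomial a * B a.
have S0 : 0 <= S.
  by apply: sumr_ge0 => a _; apply: mulr_ge0; [exact: multinomial_ge0|exact: (HB a).1].
exists (c ^- m * S * ball_volume N).
  apply: mulr_ge0; last exact: ball_volume_ge0.
  by apply: mulr_ge0 S0; rewrite invr_ge0 exprn_ge0// ltW.
move=> r r0; have M0 : 0 <= (r / c) ^+ m * S.
  by apply: mulr_ge0 S0; rewrite exprn_ge0// divr_ge0// ltW.
apply: (le_trans (ball_expansion_le hN cK iq spsi psi0 r0 M0 _)).
  move=> z t zr t01.
  exact: (line_derivative_norm_ball_le c0 cN (fun a z _ _ => (HB a).2 z) r0 zr t01).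
rewrite le_eqVlt; apply/orP; left; apply/eqP.
by rewrite expr_div_n exprD; ring.
Qed.
End expansion_bigO.

(** * Test functions multiplied by bounded functions *)

Lemma le_of_linear_bound (R : realFieldType) (a x y : R) : 0 <= y ->
  (forall eps, 0 < eps -> a <= x + y * eps) -> a <= x.
Proof.
move=> y0 H; apply/ler_addgt0Pr => eps e0.
have y1 : 0 < y + 1 by rewrite ltr_wpDl.
apply: (le_trans (H _ (divr_gt0 e0 y1))); rewrite lerD2l mulrCA ger_pMr//.
by rewrite ler_pdivrMr// mul1r lerDl.
Qed.

Section smooth_dense_Rintegral.
Context {R : realType} {n : nat}.
Local Notation lambda := (lebesgue_rV R n).
Local Notation T := (lebesgue_rV_type R n).

Lemma smooth_dense_Rintegral (h f : T -> R) (C : R) : (forall x, 0 <= h x) ->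
  lambda.-integrable [set: T] (EFin \o h) -> measurable_fun [set: T] f ->
  (forall x, `|f x| <= C) -> forall eps : R, 0 < eps ->
  exists2 v : 'rV[R]_n -> R, smooth v & \int[lambda]_x (`|f x - v x| * h x) <= eps.
Proof.
move=> h0 ih mf fC eps eps0; have [v sv vf] := smooth_dense h0 ih mf fC eps0.
exists v; first exact: sv.
have I0 : (0 <= \int[lambda]_x (`|f x - v x| * h x)%:E)%E.
  by apply: integral_ge0 => x _; rewrite lee_fin; apply: mulr_ge0; [exact: normr_ge0|exact: h0].
rewrite /Rintegral -lee_fin fineK; first exact: vf.
by rewrite ge0_fin_numE//; exact: (le_lt_trans vf (ltry _)).
Qed.

End smooth_dense_Rintegral.

(** * Expansion with the derivatives moved onto the weight *)

Section weak_expansion.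
Context {R : realType} {n : nat}.
Local Notation lambda := (lebesgue_rV R n).
Local Notation T := (lebesgue_rV_type R n).
Variables (N : 'rV[R]_n -> R) (hN : is_norm N).
Variables (K : set 'rV[R]_n) (cK : compact K).
Variables (q : T -> R) (iq : lambda.-integrable [set: T] (EFin \o q)).
Variables (m : nat) (W : multi_index n -> T -> R) (M : multi_index n -> R) (e : R).
Hypothesis e0 : 0 < e.
Hypothesis mW : forall a, measurable_fun [set: T] (W a).
Hypothesis WM : forall a x, `|W a x| <= M a.
(** [W a] models a bounded weak derivative of the cut-off weight [q]; the restriction [|z| <= e]
    keeps the shifted support in the region where [q] is not cut off. *)
Hypothesis weakW : forall a psi z, (mi_deg a <= m)%N -> smooth psi ->
  (forall x, ~ K x -> psi x = 0) -> `|z| <= e ->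
  pairing q (mi_derive a psi) z =
  (-1) ^+ mi_deg a * \int[lambda]_y (W a y * psi ((y : 'rV[R]_n) + z)).

(* The derivatives have been moved onto the weight, so that this makes sense for
   a merely bounded [g]. *)
Definition weak_coef (g : T -> R) (i : nat) : R :=
  \sum_(a <- mi_seq i) ball_moment N a * ((-1) ^+ i * \int[lambda]_y (W a y * g y)).

(** The term of order [m] is subtracted too, so the aim is an error of size o(r^(n+m)). *)
Definition weak_remainder (r : R) (g : T -> R) : R :=
  ball_pairing N r g q - \sum_(i < m.+1) r ^+ (n + i) / i`!%:R * weak_coef g i.

Local Notation integrableT f := (lambda.-integrable [set: T] (EFin \o f)).

Lemma weak_coefB (f g : T -> R) i : integrableT f -> integrableT g ->
  weak_coef (fun x => f x - g x) i = weak_coef f i - weak_coef g i.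
Proof.
move=> fi gi; rewrite /weak_coef -sumrB; apply: eq_bigr => a _.
rewrite -mulrBr -mulrBr -RintegralB; [|exact: measurableT| |].
- by do 2!apply: congr1; apply: eq_Rintegral => y _; rewrite mulrBr.
- exact: (integrable_boundedM (mW a) (WM a) fi).
- exact: (integrable_boundedM (mW a) (WM a) gi).
Qed.

Lemma weak_remainderB r (f g : T -> R) : integrableT f -> integrableT g ->
  weak_remainder r (fun x => f x - g x) = weak_remainder r f - weak_remainder r g.
Proof.
move=> fi gi; rewrite /weak_remainder (ball_pairingB hN r fi gi iq).
rewrite (eq_bigr (fun i : 'I_m.+1 => r ^+ (n + i) / i`!%:R * weak_coef f i -
   r ^+ (n + i) / i`!%:R * weak_coef g i)); last first.
  by move=> i _; rewrite (weak_coefB _ fi gi) mulrBr.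
by rewrite sumrB; ring.
Qed.

Lemma weak_coef_le i (g : T -> R) : integrableT g ->
  `|weak_coef g i| <= (\sum_(a <- mi_seq i) `|ball_moment N a| * M a) * \int[lambda]_y `|g y|.
Proof.
move=> ig; rewrite /weak_coef mulr_suml; apply: (le_trans (ler_norm_sum _ _ _)).
apply: ler_sum => a _.
rewrite normrM -mulrA; apply: ler_wpM2l; first exact: normr_ge0.
rewrite normrM normrX normrN1 expr1n mul1r.
exact: (normr_Rintegral_boundedM (mW a) (WM a) ig).
Qed.

Let M0 a : 0 <= M a.
Proof. exact: (le_trans (normr_ge0 _) (WM a (0 : 'rV[R]_n))). Qed.

Let moment_bound i : R := \sum_(a <- mi_seq i) `|ball_moment N a| * M a.

Let moment_bound_ge0 i : 0 <= moment_bound i.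
Proof. by apply: sumr_ge0 => a _; apply: mulr_ge0; [exact: normr_ge0|exact: M0]. Qed.

(** L^1 continuity at a fixed radius. The constant depends on [r], which is harmless: it only
    multiplies an approximation error that tends to 0 while [r] stays fixed. *)
Lemma weak_remainder_le r : 0 < r -> exists2 C : R, 0 <= C &
  forall g : T -> R, integrableT g -> `|weak_remainder r g| <= C * \int[lambda]_y `|g y|.
Proof.
move=> r0.
have c0 i : 0 <= r ^+ (n + i) / i`!%:R.
  by apply: divr_ge0; [apply: exprn_ge0; exact: ltW|exact: ler0n].
exists (\int[lambda]_y `|q y| + \sum_(i < m.+1) r ^+ (n + i) / i`!%:R * moment_bound i).
  apply: addr_ge0; first by apply: Rintegral_ge0 => y _; exact: normr_ge0.
  by apply: sumr_ge0 => i _; apply: mulr_ge0; [exact: c0|exact: moment_bound_ge0].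
move=> g ig; apply: (le_trans (ler_normB _ _)); rewrite mulrDl; apply: lerD.
  exact: (normr_ball_pairing_le hN r ig iq).
rewrite mulr_suml; apply: (le_trans (ler_norm_sum _ _ _)); apply: ler_sum => i _.
rewrite normrM (ger0_norm (c0 i)) -[leRHS]mulrA; apply: ler_wpM2l; first exact: c0.
exact: weak_coef_le.
Qed.

Lemma weak_coef_smooth i (psi : 'rV[R]_n -> R) : (i <= m)%N -> smooth psi ->
  (forall x, ~ K x -> psi x = 0) ->
  weak_coef psi i = \sum_(a <- mi_seq i) ball_moment N a * pairing q (mi_derive a psi) 0.
Proof.
move=> im spsi psi0; rewrite /weak_coef big_seq [RHS]big_seq; apply: eq_bigr => a.
rewrite mem_mi_seq => /eqP ai; apply: congr1.
have ez : `|0 : 'rV[R]_n| <= e by rewrite normr0 ltW.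
rewrite (weakW (leq_trans (eq_leq ai) im) spsi psi0 ez) ai.
by apply: congr1; apply: eq_Rintegral => y _; rewrite addr0.
Qed.

Lemma weak_remainder_smooth_bigO (psi : 'rV[R]_n -> R) : smooth psi ->
  (forall x, ~ K x -> psi x = 0) -> exists2 C : R, 0 <= C & forall r, 0 < r ->
  `|weak_remainder r psi| <= C * r ^+ (n + m).+1.
Proof.
move=> spsi psi0.
(* Taylor's formula one order further than [m] supplies the additional power of [r]. *)
have [C C0 HC] := ball_expansion_bigO hN cK iq spsi psi0 m.+1.
exists C => [|r r0]; first exact: C0.
rewrite -addnS; apply: le_trans (HC r r0); rewrite /weak_remainder.
rewrite le_eqVlt; apply/orP; left; apply/eqP; do 3!apply: congr1.
apply: eq_bigr => i _; apply: congr1.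
by apply: weak_coef_smooth; [exact: (ltn_ord i)|exact: spsi|exact: psi0].
Qed.

(* Expanding to order [m] only and moving the derivatives onto the weight, the
   error depends on [psi] through its L^1 norm alone; hence it passes to L^1
   limits, unlike the bound of [weak_remainder_smooth_bigO]. *)
Lemma weak_remainder_smooth_le : exists2 C : R, 0 <= C & exists2 rho : R, 0 < rho &
  forall r psi, 0 < r -> r < rho -> smooth psi -> (forall x, ~ K x -> psi x = 0) ->
  `|weak_remainder r psi| <= C * r ^+ (n + m) * \int[lambda]_y `|psi y|.
Proof.
have [c c0 cN] := is_norm_lb hN.
pose S := \sum_(a <- mi_seq m) multinomial a * M a.
have S0 : 0 <= S.
  by apply: sumr_ge0 => a _; apply: mulr_ge0; [exact: multinomial_ge0|exact: M0].
(* The first summand bounds the Taylor remainder of order [m], the second the term of order [m] that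
   [weak_remainder] also subtracts. *)
exists (c ^- m * S * ball_volume N + moment_bound m / m`!%:R).
  apply: addr_ge0.
    apply: mulr_ge0; last exact: ball_volume_ge0.
    by apply: mulr_ge0 S0; rewrite invr_ge0 exprn_ge0// ltW.
  by apply: divr_ge0; [exact: moment_bound_ge0|exact: ler0n].
(* [N z < c * e] forces [|z| <= e], the range of [weakW]. *)
exists (c * e); first exact: mulr_gt0.
move=> r psi r0 rce spsi psi0.
have I0 : 0 <= \int[lambda]_y `|psi y| by apply: Rintegral_ge0 => y _; exact: normr_ge0.
have ipsi : integrableT psi.
  exact: (continuous_support_integrable cK (smooth_continuous spsi) psi0).
pose B a := M a * \int[lambda]_y `|psi y|.
have HB a z : mi_deg a = m -> N z < r -> `|pairing q (mi_derive a psi) z| <= B a.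
  move=> am zr.
  have ze : `|z| <= e.
    by rewrite -(ler_pM2l c0); apply: (le_trans (cN z)); exact: ltW (lt_trans zr rce).
  rewrite (weakW (eq_leq am) spsi psi0 ze) normrM normrX normrN1 expr1n mul1r.
  rewrite /B -(Rintegral_normr_shift z cK spsi psi0).
  apply: (normr_Rintegral_boundedM (mW a) (WM a)).
  have := integrable_rV_affine z ltr01 (measurable_rV_continuous (smooth_continuous spsi)) ipsi.
  by congr (integrable _ _ (EFin \o _)); apply/funext => y; rewrite scale1r addrC.
have SB : \sum_(a <- mi_seq m) multinomial a * B a = S * \int[lambda]_y `|psi y|.
  by rewrite /S mulr_suml; apply: eq_bigr => a _; rewrite /B mulrA.
have M1 : 0 <= (r / c) ^+ m * \sum_(a <- mi_seq m) multinomial a * B a.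
  rewrite SB; apply: mulr_ge0; last exact: mulr_ge0.
  by rewrite exprn_ge0// divr_ge0// ltW.
have E := ball_expansion_le hN cK iq spsi psi0 r0 M1
  (fun z t => @line_derivative_norm_ball_le _ _ _ hN q psi c r m B c0 cN HB r0 z t).
have -> : weak_remainder r psi = (ball_pairing N r psi q - \sum_(i < m) r ^+ (n + i) / i`!%:R *
      \sum_(a <- mi_seq i) ball_moment N a * pairing q (mi_derive a psi) 0) -
      r ^+ (n + m) / m`!%:R * weak_coef psi m.
  rewrite /weak_remainder big_ord_recr /= opprD addrA; apply: (congr1 (fun x => x - _)).
  do 2!apply: congr1; apply: eq_bigr => i _; apply: congr1.
  apply: weak_coef_smooth; [exact: ltnW (ltn_ord i)|exact: spsi|exact: psi0].
apply: (le_trans (ler_normB _ _)); apply: (le_trans (lerD E (lexx _))).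
rewrite SB normrM ger0_norm; last by rewrite divr_ge0// exprn_ge0// ltW.
apply: (le_trans (lerD (lexx _) (ler_wpM2l _ (weak_coef_le m ipsi)))).
  by rewrite divr_ge0// exprn_ge0// ltW.
rewrite le_eqVlt; apply/orP; left; apply/eqP.
by rewrite -/(moment_bound m) expr_div_n exprD; ring.
Qed.

Variables (phi : 'rV[R]_n -> R) (sphi : smooth phi).
Hypothesis phi0 : forall x, ~ K x -> phi x = 0.
Variables (f : T -> R) (C : R) (mf : measurable_fun [set: T] f).
Hypothesis fC : forall x, `|f x| <= C.

Let iphi : integrableT (phi : T -> R).
Proof. exact: (continuous_support_integrable cK (smooth_continuous sphi) phi0). Qed.

Let g (x : T) : R := f x * phi x.

Let ig : integrableT g.
Proof. exact: integrable_boundedM mf fC iphi. Qed.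

Let ipsi (v : 'rV[R]_n -> R) : smooth v ->
  [/\ smooth (v * phi), (forall x, ~ K x -> (v * phi) x = 0) &
   integrableT ((v * phi) : T -> R)].
Proof.
move=> sv; have svp := smoothM sv sphi.
have vp0 x : ~ K x -> (v * phi) x = 0 by move=> /phi0; rewrite !fctE => ->; rewrite mulr0.
split; [exact: svp|exact: vp0|].
exact: (continuous_support_integrable cK (smooth_continuous svp) vp0).
Qed.

Let g_dense eps : 0 < eps -> exists2 v, smooth v &
  \int[lambda]_x `|g x - (v * phi) x| <= eps.
Proof.
move=> eps0; have [v sv vf] := smooth_dense_Rintegral (fun x => normr_ge0 (phi x))
  (integrable_Rnorm iphi) mf fC eps0.
exists v; first exact: sv.
apply: le_trans vf; rewrite le_eqVlt; apply/orP; left; apply/eqP.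
by apply: eq_Rintegral => x _; rewrite -normrM mulrBl.
Qed.

(** Extends a bound from smooth multiples [v * phi] to [g]: insert a [v * phi] that is [eps]-close
    to [g], control the exchange by L^1 continuity at fixed [r], and let [eps] tend to 0. *)
Let remainder_dist (Cm r : R) (psi : T -> R) : 0 < r -> 0 <= Cm ->
  integrableT psi ->
  (forall v, smooth v -> `|weak_remainder r (fun x => (v * phi) x - psi x)| <=
     Cm * \int[lambda]_x `|(v * phi) x - psi x|) ->
  `|weak_remainder r g - weak_remainder r psi| <= Cm * \int[lambda]_x `|g x - psi x|.
Proof.
move=> r0 Cm0 ip H; have [Cr Cr0 HCr] := weak_remainder_le r0.
apply: (@le_of_linear_bound _ _ _ (Cr + Cm)); first exact: addr_ge0.
move=> eps eps0; have [v sv gv] := g_dense eps0; have [_ _ iv] := ipsi sv.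
have -> : weak_remainder r g - weak_remainder r psi =
    weak_remainder r (fun x => g x - (v * phi) x) +
    weak_remainder r (fun x => (v * phi) x - psi x).
  by rewrite (weak_remainderB r ig iv) (weak_remainderB r iv ip); ring.
have igv := integrable_RB ig iv; have ivp := integrable_RB iv ip.
have igp := integrable_RB ig ip.
have h1 := le_trans (HCr _ igv) (ler_wpM2l Cr0 gv).
have h2 : \int[lambda]_x `|(v * phi) x - psi x| <= \int[lambda]_x `|g x - psi x| + eps.
  apply: le_trans (lerD (lexx _) gv).
  rewrite -RintegralD; [|exact: measurableT|exact: integrable_Rnorm igp|exact: integrable_Rnorm igv].
  apply: le_Rintegral; [exact: measurableT|exact: integrable_Rnorm ivp|
    exact: integrable_RD (integrable_Rnorm igp) (integrable_Rnorm igv)|].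
  move=> x _; rewrite [leRHS]addrC (distrC (g x) ((v * phi) x)); exact: ler_distD.
have h3 := le_trans (H v sv) (ler_wpM2l Cm0 h2).
apply: (le_trans (ler_normD _ _)); apply: (le_trans (lerD h1 h3)).
rewrite le_eqVlt; apply/orP; left; apply/eqP; ring.
Qed.

(** The order of the choices is essential. [C2] is uniform over smooth functions supported in [K],
    so [v] can be chosen with [C2] times the L^1 error at most [eps / 2]; only then is [C1] known,
    as it depends on [v], and small [r] makes [C1 * r] at most [eps / 2]. The added 1 in the
    denominators covers vanishing constants. *)
Lemma weak_remainder_little_o eps : 0 < eps -> exists2 rho : R, 0 < rho &
  forall r, 0 < r -> r < rho ->
  `|weak_remainder r (fun x => f x * phi x)| <= eps * r ^+ (n + m).
Proof.
move=> eps0; have [C2 C20 [rho rho0 HC2]] := weak_remainder_smooth_le.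
have C21 : 0 < 2 * (C2 + 1) by rewrite mulr_gt0// ltr_wpDl.
have [v sv gv] := g_dense (divr_gt0 eps0 C21).
have [svp vp0 iv] := ipsi sv.
have [C1 C10 HC1] := weak_remainder_smooth_bigO svp vp0.
have C11 : 0 < 2 * (C1 + 1) by rewrite mulr_gt0// ltr_wpDl.
exists (Num.min rho (eps / (2 * (C1 + 1)))).
  by rewrite lt_min rho0 divr_gt0.
move=> r r0; rewrite lt_min => /andP[rrho r1].
have rn0 : 0 < r ^+ (n + m) by apply: exprn_gt0.
have D : `|weak_remainder r g - weak_remainder r (v * phi)| <=
    (C2 * r ^+ (n + m)) * \int[lambda]_x `|g x - (v * phi) x|.
  apply: remainder_dist; [exact: r0|apply: mulr_ge0; [exact: C20|exact: ltW]|exact: iv|].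
  move=> v' sv'; have [sp' p0' _] := ipsi sv'.
  have sd := smoothB sp' svp.
  apply: (HC2 r (v' * phi - v * phi) r0 rrho sd) => x Kx.
  have := vp0 x Kx; have := p0' x Kx; rewrite !fctE => -> ->; exact: subr0.
have key (a b : R) (x y : R) : 0 <= x -> a <= x * (eps / (2 * (x + 1))) ->
    0 <= y -> b <= y * (eps / (2 * (y + 1))) -> b + a <= eps.
  move=> x0 ha y0 hb.
  have hx (z : R) : 0 <= z -> z * (eps / (2 * (z + 1))) <= eps / 2.
    move=> z0; rewrite mulrA ler_pdivrMr; last by rewrite mulr_gt0// ltr_wpDl.
    by rewrite [leRHS](_ : _ = z * eps + eps); [rewrite lerDl ltW|field].
  by have := hx x x0; have := hx y y0; lra.
have := HC1 r r0; move: D gv r1 rn0; rewrite exprSr.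
set E := weak_remainder r g; set E' := weak_remainder r (v * phi).
set I := Rintegral _ _ _; set p := r ^+ (n + m).
move=> D gv r1 p0 hE'.
have -> : E = E' + (E - E') by ring.
apply: (le_trans (ler_normD _ _)); apply: (le_trans (lerD hE' D)).
rewrite [leLHS](_ : _ = (C1 * r + C2 * I) * p); last by ring.
rewrite ler_pM2r//; apply: (key _ _ C2 C1 C20 _ C10).
  exact: ler_wpM2l.
by apply: ler_wpM2l => //; exact: ltW.
Qed.

(** The two expansions represent the same number for small [r]. Their difference divided by [r ^+ n]
    is a polynomial of degree at most [m] in [r] that is o(r^m), so all its coefficients vanish, in
    particular the last one. *)
Lemma ball_pairing_coef_eq (p : T -> R) (r0 : R) : integrableT p -> 0 < r0 ->
  (forall r, 0 < r -> r < r0 ->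
    ball_pairing N r phi p = ball_pairing N r (fun x => f x * phi x) q) ->
  \sum_(a <- mi_seq m) ball_moment N a * pairing p (mi_derive a phi) 0 =
  weak_coef (fun x => f x * phi x) m.
Proof.
move=> ip r00 Hr.
pose P i : R := \sum_(a <- mi_seq i) ball_moment N a * pairing p (mi_derive a phi) 0.
pose c i : R := (P i - weak_coef (fun x => f x * phi x) i) / i`!%:R.
suff /(_ m (leqnn m)) : forall i, (i <= m)%N -> c i = 0.
  move=> /eqP; rewrite /c mulf_eq0 invr_eq0 pnatr_eq0 -leqn0 leqNgt fact_gt0 orbF subr_eq0.
  by move/eqP.
apply: poly_little_o => eps eps0.
have [D D0 HD] := ball_expansion_bigO hN cK ip sphi phi0 m.+1.
have [rho rho0 Hrho] := weak_remainder_little_o (divr_gt0 eps0 (ltr0n _ 2)).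
have D1 : 0 < 2 * (D + 1) by rewrite mulr_gt0// ltr_wpDl.
exists (Num.min r0 (Num.min rho (eps / (2 * (D + 1))))).
  by rewrite !lt_min r00 rho0 divr_gt0.
move=> r r_gt0; rewrite !lt_min => /and3P[rr0 rrho rD].
have rn0 : 0 < r ^+ n by apply: exprn_gt0.
have := HD r r_gt0; have := Hrho r r_gt0 rrho.
rewrite /weak_remainder -(Hr r r_gt0 rr0).
set J := ball_pairing _ _ _ _; set A := \sum_(i < _) _; set B := \sum_(i < _) _.
have -> : \sum_(i < m.+1) c i * r ^+ i = (B - A) / r ^+ n.
  rewrite /A /B -sumrB mulr_suml; apply: eq_bigr => i _.
  rewrite -/(P i) /c exprD; field.
  by rewrite pnatr_eq0 -lt0n fact_gt0 gt_eqF.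
rewrite addnS exprSr (exprD _ n m) => h1 h2.
rewrite normrM normfV (gtr0_norm rn0) ler_pdivrMr//.
have -> : B - A = (J - A) - (J - B) by ring.
apply: (le_trans (ler_normB _ _)); apply: (le_trans (lerD h1 h2)).
have pm0 : 0 < r ^+ n * r ^+ m by apply: mulr_gt0 => //; exact: exprn_gt0.
rewrite [leRHS](_ : _ = eps * (r ^+ n * r ^+ m)); last by ring.
rewrite [leLHS](_ : _ = (eps / 2 + D * r) * (r ^+ n * r ^+ m)); last by ring.
rewrite ler_pM2r//.
have h3 : D * r <= D * (eps / (2 * (D + 1))) by apply: ler_wpM2l => //; exact: ltW.
have h4 : D * (eps / (2 * (D + 1))) <= eps / 2.
  rewrite mulrA ler_pdivrMr//.
  by rewrite [leRHS](_ : _ = D * eps + eps); [rewrite lerDl ltW|field].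
have h5 := le_trans h3 h4.
by apply: (le_trans (lerD (lexx _) h5)); rewrite -splitr.
Qed.

End weak_expansion.

(** * Strongly harmonic functions *)

Section ae_monotonicity.
Context d (T : measurableType d) {R : realType} (mu : {measure set T -> \bar R}).

Lemma le_Rintegral_subset_ae (A B : set T) (w : T -> R) : measurable A -> measurable B ->
  A `<=` B -> mu.-integrable B (EFin \o w) -> {ae mu, forall x, B x -> 0 < w x} ->
  \int[mu]_(x in A) w x <= \int[mu]_(x in B) w x.
Proof.
move=> mA mB AB iB w0; have iA := integrableS mB mA AB iB.
have H D : measurable D -> D `<=` B -> mu.-integrable D (EFin \o w) ->
    (\int[mu]_(x in D) (w x)%:E = \int[mu]_(x in D) `|(w x)%:E|)%E.
  move=> mD DB iD; have mw := measurable_int mu iD.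
  apply: ae_eq_integral => //; first exact: measurableT_comp.
  by apply: filterS w0 => x h /DB /h w0; rewrite /= gtr0_norm.
apply: fine_le; [exact: integrable_fin_num|exact: integrable_fin_num|].
rewrite (H _ mA AB iA) (H _ mB _ iB)//; apply: ge0_subset_integral => //.
by apply: measurableT_comp => //; exact: (measurable_int mu iB).
Qed.

Lemma normr_Rintegral_subset (A B : set T) (f : T -> R) : measurable A -> measurable B ->
  A `<=` B -> mu.-integrable B (EFin \o f) ->
  `|\int[mu]_(x in A) f x| <= \int[mu]_(x in B) `|f x|.
Proof.
move=> mA mB AB iB; have iA := integrableS mB mA AB iB.
apply: (le_trans (le_normr_Rintegral mA iA)).
have nA : mu.-integrable A (EFin \o (fun x => `|f x|)) by have /= := integrable_abse iA.
have nB : mu.-integrable B (EFin \o (fun x => `|f x|)) by have /= := integrable_abse iB.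
apply: fine_le; [exact: integrable_fin_num|exact: integrable_fin_num|].
by apply: ge0_subset_integral => //; exact: (measurable_int mu nB).
Qed.

Lemma ae_on_subset (A B : set T) (P : T -> Prop) : A `<=` B ->
  {ae mu, forall x, B x -> P x} -> {ae mu, forall x, A x -> P x}.
Proof. by move=> AB; apply: filterS => x h /AB. Qed.

End ae_monotonicity.

(** * Local boundedness and the integrated mean value property *)

Section harmonic.
Context {R : realType} {n : nat}.
Local Notation lambda := (lebesgue_rV R n).
Local Notation T := (lebesgue_rV_type R n).

Lemma open_lebesgue_gt0 (U : set 'rV[R]_n) (x : 'rV[R]_n) : open U -> U x -> (0 < lambda U)%E.
Proof.
move=> oU Ux.
have /nbhs_ballP[e /= e0 eU] : nbhs x U by exact: open_nbhs_nbhs.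
pose B := [set y : 'rV[R]_n | `|y| < e].
have oB : open B by exact: (open_comp (fun x _ => @norm_continuous _ _ x) (@open_lt _ e)).
pose f (y : borel_rV R n) : \bar R := (\1_(U : set (borel_rV R n)) y : R)%:E.
have mf : measurable_fun setT f.
  apply/measurable_EFinP; apply: measurable_indic; exact: open_measurable_rV.
have := @ge0_lebesgue_rV_affine R n x 1 ltr01 f mf (fun y => ltac:(by rewrite lee_fin indicE)).
have mU : measurable (U : set T) by exact: measurable_borel_lebesgue (open_measurable_rV oU).
have -> : lambda U = (\int[lambda]_y f y)%E by rewrite [RHS]integral_indic ?setIT.
rewrite expr1n mul1e /f => <-; apply: (lt_le_trans (@ball_lebesgue_gt0 R n e e0)).
have mB : measurable (B : set T) by exact: measurable_borel_lebesgue (open_measurable_rV oB).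
have -> : lambda [set y : 'rV[R]_n | `|y| < e] = (\int[lambda]_y (\1_(B : set T) y : R)%:E)%E.
  by rewrite integral_indic ?setIT.
refine (@ge0_le_integral _ T R lambda setT measurableT _ _ _ _ _ _).
- by move=> y _; rewrite lee_fin indicE ler0n.
- by apply/measurable_EFinP; apply: measurable_indic; exact: mB.
- apply: measurable_fun_borel_lebesgue.
  exact: (measurableT_comp mf (@measurable_rV_affine R n x 1)).
move=> y _; rewrite lee_fin !indicE ler_nat.
case: (boolP (y \in _)) => // /set_mem yB.
rewrite mem_set//; apply: eU; rewrite -ball_normE /= scale1r opprD addNKr normrN.
exact: yB.
Qed.

Variables (N : 'rV[R]_n -> R) (hN : is_norm N).

Local Notation dN := (fun x y : 'rV[R]_n => N (x - y)).

Lemma open_dball x r : open (dball dN x r).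
Proof.
have cN : continuous (fun y : 'rV[R]_n => N (x - y)).
  move=> y; apply: (@continuous_comp _ _ _ (fun y : 'rV[R]_n => x - y) N); last exact: is_norm_continuous.
  by apply: (@continuousB _ _ _ (cst x) id); [exact: cst_continuous|].
have /continuousP cN' := cN.
by apply: (cN' [set y | y < r]); exact: open_lt.
Qed.

Lemma measurable_dball x r :
  measurable (dball dN x r : set (lebesgue_rV_type R n)).
Proof. exact: measurable_borel_lebesgue (open_measurable_rV (@open_dball x r)). Qed.

Lemma lebesgue_dball_gt0 x r : 0 < r -> (0 < lambda (dball dN x r))%E.
Proof.
move=> r0; apply: (open_lebesgue_gt0 (@open_dball x r) (x := x)).
by rewrite /dball /= subrr is_norm0.
Qed.

Variables (Omega : set 'rV[R]_n) (w u : 'rV[R]_n -> R).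
Hypothesis w_L1 : L1_loc Omega w.
Hypothesis w_gt0 : {ae lambda, forall x, Omega x -> 0 < w x}.
Hypothesis u_harmonic : strongly_harmonic Omega dN w u.
Variables (K L : set 'rV[R]_n) (c e : R).
Hypothesis cK : compact K.
Hypothesis cL : compact L.
Hypothesis LO : L `<=` Omega.
Hypothesis c0 : 0 < c.
Hypothesis e0 : 0 < e.
Hypothesis cN : forall x, c * `|x| <= N x.
Hypothesis KL : forall x y, K x -> `|y - x| <= e -> L y.

Let dball_sub x r : K x -> r <= c * e -> dball dN x r `<=` L.
Proof.
move=> Kx rce y xy; apply: (KL Kx); rewrite -(ler_pM2l c0) distrC.
by apply: (le_trans (cN _)); exact: (le_trans (ltW xy) rce).
Qed.

Let dball_compact x r : K x -> r <= c * e -> relatively_compact_in (dball dN x r) Omega.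
Proof.
move=> Kx rce.
have sub : closure (dball dN x r) `<=` L.
  rewrite closureE => y; apply; split; last exact: dball_sub.
  exact: (compact_closed (@norm_hausdorff _ _) cL).
split; last exact: subset_trans sub LO.
exact: (subclosed_compact (@closed_closure _ _) cL sub).
Qed.

Let mL : measurable (L : set T).
Proof. exact: measurable_borel_lebesgue (compact_measurable_rV cL). Qed.

Let iwL : lambda.-integrable L (EFin \o w). Proof. exact: w_L1. Qed.

Let iuwL : lambda.-integrable L (EFin \o (fun y => u y * w y)).
Proof. by have [_ h _] := u_harmonic; exact: h. Qed.

Let w_gt0L : {ae lambda, forall x, L x -> 0 < w x}.
Proof. exact: (@ae_on_subset _ T R lambda L Omega (fun x => 0 < w x) LO w_gt0). Qed.

Local Notation mass x r := (\int[lambda]_(y in dball dN x r) w y).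

Let mass_gt0 x r : 0 < r -> dball dN x r `<=` L -> 0 < mass x r.
Proof.
move=> r0 sub; apply: Rintegral_gt0.
- exact: measurable_dball.
- exact: lebesgue_dball_gt0.
- exact: (integrableS mL (@measurable_dball x r) sub iwL).
- exact: (@ae_on_subset _ T R lambda _ L (fun x => 0 < w x) sub w_gt0L).
Qed.

(** Clearing the denominator requires a ball of positive mass, which follows from [w > 0] almost
    everywhere. *)
Let mean_value x r : K x -> 0 < r -> r <= c * e ->
  u x * mass x r = \int[lambda]_(y in dball dN x r) (u y * w y).
Proof.
move=> Kx r0 rce; have [_ _ H] := u_harmonic.
rewrite {1}(H x r r0 (dball_compact Kx rce)) mulrC mulrA divff ?mul1r//.
by rewrite gt_eqF//; apply: mass_gt0 => //; exact: dball_sub.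
Qed.

(** The mean value property bounds [|u x|] times the mass of a ball by the integral of [|u w|] over
    [L]. It remains to bound these masses from below, locally uniformly in the centre and then on
    [K] by compactness. *)
Lemma harmonic_bounded : exists2 M : R, 0 <= M & forall x, K x -> `|u x| <= M.
Proof.
pose r := c * e; have r0 : 0 < r by exact: mulr_gt0.
pose I := \int[lambda]_(y in L) `|u y * w y|.
have HI x : K x -> `|u x| * mass x r <= I.
  move=> Kx; have sub := dball_sub Kx (lexx r).
  have m0 := mass_gt0 r0 sub.
  rewrite -{1}(gtr0_norm m0) -normrM (mean_value Kx r0 (lexx _)).
  exact: (normr_Rintegral_subset (@measurable_dball x r) mL sub iuwL).
have I0 : 0 <= I by apply: Rintegral_ge0 => y _; exact: normr_ge0.
(* A ball of radius [r] centred near [x] contains the ball of radius [r / 2]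
   around [x], which bounds its mass from below. *)
have H x : K x -> \forall x' \near x & M \near (+oo)%R, K x' -> `|u x'| <= M.
  move=> Kx; have r20 : 0 < r / 2 by rewrite divr_gt0.
  have r2r : r / 2 <= r by rewrite ler_pdivrMr// ler_peMr ?ler1n// ltW.
  pose D := mass x (r / 2).
  have D0 : 0 < D.
    by apply: mass_gt0 => //; exact: dball_sub.
  exists (dball dN x (r / 2), [set M | I / D < M]).
    split; last exact: nbhs_pinfty_gt (num_real _).
    apply: open_nbhs_nbhs; split; first exact: open_dball.
    by rewrite /dball /= subrr is_norm0.
  move=> [y M] /= [xy DM] Ky.
  apply: le_trans (ltW DM); rewrite ler_pdivlMr//; apply: le_trans (HI y Ky).
  apply: ler_wpM2l; first exact: normr_ge0.
  have sub := dball_sub Ky (lexx r).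
  apply: (le_Rintegral_subset_ae (@measurable_dball x _) (@measurable_dball y _)).
  - move=> z xz; rewrite /dball /=.
    have -> : y - z = (y - x) + (x - z) by rewrite addrA subrK.
    apply: (le_lt_trans (is_norm_triangle hN _ _)); rewrite (is_normB hN y x).
    by rewrite [ltRHS]splitr; exact: ltrD.
  - exact: (integrableS mL (@measurable_dball y r) sub iwL).
  - exact: (@ae_on_subset _ T R lambda _ L (fun x => 0 < w x) sub w_gt0L).
have [M [_ HM]] := (compact_near_coveringP K).1 cK R _ (fun M x => K x -> `|u x| <= M) _ H.
exists (`|M| + 1); first by apply: addr_ge0.
move=> x Kx; apply: (HM _ _ x Kx Kx).
by apply: (le_lt_trans (ler_norm M)); rewrite ltrDl.
Qed.

(** Where [phi] does not vanish the ball lies in [L], so the cutoffs do not change the inner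
    integrals and the mean value property applies pointwise. *)
Lemma harmonic_ball_pairing (phi : 'rV[R]_n -> R) (r : R) :
  (forall x, ~ K x -> phi x = 0) -> 0 < r -> r <= c * e ->
  ball_pairing N r phi ((fun y => u y * w y) \_ L) =
  ball_pairing N r (fun x => (u \_ K) x * phi x) (w \_ L).
Proof.
move=> phi0 r0 rce; rewrite /ball_pairing; apply: eq_Rintegral => x _.
have [Kx|nKx] := pselect (K x); last by rewrite (phi0 x nKx) mulr0 !mul0r.
have H (f : 'rV[R]_n -> R) : \int[lambda]_y (norm_ball N r (x - (y : 'rV[R]_n)) * (f \_ L) y) =
    \int[lambda]_(y in dball dN x r) f y.
  rewrite [RHS]Rintegral_mkcond; apply: eq_Rintegral => y _.
  rewrite !patchE /norm_ball; have [xy|xr] := pselect (dball dN x r y); last first.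
    rewrite (memNset xr).
    have -> : N (x - y) < r = false by apply/negP; exact: xr.
    by rewrite mul0r.
  have Ly := dball_sub Kx rce xy.
  have -> : N (x - y) < r = true by exact: xy.
  by rewrite (mem_set Ly) (mem_set xy) mul1r.
rewrite !H patchE mem_set// -mean_value//; ring.
Qed.

End harmonic.

(** * Restriction of weak derivatives to compact sets *)

Section restriction.
Context {R : realType} {n : nat}.
Local Notation lambda := (lebesgue_rV R n).
Local Notation T := (lebesgue_rV_type R n).

Lemma ae_eq_Rintegral_mul d (X : measurableType d) (mu : {measure set X -> \bar R})
    (f g h : X -> R) : measurable_fun setT f -> measurable_fun setT g ->
  measurable_fun setT h -> {ae mu, forall x, f x = g x} ->
  \int[mu]_x (f x * h x) = \int[mu]_x (g x * h x).
Proof.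
move=> mf mg mh fg; apply: ae_eq_RintegralT; [exact: measurable_funM|exact: measurable_funM|].
by apply: filterS fg => x /= ->.
Qed.

Lemma Rintegral_mul_support d (X : measurableType d) (mu : {measure set X -> \bar R})
    (A L : set X) (f p : X -> R) : L `<=` A -> (forall x, ~ L x -> p x = 0) ->
  \int[mu]_(x in A) (f x * p x) = \int[mu]_x ((f \_ L) x * p x).
Proof.
move=> LA p0; rewrite Rintegral_mkcond; apply: eq_Rintegral => x _; rewrite !patchE.
have [Lx|nLx] := pselect (L x).
  by rewrite (mem_set Lx) (mem_set (LA x Lx)).
by rewrite (p0 x nLx) mulr0; case: ifP => _; rewrite ?mulr0.
Qed.

Lemma integrable_patchT d (X : measurableType d) (mu : {measure set X -> \bar R})
    (L : set X) (f : X -> R) : measurable L -> mu.-integrable L (EFin \o f) ->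
  mu.-integrable setT (EFin \o (f \_ L)).
Proof. by move=> mL /(integrable_mkcond _ mL).1; rewrite restrict_EFin. Qed.

(** Smooth functions are dense in L^1 with weight [|h|], so orthogonality to [h] passes to bounded
    measurable functions. It allows one weak derivative to be exchanged for another against the
    non-smooth factor [u * phi]. *)
Lemma smooth_orthogonal (h f : T -> R) (C : R) :
  lambda.-integrable [set: T] (EFin \o h) -> measurable_fun [set: T] f ->
  (forall x, `|f x| <= C) ->
  (forall v : 'rV[R]_n -> R, smooth v ->
     lambda.-integrable [set: T] (EFin \o (fun x => v x * h x)) /\
     \int[lambda]_x (v x * h x) = 0) ->
  \int[lambda]_x (f x * h x) = 0.
Proof.
move=> ih mf fC H; apply/eqP; rewrite -normr_le0; apply/ler_addgt0Pr => eps eps0.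
have [v sv vf] := smooth_dense_Rintegral (fun x => normr_ge0 (h x)) (integrable_Rnorm ih)
  mf fC eps0.
have [iv v0] := H v sv; have ifh := integrable_boundedM mf fC ih.
rewrite add0r; apply: le_trans vf.
rewrite -[\int[lambda]_x (f x * h x)]subr0 -[X in _ - X]v0.
rewrite -RintegralB; [|exact: measurableT|exact: ifh|exact: iv].
apply: (le_trans (le_normr_Rintegral measurableT (integrable_RB ifh iv))).
rewrite le_eqVlt; apply/orP; left; apply/eqP.
by apply: eq_Rintegral => x _; rewrite -mulrBl normrM.
Qed.

Section weak_derivatives.
Variables (Omega : set 'rV[R]_n) (w : 'rV[R]_n -> R) (L : set 'rV[R]_n).
Hypothesis cL : compact L.
Hypothesis LO : L `<=` Omega.

Lemma compact_measurable_lebesgue : measurable (L : set T).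
Proof. exact: measurable_borel_lebesgue (compact_measurable_rV cL). Qed.

Lemma weak_derivative_restrict (a : multi_index n) (g psi : 'rV[R]_n -> R) :
  weak_derivative Omega a w g -> smooth psi -> (forall x, ~ L x -> psi x = 0) ->
  \int[lambda]_x ((w \_ L) x * mi_derive a psi x) =
  (-1) ^+ mi_deg a * \int[lambda]_x ((g \_ L) x * psi x).
Proof.
move=> [_ _ H] spsi psi0.
have := H psi (smooth_test_function spsi cL LO psi0).
rewrite (@Rintegral_mul_support _ T lambda Omega L w (mi_derive a psi) LO
  (mi_derive_support cL a psi0)).
by rewrite (@Rintegral_mul_support _ T lambda Omega L g psi LO psi0).
Qed.

(** Function and bound form one pair, so that both can be selected for all multi-indices by a single
    use of choice. *)
Lemma weak_derivative_bounded (a : multi_index n) (k : nat) :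
  sobolev_infty_loc Omega k w -> (mi_deg a <= k)%N ->
  exists WM : (T -> R) * R, [/\ measurable_fun [set: T] WM.1, (forall x, `|WM.1 x| <= WM.2) &
    forall psi, smooth psi -> (forall x, ~ L x -> psi x = 0) ->
    \int[lambda]_x ((w \_ L) x * mi_derive a psi x) =
    (-1) ^+ mi_deg a * \int[lambda]_x (WM.1 x * psi x)].
Proof.
move=> ws ak; have [g wg Lg] := ws a ak.
have [g' [M [mg mg' M0 gM gg']]] := Lfun_infty_bounded (Lg L cL LO).
exists (g', M); split; [exact: mg'|exact: gM|move=> psi spsi psi0 /=].
rewrite (weak_derivative_restrict wg spsi psi0); apply: congr1.
exact: (ae_eq_Rintegral_mul mg mg' (measurable_smooth spsi) gg').
Qed.

End weak_derivatives.
End restriction.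

(** * From the mean value property to the system of equations *)

Section harmonic_weak_solution.
Context {R : realType} {n : nat}.
Local Notation lambda := (lebesgue_rV R n).
Local Notation T := (lebesgue_rV_type R n).
Variables (N : 'rV[R]_n -> R) (hN : is_norm N).
Local Notation dN := (fun x y : 'rV[R]_n => N (x - y)).
Variables (Omega : set 'rV[R]_n) (w u : 'rV[R]_n -> R).
Hypothesis Omega_open : open Omega.
Hypothesis w_L1 : L1_loc Omega w.
Hypothesis w_gt0 : {ae lambda, forall x, Omega x -> 0 < w x}.
Hypothesis u_harmonic : strongly_harmonic Omega dN w u.

Lemma pde_coef_ball_moment (a : multi_index n) : pde_coef dN a = ball_moment N a.
Proof.
rewrite /pde_coef /ball_moment; apply: congr1.
rewrite Rintegral_mkcond; apply: eq_Rintegral => x _.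
rewrite patchE /norm_ball; have [xB|xB] := pselect (dball dN 0 1 x).
  have -> : N x < 1 = true by rewrite -(is_normN hN) -sub0r; exact: xB.
  by rewrite (mem_set xB) mul1r.
have -> : N x < 1 = false by apply/negP; rewrite -(is_normN hN) -sub0r; exact: xB.
by rewrite (memNset xB) mul0r.
Qed.

Lemma harmonic_compact_bounded (K : set 'rV[R]_n) : compact K -> K `<=` Omega ->
  measurable_fun [set: T] (u \_ K : T -> R) /\ exists C : R, forall x, `|(u \_ K) x| <= C.
Proof.
move=> cK KO; split.
  have [mu _ _] := u_harmonic.
  apply/(measurable_restrictT _ (compact_measurable_lebesgue cK)).1.
  apply: measurable_funS mu => //.
  exact: measurable_borel_lebesgue (open_measurable_rV Omega_open).
have [c c0 cN] := is_norm_lb hN.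
have [e e0 [L [cL LO KL]]] := compact_thicken cK Omega_open KO.
have [M M0 uM] := harmonic_bounded hN w_L1 w_gt0 u_harmonic cK cL LO c0 e0 cN KL.
exists M => x; rewrite patchE; case: ifPn => [/set_mem/uM //|_].
by rewrite normr0.
Qed.

Lemma harmonic_L1_loc (f : 'rV[R]_n -> R) : L1_loc Omega f ->
  L1_loc Omega (fun x => u x * f x).
Proof.
move=> Lf K cK KO; have mK := compact_measurable_lebesgue cK.
have [mu [C uC]] := harmonic_compact_bounded cK KO.
apply: (@integrable_mkcond _ T R lambda K _ mK).2; rewrite restrict_EFin.
have := integrable_boundedM mu uC (integrable_patchT mK (Lf K cK KO)).
congr (integrable _ _ (EFin \o _)); apply/funext => x; rewrite !patchE.
by case: ifP => // _; rewrite mul0r.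
Qed.

Variables (m k : nat).
Hypothesis mk : (m <= k)%N.
Hypothesis w_sobolev : sobolev_infty_loc Omega k w.

(** [ball_pairing_coef_eq] is applied with [q] equal to [w] on [L], [p] to [u w] on [L] and [f] to
    [u] on [K]. It yields the identity for bounded representatives, which are then exchanged for
    [Dw]. *)
Lemma harmonic_moment_identity (phi : 'rV[R]_n -> R) (Dw : multi_index n -> 'rV[R]_n -> R) :
  test_function Omega phi ->
  (forall a, mi_deg a = m -> weak_derivative Omega a w (Dw a)) ->
  \sum_(a <- mi_seq m) ball_moment N a *
    \int[lambda]_(x in Omega) (u x * w x * mi_derive a phi x) =
  (-1) ^+ m * \sum_(a <- mi_seq m) ball_moment N a *
    \int[lambda]_(x in Omega) (phi x * (u x * Dw a x)).
Proof.
move=> [sphi [cK KO]] HDw; set K := closure _ in cK KO.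
have phi0 x : ~ K x -> phi x = 0.
  move=> Kx; apply: contrapT => /eqP px; apply: Kx; exact: subset_closure.
have [c c0 cN] := is_norm_lb hN.
have [e e0 [L [cL LO KL]]] := compact_thicken cK Omega_open KO.
have KsubL x : K x -> L x by move=> Kx; apply: (KL x x Kx); rewrite subrr normr0 ltW.
have phiL0 x : ~ L x -> phi x = 0 by move=> Lx; apply: phi0 => /KsubL.
have mL := compact_measurable_lebesgue cL.
have [mu [C uC]] := harmonic_compact_bounded cK KO.
have iq := integrable_patchT mL (w_L1 cL LO).
have ip := integrable_patchT mL (harmonic_L1_loc w_L1 cL LO).
pose good a (WM : (T -> R) * R) := [/\ measurable_fun [set: T] WM.1,
  (forall x, `|WM.1 x| <= WM.2) & forall psi, (mi_deg a <= m)%N -> smooth psi ->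
    (forall x, ~ L x -> psi x = 0) ->
    \int[lambda]_x ((w \_ L) x * mi_derive a psi x) =
    (-1) ^+ mi_deg a * \int[lambda]_x (WM.1 x * psi x)].
have /choice[WM HWM] : forall a, exists WM, good a WM.
  move=> a; have [am|am] := leqP (mi_deg a) m.
    have [WM [h1 h2 h3]] := weak_derivative_bounded cL LO w_sobolev (leq_trans am mk).
    by exists WM; split => // psi _; exact: h3.
  (* Above degree [m] the third clause is vacuous; zero is a default value making the choice
     total. *)
  exists (cst 0, 0); split; first exact: measurable_cst.
    by move=> x; rewrite /= normr0.
  by move=> psi; rewrite leqNgt am.
have mW a := let: And3 h _ _ := HWM a in h.
have WMle a := let: And3 _ h _ := HWM a in h.
have weak a := let: And3 _ _ h := HWM a in h.
have weakz a psi (z : 'rV[R]_n) : (mi_deg a <= m)%N -> smooth psi ->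
    (forall x, ~ K x -> psi x = 0) -> `|z| <= e ->
    pairing (w \_ L) (mi_derive a psi) z =
    (-1) ^+ mi_deg a * \int[lambda]_y ((WM a).1 y * psi ((y : 'rV[R]_n) + z)).
  move=> am spsi psi0 ze.
  (* The shifted function is supported in [L], since [K] moved by at most [e] remains there. *)
  rewrite -(weak a (psi \o shift z) am (@smooth_shift _ _ psi z spsi)); last first.
    move=> x Lx; apply: psi0 => Kxz; apply: Lx; apply: (KL _ _ Kxz).
    by rewrite opprD addNKr normrN.
  rewrite mi_derive_shift /pairing; apply: eq_Rintegral => y _.
  by rewrite mulrC.
have Hr r : 0 < r -> r < c * e ->
    ball_pairing N r phi ((fun y => u y * w y) \_ L) =
    ball_pairing N r (fun x => (u \_ K) x * phi x) (w \_ L).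
  move=> r0 rce.
  exact: (harmonic_ball_pairing hN w_L1 w_gt0 u_harmonic cL LO c0 cN KL phi0 r0 (ltW rce)).
have key := ball_pairing_coef_eq hN cK iq e0 mW WMle weakz sphi phi0 mu uC ip
  (mulr_gt0 c0 e0) Hr.
transitivity (\sum_(a <- mi_seq m) ball_moment N a *
    pairing ((fun y => u y * w y) \_ L) (mi_derive a phi) 0).
  apply: eq_bigr => a _; apply: congr1.
  rewrite (@Rintegral_mul_support R _ T lambda Omega L (fun y => u y * w y) (mi_derive a phi) LO
    (mi_derive_support cL a phiL0)).
  by apply: eq_Rintegral => x _; rewrite addr0 mulrC.
rewrite key /weak_coef mulr_sumr big_seq [RHS]big_seq; apply: eq_bigr => a.
rewrite mem_mi_seq => /eqP am; rewrite mulrCA; do 2!apply: congr1.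
have wD := HDw a am.
have iD : lambda.-integrable [set: T] (EFin \o (Dw a \_ L : T -> R)).
  by have [_ h _] := wD; exact: (integrable_patchT mL (h L cL LO)).
have mD : measurable_fun [set: T] (Dw a \_ L : T -> R).
  exact/measurable_EFinP/(measurable_int lambda iD).
have [B B0 phiB] := continuous_support_bounded cK (smooth_continuous sphi) phi0.
have mphi := measurable_smooth sphi.
(* The gap between the bounded representative and the given weak derivative, localised by [phi]. It
   integrates to 0 against smooth [v], as [v * phi] is again a test function. *)
pose h (x : T) : R := ((WM a).1 x - (Dw a \_ L) x) * phi x.
have iWpsi psi : smooth psi -> (forall x, ~ K x -> psi x = 0) ->
    lambda.-integrable [set: T] (EFin \o (fun x => (WM a).1 x * psi x)) /\
    lambda.-integrable [set: T] (EFin \o (fun x => (Dw a \_ L) x * psi x)).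
  move=> spsi psi0; split.
    apply: (integrable_boundedM (mW a) (WMle a)).
    exact: (continuous_support_integrable cK (smooth_continuous spsi) psi0).
  have [C' _ psiC] := continuous_support_bounded cK (smooth_continuous spsi) psi0.
  have := integrable_boundedM (measurable_smooth spsi) psiC iD.
  by congr (integrable _ _ (EFin \o _)); apply/funext => x; rewrite mulrC.
have [iWphi iDphi] := iWpsi phi sphi phi0.
have ih : lambda.-integrable [set: T] (EFin \o h).
  have := integrable_RB iWphi iDphi.
  by congr (integrable _ _ (EFin \o _)); apply/funext => x; rewrite /h mulrBl.
have H : \int[lambda]_x ((u \_ K) x * h x) = 0.
  apply: (smooth_orthogonal ih mu uC) => v sv.
  have svp := smoothM sv sphi.
  have vp0 x : ~ K x -> (v * phi) x = 0 by move=> /phi0; rewrite !fctE => ->; rewrite mulr0.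
  have vpL0 x : ~ L x -> (v * phi) x = 0 by move=> Lx; apply: vp0 => /KsubL.
  have [iW iDv] := iWpsi (v * phi) svp vp0.
  have E : (fun x => v x * h x) =
      (fun x => (WM a).1 x * (v * phi) x - (Dw a \_ L) x * (v * phi) x) :> (T -> R).
    by apply/funext => x; rewrite /h !fctE; ring.
  rewrite E; split; first exact: (integrable_RB iW iDv).
  rewrite RintegralB; [|exact: measurableT|exact: iW|exact: iDv].
  apply/eqP; rewrite subr_eq0; apply/eqP.
  apply: (@mulfI _ ((-1) ^+ mi_deg a : R)); first by rewrite signr_eq0.
  rewrite -(weak a _ (eq_leq am) svp vpL0).
  exact: (weak_derivative_restrict cL LO wD svp vpL0).
transitivity (\int[lambda]_x ((Dw a \_ L) x * ((u \_ K) x * phi x))).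
  apply/eqP; rewrite -subr_eq0 -RintegralB; [|exact: measurableT| |].
  - rewrite -H; apply/eqP; apply: eq_Rintegral => x _; rewrite /h; ring.
  - apply: (integrable_boundedM (mW a) (WMle a)).
    apply: (integrable_boundedM mu uC).
    exact: (continuous_support_integrable cK (smooth_continuous sphi) phi0).
  - have := integrable_boundedM mu uC iDphi.
    by congr (integrable _ _ (EFin \o _)); apply/funext => x; rewrite mulrCA.
rewrite -(@Rintegral_mul_support R _ T lambda Omega L (Dw a)
  (fun x => (u \_ K) x * phi x) LO); last first.
  by move=> x Lx; rewrite (phiL0 x Lx) mulr0.
apply: eq_Rintegral => x _; rewrite patchE.
have [Kx|Kx] := pselect (K x); first by rewrite (mem_set Kx); ring.
by rewrite (phi0 x Kx) !mul0r !mulr0.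
Qed.


End harmonic_weak_solution.

Theorem theorem1 (R : realType) (n : nat) (Omega : set 'rV[R]_n)
    (d : 'rV[R]_n -> 'rV[R]_n -> R) (w : 'rV[R]_n -> R) (l : nat)
    (Omega_open : open Omega) (d_norm : norm_induced d)
    (w_L1loc : L1_loc Omega w)
    (w_gt0 : {ae lebesgue_rV R n, forall x, Omega x -> 0 < w x})
    (l_ge1 : (1 <= l)%N)
    (w_sobolev : sobolev_infty_loc Omega (2 * l) w)
    (u : 'rV[R]_n -> R) (u_harmonic : strongly_harmonic Omega d w u)
    (k : nat) (k_bounds : (1 <= k <= l)%N) :
  weak_solution Omega d w u (2 * k).
Proof.
have [N hN dE] := d_norm.
have {}dE : d = fun x y => N (x - y) by apply/funext => x; apply/funext => y; exact: dE.
rewrite {d d_norm}dE in u_harmonic *.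
have kl : (2 * k <= 2 * l)%N by rewrite leq_mul2l; have /andP[_ ->] := k_bounds.
split=> [a ak|Dw HDw].
  by have [g wg _] := w_sobolev a (leq_trans (eq_leq ak) kl); exists g.
split=> [a ak|phi tphi].
  have [_ LD _] := HDw a ak.
  exact: (harmonic_L1_loc hN Omega_open w_L1loc w_gt0 u_harmonic LD).
have key := harmonic_moment_identity hN Omega_open w_L1loc w_gt0 u_harmonic kl w_sobolev
  tphi HDw.
rewrite fsum_mi_deg.
transitivity ((-1) ^+ (2 * k) * (\sum_(a <- mi_seq (2 * k)) ball_moment N a *
    \int[lebesgue_rV R n]_(x in Omega) (u x * w x * mi_derive a phi x)) -
  \sum_(a <- mi_seq (2 * k)) ball_moment N a *
    \int[lebesgue_rV R n]_(x in Omega) (phi x * (u x * Dw a x))).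
  rewrite mulr_sumr -sumrB big_seq [RHS]big_seq; apply: eq_bigr => a.
  rewrite mem_mi_seq => /eqP ak; rewrite pde_coef_ball_moment// ak mulrBr.
  by apply: (congr1 (fun z => z - _)); rewrite mulrCA.
(* The sign from the distributional derivative and the sign in the identity multiply to 1. *)
by rewrite key mulrA -exprD -signr_odd oddD addbb expr0 mul1r subrr.
Qed.
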